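(* Let $(X_1,X_2,\ldots)$ be a stationary sequence of real random variables and let $M_n=\max_{1\le k\le n}X_k$, $n\ge1$. Assume that for some sequence $a_n\to\infty$ and a stochastic process $(Y(t),t\ge0)$ such that $P(Y(t)=Y(1))<1$ for every $t\ne1$, $$\left(\frac1{a_n}M_{\lfloor nt\rfloor},\ t\ge0\right)\Rightarrow\bigl(Y(t),\ t\ge0\bigr)$$ in the sense of convergence of finite-dimensional distributions. Then $(Y(t),t\ge0)$ is self-similar with some exponent $H>0$ of self-similarity, and it has stationary max-increments. Furthermore, $(Y(t),t\ge0)$ is continuous in probability, and the sequence $(a_n)$ is regularly varying with index $H$.
   Context: A process $(Y(t),t\ge0)$ is self-similar with exponent $H$ if for every $c>0$, $(Y(ct),t\ge0)\stackrel{d}{=}(c^HY(t),t\ge0)$ in the sense of equality of finite-dimensional distributions. A process $(Y(t),t\ge0)$ has stationary max-increments if for every $r\ge0$ there exists, perhaps on an enlarged probability space, a stochastic process $(Y^{(r)}(t),t\ge0)$ such that $(Y^{(r)}(t),t\ge0)\stackrel{d}{=}(Y(t),t\ge0)$ and $(Y(t+r),t\ge0)\stackrel{d}{=}(Y(r)\vee Y^{(r)}(t),t\ge0)$ (equalities of finite-dimensional distributions). Convention: the maximum over an empty index set is $0$, so $M_0=0$. *)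

(* Defs.v *)
From HB Require Import structures.
From mathcomp Require Import all_boot all_order all_algebra.
From mathcomp Require Import all_classical all_reals all_analysis.

Set Implicit Arguments.
Unset Strict Implicit.
Unset Printing Implicit Defensive.

Import Order.TTheory GRing.Theory Num.Theory.
Import numFieldNormedType.Exports.

Local Open Scope classical_set_scope.
Local Open Scope ring_scope.

(* Continuous-time processes are families [Y : R -> {RV P >-> R}] of which only
   the times [t >= 0] matter: every notion below restricts to them. *)

Section finite_dimensional_distributions.
Context (R : realType) (I : Type).

(* Equality of the finite-dimensional distributions of two processes, possibly
   on different probability spaces, over the times in [D]; [k.-tuple R] carries
   the product sigma-algebra. *)
Definition fdd_eq (D : set I)
    (d1 : measure_display) (T1 : measurableType d1) (P1 : probability T1 R)
    (Y1 : I -> T1 -> R)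
    (d2 : measure_display) (T2 : measurableType d2) (P2 : probability T2 R)
    (Y2 : I -> T2 -> R) : Prop :=
  forall (k : nat) (t : 'I_k -> I), (forall i, D (t i)) ->
  forall B : set (k.-tuple R), measurable B ->
    P1 [set w | B [tuple Y1 (t i) w | i < k]] =
    P2 [set w | B [tuple Y2 (t i) w | i < k]].

(* Weak convergence of the finite-dimensional distributions, tested against
   bounded continuous functions on R^k. *)
Definition fdd_cvg (D : set I)
    (d1 : measure_display) (T1 : measurableType d1) (P1 : probability T1 R)
    (Z : nat -> I -> T1 -> R)
    (d2 : measure_display) (T2 : measurableType d2) (P2 : probability T2 R)
    (Y : I -> T2 -> R) : Prop :=
  forall (k : nat) (t : 'I_k -> I), (forall i, D (t i)) ->
  forall f : 'rV[R]_k -> R, continuous f ->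
    (exists C : R, forall x, `|f x| <= C) ->
    ('E_P1[fun w => f (\row_(i < k) Z n (t i) w)])%E @[n --> \oo] -->
    ('E_P2[fun w => f (\row_(i < k) Y (t i) w)])%E.

End finite_dimensional_distributions.

Section processes.
Context (R : realType) (d : measure_display) (T : measurableType d)
  (P : probability T R).

(* The sequence is [X 1, X 2, ...]; the value [X 0] plays no role. *)
Definition stationary (X : nat -> {RV P >-> R}) : Prop :=
  forall h : nat,
    fdd_eq [set k | (1 <= k)%N] P (fun k w => X (k + h)%N w)
                                P (fun k w => X k w).

(* The default value [X 1] of the iterated maximum is one of its terms when
   [n >= 1], hence harmless even if all the [X k] are negative. *)
Definition partial_max (X : nat -> {RV P >-> R}) (n : nat) (w : T) : R :=
  if n is 0%N then 0 else \big[Num.max/X 1%N w]_(1 <= k < n.+1) X k w.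

Definition self_similar (H : R) (Y : R -> {RV P >-> R}) : Prop :=
  forall c : R, 0 < c ->
    fdd_eq [set t | 0 <= t] P (fun t w => Y (c * t) w)
                            P (fun t w => c `^ H * Y t w).

(* An enlargement of [(T, P)] is a probability space [(T', P')] with a
   measure-preserving map [p : T' -> T], along which the random variables on
   [T] are transported. *)
Definition stationary_max_increments (Y : R -> {RV P >-> R}) : Prop :=
  forall r : R, 0 <= r ->
  exists (d' : measure_display) (T' : measurableType d')
         (P' : probability T' R) (p : T' -> T) (Yr : R -> {RV P' >-> R}),
    [/\ measurable_fun setT p,
        forall A : set T, measurable A -> P' (p @^-1` A) = P A,
        fdd_eq [set t | 0 <= t] P' (fun t w => Yr t w) P (fun t w => Y t w) &
        fdd_eq [set t | 0 <= t] P (fun t w => Y (t + r) w)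
                                P' (fun t w => Num.max (Y r (p w)) (Yr t w))].

Definition continuous_in_probability (Y : R -> {RV P >-> R}) : Prop :=
  forall t : R, 0 <= t -> forall e : R, 0 < e ->
    P [set w | e <= `|Y s w - Y t w|]
      @[s --> within [set s | 0 <= s] (nbhs t)] --> 0%E.

End processes.

Definition regularly_varying (R : realType) (H : R) (a : nat -> R) : Prop :=
  (\forall n \near \oo, 0 < a n) /\
  forall c : R, 0 < c ->
    a (Num.truncn (c * n%:R)) / a n @[n --> \oo] --> c `^ H.

(* Main.v *)
(** Write [Z_n(t)] for the normalized maxima and [[x]] for the integer part of [x].
    The integer parts of [n c t] and [[c n] t] differ by a bounded amount, and by
    stationarity the maximum of boundedly many consecutive [X]'s is negligible
    against [a_n]; hence
    [a_[cn] / a_n * Z_[cn](t)] and [Z_n(c t)] have the same limit.  The limit [Y]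
    is nonnegative and nondecreasing and no [Y(t)], [t > 0], vanishes almost
    surely, so a convergence of types argument yields
    [a_[cn] / a_n --> rho(c)] and [Y(c .) = rho(c) Y(.)] in law.  As [rho] is
    multiplicative and monotone it is a power [c^H], with [H > 0] since
    [Y(2) <> Y(1)].  Continuity in probability follows from self-similarity and
    monotonicity.

    For the max-increments, the pairs formed by the maximum up to [n r] and the
    maxima over the following blocks, at dyadic times, converge along an
    ultrafilter to a limit law carried by a sequence of random bits (a uniform
    variable is split according to the limiting cylinder probabilities).
    Radon-Nikodym derivatives with respect to the law of [Y(r)] then allow these
    bits to be redrawn on [T' * R], conditionally on the original [Y(r)], and
    right limits over dyadic times give the process at all times.

    All laws are tested through [phi x = x^+ / (1 + x^+)] and the functions
    [ramp], which are antitone, Lipschitz, and stable under replacing a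
    coordinate by a maximum of two. *)
Require Import Defs.
From HB Require Import structures.
From mathcomp Require Import all_boot all_order all_algebra.
From mathcomp Require Import all_classical all_reals all_analysis.
From mathcomp Require Import measurable_realfun.
From mathcomp Require Import ring lra zify.

Set Implicit Arguments.
Unset Strict Implicit.
Unset Printing Implicit Defensive.

Import Order.TTheory GRing.Theory Num.Theory.
Import numFieldNormedType.Exports.

Local Open Scope classical_set_scope.
Local Open Scope ring_scope.

(** Limits in law are handled through means of bounded functions. For convergence of types one mean
    is enough: [G l = E phi (l Y(1))] is strictly increasing in [l], because [Y(1)] is nonnegative
    and not almost surely equal to [Y(0) = 0]. Comparing two limits of means then pins down [a_[cn]
    / a_n] without tightness or subsequences.

    Max-increments must be realized on an extension of the space of the given [Y] and coupled with
    that very [Y(r)], whereas the block maxima live on the space of the [X]'s and their joint limit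
    on a third space; only the law of [Y(r)] is common. So a conditional law given [Y(r)] has to be
    moved. For bits it amounts to countably many real functions, one for each finite word, which
    replaces a regular conditional distribution on a space of paths and explains why countably many
    times come first.

    The hypothesis controls the maximum up to [n r], the following blocks, and their maxima, but not
    their joint law. An ultrafilter picks some joint limit; any choice works, since only these
    quantities enter the conclusion. *)

(** * Expectations of bounded random variables *)

Section bounded_expectation.
Context (R : realType) (d : measure_display) (T : measurableType d)
  (P : probability T R).
Implicit Types f g : T -> R.

Definition bounded_measurable f :=
  measurable_fun setT f /\ exists C : R, forall w, `|f w| <= C.

Lemma bm_integrable f : bounded_measurable f -> P.-integrable setT (EFin \o f).
Proof.
move=> [mf [C fC]]; apply: measurable_bounded_integrable => //.
  by rewrite -ge0_fin_numE// fin_num_measure.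
by exists `|C|; split; rewrite ?num_real// => x Cx w _ /=;
  rewrite (le_trans (fC w))// (le_trans (ler_norm _))// ltW.
Qed.

Definition Ex f : R := \int[P]_w f w.

Lemma Ex_EFin f : bounded_measurable f -> (Ex f)%:E = (\int[P]_w (f w)%:E)%E.
Proof.
by move=> bf; rewrite /Ex /Rintegral fineK//; apply: integrable_fin_num => //;
  exact: bm_integrable.
Qed.

Lemma Ex_expectation f : bounded_measurable f -> ('E_P[f])%E = (Ex f)%:E.
Proof. by move=> bf; rewrite Ex_EFin// unlock. Qed.

Lemma bm_cst (c : R) : bounded_measurable (fun=> c).
Proof. by split=> //; exists `|c|. Qed.

Lemma bmD f g : bounded_measurable f -> bounded_measurable g ->
  bounded_measurable (fun w => f w + g w).
Proof.
move=> [mf [C fC]] [mg [D gD]]; split; first exact: measurable_funD.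
by exists (C + D) => w; rewrite (le_trans (ler_normD _ _))// lerD.
Qed.

Lemma bmM f g : bounded_measurable f -> bounded_measurable g ->
  bounded_measurable (fun w => f w * g w).
Proof.
move=> [mf [C fC]] [mg [D gD]]; split; first exact: measurable_funM.
by exists (C * D) => w; rewrite normrM ler_pM.
Qed.

Lemma bmN f : bounded_measurable f -> bounded_measurable (fun w => - f w).
Proof.
move=> [mf [C fC]]; split; first exact: measurableT_comp.
by exists C => w; rewrite normrN.
Qed.

Lemma bm_sum (I : Type) (s : seq I) (F : I -> T -> R) :
  (forall i, bounded_measurable (F i)) ->
  bounded_measurable (fun w => \sum_(i <- s) F i w).
Proof.
move=> bF; elim: s => [|i s IHs].
  by under eq_fun do rewrite big_nil; exact: bm_cst.
by under eq_fun do rewrite big_cons; exact: bmD.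
Qed.

Lemma bm_norm f : bounded_measurable f -> bounded_measurable (fun w => `|f w|).
Proof.
move=> [mf [C fC]]; split; first exact: measurableT_comp.
by exists C => w; rewrite normr_id.
Qed.

Lemma bm01 f : measurable_fun setT f -> (forall w, 0 <= f w <= 1) ->
  bounded_measurable f.
Proof. by move=> mf f01; split=> //; exists 1 => w; have := f01 w; rewrite ler_norml; lra. Qed.

Lemma ExD f g : bounded_measurable f -> bounded_measurable g ->
  Ex (fun w => f w + g w) = Ex f + Ex g.
Proof. by move=> bf bg; rewrite /Ex RintegralD//; exact: bm_integrable. Qed.

Lemma ExB f g : bounded_measurable f -> bounded_measurable g ->
  Ex (fun w => f w - g w) = Ex f - Ex g.
Proof. by move=> bf bg; rewrite /Ex RintegralB//; exact: bm_integrable. Qed.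

Lemma ExZ (c : R) f : bounded_measurable f -> Ex (fun w => c * f w) = c * Ex f.
Proof. by move=> bf; rewrite /Ex RintegralZl//; exact: bm_integrable. Qed.

Lemma Ex_cst (c : R) : Ex (fun=> c) = c.
Proof.
rewrite /Ex Rintegral_cst//= (_ : _ [set: T] = 1%E) ?mulr1//.
exact: probability_setT.
Qed.

Lemma Ex_sum (I : Type) (s : seq I) (F : I -> T -> R) :
  (forall i, bounded_measurable (F i)) ->
  Ex (fun w => \sum_(i <- s) F i w) = \sum_(i <- s) Ex (F i).
Proof.
move=> bF; elim: s => [|i s IHs].
  by under eq_fun do rewrite big_nil; rewrite Ex_cst big_nil.
under eq_fun do rewrite big_cons.
by rewrite ExD//; [rewrite big_cons IHs|exact: bm_sum].
Qed.

Lemma Ex_le f g : bounded_measurable f -> bounded_measurable g ->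
  (forall w, f w <= g w) -> Ex f <= Ex g.
Proof. by move=> bf bg fg; apply: le_Rintegral => //; exact: bm_integrable. Qed.

Lemma Ex_ge0 f : (forall w, 0 <= f w) -> 0 <= Ex f.
Proof. by move=> f0; exact: Rintegral_ge0. Qed.

Lemma Ex_ae f g : bounded_measurable f -> bounded_measurable g ->
  {ae P, forall w, f w = g w} -> Ex f = Ex g.
Proof.
move=> [mf _] [mg _] fg; congr fine; apply: ae_eq_integral => //;
  [exact/measurable_EFinP|exact/measurable_EFinP|].
by apply: filterS fg => w fgw _ /=; rewrite fgw.
Qed.

(** The maximum of [f] and [g] dominates [f] everywhere and equals [g] almost everywhere. *)
Lemma Ex_le_ae f g : bounded_measurable f -> bounded_measurable g ->
  {ae P, forall w, f w <= g w} -> Ex f <= Ex g.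
Proof.
move=> bf bg fg.
have bh : bounded_measurable (fun w => Num.max (f w) (g w)).
  move: (bf) (bg) => [mf [C fC]] [mg [D gD]]; split; first exact: measurable_maxr.
  exists (C + D) => w; have := fC w; have := gD w.
  by rewrite !ler_norml ge_max le_max => /andP[? ?] /andP[? ?];
    apply/andP; split; [apply/orP; left|apply/andP; split]; lra.
rewrite (@Ex_ae g (fun w => Num.max (f w) (g w)))//.
  by apply: Ex_le => // w; rewrite le_max lexx.
by apply: filterS fg => w /max_idPr ->.
Qed.

Lemma Ex_norm_le f : bounded_measurable f -> `|Ex f| <= Ex (fun w => `|f w|).
Proof. by move=> bf; apply: le_normr_Rintegral => //; exact: bm_integrable. Qed.

Lemma Ex_eq0 f : bounded_measurable f -> (forall w, 0 <= f w) -> Ex f = 0 ->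
  {ae P, forall w, f w = 0}.
Proof.
move=> bf f0 Ef.
have : ae_eq P setT (fun w => (f w)%:E) (cst 0%E).
  apply/ae_eq_integral_abs => //; first by apply/measurable_EFinP; case: bf.
  under eq_integral do rewrite gee0_abs ?lee_fin//.
  by rewrite -Ex_EFin// Ef.
by apply: filterS => w /(_ I) /= [].
Qed.

Lemma Ex_indic (A : set T) : measurable A -> (Ex (\1_A))%:E = P A.
Proof.
move=> mA; rewrite Ex_EFin; first by rewrite integral_indic// setIT.
by apply: bm01 => // w; rewrite indicE; case: (_ \in _); rewrite /= ?lexx ler01.
Qed.

Lemma Ex_cvg (f_ : nat -> T -> R) f (C : R) :
  (forall n, measurable_fun setT (f_ n)) -> measurable_fun setT f ->
  (forall n w, `|f_ n w| <= C) ->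
  {ae P, forall w, f_ n w @[n --> \oo] --> f w} ->
  Ex (f_ n) @[n --> \oo] --> Ex f.
Proof.
move=> mf_ mf fC f_f.
have [] := @dominated_convergence _ _ _ P setT measurableT
  (fun n w => (f_ n w)%:E) (fun w => (f w)%:E) (cst C%:E).
- by move=> n; exact/measurable_EFinP.
- exact/measurable_EFinP.
- by apply: filterS f_f => w h _; apply: cvg_EFin => //; exact: nearW.
- exact: (bm_integrable (bm_cst C)).
- by apply: aeW => w n _ /=; rewrite lee_fin.
- move=> intf _ h.
  apply: fine_cvg; rewrite fineK//.
  exact: integrable_fin_num.
Qed.

End bounded_expectation.

Ltac case_minmax := rewrite ?maxEle; repeat (case: ifPn; rewrite -?ltNge => ?);
  rewrite ?minEle; repeat (case: ifPn; rewrite -?ltNge => ?).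

(** * Test functions *)

Section clamp_phi.
Context (R : realType).
Implicit Types x y : R.

Definition clamp x : R := Num.min 1 (Num.max 0 x).

Lemma ler_min2 (a b c e : R) : a <= b -> c <= e -> Num.min a c <= Num.min b e.
Proof. by case_minmax; lra. Qed.

Lemma clamp01 x : 0 <= clamp x <= 1.
Proof. by rewrite /clamp; case_minmax; lra. Qed.

Lemma clamp_ge0 x : 0 <= clamp x.
Proof. by case/andP: (clamp01 x). Qed.

Lemma clamp_le1 x : clamp x <= 1.
Proof. by case/andP: (clamp01 x). Qed.

Lemma clamp_le0 x : x <= 0 -> clamp x = 0.
Proof. by rewrite /clamp => ?; case_minmax; lra. Qed.

Lemma clamp_ge1 x : 1 <= x -> clamp x = 1.
Proof. by rewrite /clamp => ?; case_minmax; lra. Qed.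

Lemma clamp_id x : 0 <= x <= 1 -> clamp x = x.
Proof. by rewrite /clamp => ?; case_minmax; lra. Qed.

Lemma le_clamp x y : x <= y -> clamp x <= clamp y.
Proof. by rewrite /clamp => ?; case_minmax; lra. Qed.

Lemma clampD x y : clamp (x + y) <= clamp x + clamp y.
Proof. by rewrite /clamp; case_minmax; lra. Qed.

Lemma clamp_le_norm x : clamp x <= `|x|.
Proof. by rewrite /clamp; have := ler_norm x; have := normr_ge0 x; case_minmax; lra. Qed.

Lemma measurable_clamp : measurable_fun setT clamp.
Proof.
apply: measurable_minr => //; apply: measurable_maxr => //; exact: measurable_id.
Qed.

Lemma continuous_clamp : continuous clamp.
Proof.
move=> x; rewrite /clamp; apply: continuous_min; first exact: cvg_cst.
by apply: continuous_max; [exact: cvg_cst|exact: cvg_id].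
Qed.

(** An increasing bijection from [[0, +oo[] onto [[0, 1[], constant on the negative half-line, so
    that it does not separate a maximum from its positive part. *)
Definition phi x : R := Num.max 0 x / (1 + Num.max 0 x).

Lemma max0_ge0 x : 0 <= Num.max 0 x.
Proof. by rewrite le_max lexx. Qed.

Lemma phi_max0 x : phi (Num.max 0 x) = phi x.
Proof. by rewrite /phi maxA maxxx. Qed.

Lemma phiE x : 0 <= x -> phi x = x / (1 + x).
Proof. by move=> x0; rewrite /phi (max_idPr x0). Qed.

Lemma phi_le0 x : x <= 0 -> phi x = 0.
Proof. by move=> x0; rewrite /phi (max_idPl x0) mul0r. Qed.

Lemma phi0 : phi 0 = 0. Proof. exact: phi_le0. Qed.

Lemma phi_ge0 x : 0 <= phi x.
Proof. by rewrite /phi divr_ge0// ?addr_ge0// max0_ge0. Qed.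

Lemma phi_lt1 x : phi x < 1.
Proof.
by rewrite /phi; have := max0_ge0 x => h; rewrite ltr_pdivrMr; lra.
Qed.

Lemma phiB x y : 0 <= x -> 0 <= y ->
  phi y - phi x = (y - x) / ((1 + x) * (1 + y)).
Proof. by move=> x0 y0; rewrite !phiE//; field; apply/andP; split; lra. Qed.

Lemma lt_phi x y : 0 <= x -> x < y -> phi x < phi y.
Proof.
move=> x0 xy; rewrite -subr_gt0 phiB//; last by lra.
by rewrite divr_gt0 ?mulr_gt0//; lra.
Qed.

Lemma le_phi x y : x <= y -> phi x <= phi y.
Proof.
move=> xy; have [x0|x0] := leP x 0; first by rewrite (phi_le0 x0) phi_ge0.
by move: xy; rewrite le_eqVlt => /predU1P[->//|xy]; rewrite ltW// lt_phi// ltW.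
Qed.

Lemma phi_max x y : phi (Num.max x y) = Num.max (phi x) (phi y).
Proof.
by have [xy|/ltW xy] := leP x y; apply/esym; [apply/max_idPr|apply/max_idPl];
  exact: le_phi.
Qed.

Lemma phi_subadd x y : 0 <= x -> 0 <= y -> phi (Num.max x y) <= phi x + phi y.
Proof.
move=> x0 y0; rewrite phi_max; have := phi_ge0 x; have := phi_ge0 y.
by case_minmax; lra.
Qed.

(* the inverse of [phi] on [[0, 1[] *)
Definition psi y : R := y / (1 - y).

Lemma psiK x : 0 <= x -> psi (phi x) = x.
Proof.
move=> x0; rewrite /psi phiE//.
rewrite (_ : 1 - x / (1 + x) = (1 + x)^-1); last by field; lra.
by rewrite invrK divfK//; lra.
Qed.

Lemma continuous_phi : continuous phi.
Proof.
move=> x; rewrite /phi.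
have c : {for x, continuous (fun y => Num.max 0 y)}.
  by apply: continuous_max; [exact: cvg_cst|exact: cvg_id].
apply: cvgM; first exact: c.
apply: cvgV; first by have := max0_ge0 x; lra.
by apply: cvgD; [exact: cvg_cst|exact: c].
Qed.

Lemma measurable_phi : measurable_fun setT phi.
Proof. exact: continuous_measurable_fun continuous_phi. Qed.

Lemma measurable_invr : measurable_fun setT (GRing.inv : R -> R).
Proof.
(* The power [-1] inverts nonnegative reals only, hence the square; at [0] both sides are [0] by
   convention. *)
rewrite (_ : GRing.inv = fun x : R => x * (x ^+ 2) `^ (-1)).
  apply: measurable_funM; first exact: measurable_id.
  apply: (measurableT_comp (measurable_powR (-1))); exact: exprn_measurable.
apply/funext => x; rewrite powR_inv1 ?sqr_ge0//.
by have [->|x0] := eqVneq x 0; [rewrite invr0 mul0r|field].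
Qed.

Lemma measurable_psi : measurable_fun setT psi.
Proof.
apply: measurable_funM; first exact: measurable_id.
apply: (measurableT_comp measurable_invr).
apply: measurable_funB; [exact: measurable_cst|exact: measurable_id].
Qed.

End clamp_phi.

(* [ramp s m u] tends, for [p.2 = 1 + m * x_p] and [m] to infinity, to the
   indicator of the closed box [u p.1 <= x_p, p in s]. *)
Section ramp.
Context (R : realType) (I : choiceType).
Implicit Types (s : seq (I * R)) (m : R) (u v : I -> R).

Definition ramp s m u : R :=
  \big[Num.min/1]_(p <- s) clamp (p.2 - m * u p.1).

Lemma ramp_nil m u : ramp [::] m u = 1.
Proof. by rewrite /ramp big_nil. Qed.

Lemma ramp_cons p s m u :
  ramp (p :: s) m u = Num.min (clamp (p.2 - m * u p.1)) (ramp s m u).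
Proof. by rewrite /ramp big_cons. Qed.

Lemma ramp01 s m u : 0 <= ramp s m u <= 1.
Proof.
elim: s => [|p s /andP[r0 r1]]; first by rewrite ramp_nil ler01 lexx.
by rewrite ramp_cons le_min clamp_ge0 r0 ge_min r1 orbT.
Qed.

Lemma eq_ramp s m u v : (forall p, p \in s -> u p.1 = v p.1) ->
  ramp s m u = ramp s m v.
Proof. by move=> uv; apply: eq_big_seq => p /uv ->. Qed.

Lemma ramp_le s m u v : 0 <= m -> (forall p, p \in s -> u p.1 <= v p.1) ->
  ramp s m v <= ramp s m u.
Proof.
move=> m0; elim: s => [|p s IHs] uv; first by rewrite !ramp_nil.
have IH : ramp s m v <= ramp s m u.
  by apply: IHs => q qs; apply: uv; rewrite inE qs orbT.
have uvp : clamp (p.2 - m * v p.1) <= clamp (p.2 - m * u p.1).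
  by apply: le_clamp; rewrite lerD2l lerN2 ler_wpM2l// uv ?mem_head.
by rewrite !ramp_cons; apply: ler_min2.
Qed.

(** By subadditivity of [clamp] each term of the minimum moves by at most its own increment. The
    bound is one-sided: coordinates with [v <= u] cost nothing when [m >= 0]. *)
Lemma ramp_diff s m u v : ramp s m u <=
  ramp s m v + \sum_(p <- s) clamp (m * (v p.1 - u p.1)).
Proof.
elim: s => [|p s IHs]; first by rewrite !ramp_nil big_nil addr0.
rewrite !ramp_cons big_cons.
have := clampD (p.2 - m * v p.1) (m * (v p.1 - u p.1)).
rewrite (_ : _ - _ + _ = p.2 - m * u p.1); last by ring.
have := clamp_ge0 (m * (v p.1 - u p.1)).
have : 0 <= \sum_(q <- s) clamp (m * (v q.1 - u q.1)).
  by apply: sumr_ge0 => *; exact: clamp_ge0.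
by move: IHs; case_minmax; lra.
Qed.

Context (d : measure_display) (T : measurableType d).

Lemma measurable_ramp s m (U : I -> T -> R) :
  (forall p, p \in s -> measurable_fun setT (U p.1)) ->
  measurable_fun setT (fun w => ramp s m (U^~ w)).
Proof.
elim: s => [|p s IHs] mU.
  by under eq_fun do rewrite ramp_nil; exact: measurable_cst.
under eq_fun do rewrite ramp_cons.
apply: measurable_minr; last by apply: IHs => q qs; apply: mU; rewrite inE qs orbT.
apply: (measurableT_comp (@measurable_clamp R)).
apply: measurable_funB; first exact: measurable_cst.
by apply: measurable_funM; [exact: measurable_cst|apply: mU; rewrite mem_head].
Qed.

Lemma bm_ramp s m (U : I -> T -> R) :
  (forall p, p \in s -> measurable_fun setT (U p.1)) ->
  bounded_measurable (fun w => ramp s m (U^~ w)).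
Proof. by move=> mU; apply: bm01 => [|w]; [exact: measurable_ramp|exact: ramp01]. Qed.

End ramp.

(* a maximum inside the test function only lengthens the index list *)
Lemma ramp_max (R : realType) (I J : choiceType) (s : seq (J * R)) (m : R)
    (u : I -> R) (i0 : I) (f : J -> I) : 0 <= m ->
  ramp s m (fun j => Num.max (u i0) (u (f j))) =
  ramp (flatten [seq [:: (i0, p.2); (f p.1, p.2)] | p <- s]) m u.
Proof.
move=> m0; elim: s => [|p s IHs] /=; first by rewrite !ramp_nil.
rewrite !ramp_cons IHs minA; congr Num.min => /=.
have [h|/ltW h] := leP (u i0) (u (f p.1)); apply/esym;
  [apply/min_idPr|apply/min_idPl];
  by apply: le_clamp; rewrite lerD2l lerN2 ler_wpM2l.
Qed.

(** * Finite-dimensional laws *)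

Lemma measurable_forall_fin (d : measure_display) (T : measurableType d)
    (I : finType) (A : I -> set T) :
  (forall i, measurable (A i)) -> measurable [set w | forall i, A i w].
Proof.
move=> mA; rewrite (_ : [set w | _] = \bigcap_(i in [set: I]) A i).
  by apply: fin_bigcap_measurable => // i _; exact: mA.
by apply/seteqP; split=> w /= Aw i; [move=> _|]; exact: Aw.
Qed.

Lemma measurable_le_set (R : realType) (d : measure_display)
    (T : measurableType d) (f : T -> R) (x : R) :
  measurable_fun setT f -> measurable [set w | f w <= x].
Proof.
move=> mf; rewrite (_ : [set w | _] = f @^-1` `]-oo, x]).
  by rewrite -[X in measurable X]setTI; apply: mf => //; exact: measurable_itv.
by apply/seteqP; split=> w /=; rewrite in_itv.
Qed.

Lemma measurable_lt_set (R : realType) (d : measure_display)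
    (T : measurableType d) (f : T -> R) (x : R) :
  measurable_fun setT f -> measurable [set w | x < f w].
Proof.
move=> mf; rewrite (_ : [set w | _] = f @^-1` `]x, +oo[).
  by rewrite -[X in measurable X]setTI; apply: mf => //; exact: measurable_itv.
by apply/seteqP; split=> w /=; rewrite in_itv /= andbT.
Qed.

Section closed_boxes.
Context (R : realType) (k : nat).

Definition closed_box (x : 'I_k -> R) : set (k.-tuple R) :=
  [set y | forall i, tnth y i <= x i].

Lemma measurable_closed_box x : measurable (closed_box x).
Proof.
apply: measurable_forall_fin => i; apply: measurable_le_set.
exact: measurable_tnth.
Qed.

Let G : set (set (k.-tuple R)) := range closed_box.

Lemma measurable_tupleE : @measurable _ (k.-tuple R) = <<s G >>.
Proof.
apply/seteqP; split; last first.
  apply: smallest_sub; first exact: sigma_algebra_measurable.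
  by move=> _ [x _ <-]; exact: measurable_closed_box.
apply: smallest_sub; first exact: smallest_sigma_algebra.
rewrite -bigcup_seq; apply: bigcup_sub => i _ _ [B mB <-].
have mi : measurable_fun [set: g_sigma_algebraType G]
    (fun y : k.-tuple R => tnth y i : R).
  apply: (measurability _ (RGenOInfty.measurableE R)) => _ [_ [a ->] <-].
  rewrite setTI (_ : _ @^-1` _ = ~` [set y : k.-tuple R | tnth y i <= a]);
    last first.
    by apply/seteqP; split=> y /=; rewrite in_itv /= andbT ltNge => /negP.
  apply: (@measurableC _ (g_sigma_algebraType G)).
  (* A half-space bounding the coordinate [i] is the union of the boxes whose other sides are at
     [n]. *)
  pose x n j : R := if j == i then a else n%:R.
  rewrite (_ : [set y | _] = \bigcup_n closed_box (x n)).
    by apply: bigcup_measurable => n _; apply: sub_sigma_algebra; exists (x n).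
  apply/seteqP; split=> y /=; last by move=> [n _ /(_ i)]; rewrite /x eqxx.
  move=> yi; exists (\max_(j < k) Num.truncn `|tnth y j|).+1 => // j.
  rewrite /x; case: eqP => [->//|_].
  apply: (le_trans (ler_norm _)); apply/ltW/(lt_le_trans (Num.Theory.truncnS_gt _)).
  by rewrite ler_nat ltnS; exact: (@leq_bigmax _ (fun j => Num.truncn `|tnth y j|)).
by have := mi measurableT B mB.
Qed.

(** Closed boxes generate the sigma-algebra, are stable under intersection and exhaust the space, so
    Dynkin's uniqueness theorem applies. *)
Lemma closed_box_unique (mu1 mu2 : {finite_measure set (k.-tuple R) -> \bar R}) :
  (forall x, mu1 (closed_box x) = mu2 (closed_box x)) ->
  forall B, measurable B -> mu1 B = mu2 B.
Proof.
move=> mu12 B mB.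
apply: (measure_unique G (fun n => closed_box (fun=> n%:R))) => //.
- exact measurable_tupleE.
- move=> _ _ [x _ <-] [y _ <-]; exists (fun i => Num.min (x i) (y i)) => //.
  apply/seteqP; split=> z /=.
    by move=> h; split=> i; have := h i; rewrite le_min => /andP[].
  by move=> [h1 h2] i; rewrite le_min h1 h2.
- by move=> n; exists (fun=> n%:R).
- apply/seteqP; split=> // y _; exists (\max_(j < k) Num.truncn `|tnth y j|).+1 => // j.
  apply: (le_trans (ler_norm _)); apply/ltW/(lt_le_trans (Num.Theory.truncnS_gt _)).
  by rewrite ler_nat ltnS; exact: (@leq_bigmax _ (fun j => Num.truncn `|tnth y j|)).
- by move=> _ [x _ <-]; exact: mu12.
- move=> n; rewrite -ge0_fin_numE//; apply: fin_num_measure.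
  exact: measurable_closed_box.
Qed.

End closed_boxes.

Section joint_law.
Context (R : realType) (I : choiceType).
Context (d : measure_display) (T : measurableType d) (P : probability T R).
Context (k : nat) (U : I -> T -> R) (t : 'I_k -> I).
Hypothesis mU : forall i, measurable_fun setT (U (t i)).

Definition joint w : k.-tuple R := [tuple U (t i) w | i < k].

Lemma measurable_joint : measurable_fun setT joint.
Proof.
apply/measurable_fun_tnthP => i; rewrite (_ : _ \o _ = U (t i))//.
by apply/funext => w /=; rewrite tnth_mktuple.
Qed.

Definition joint_law : probability (k.-tuple R) R :=
  distribution P (mfun_Sub (mem_set measurable_joint)).

Lemma joint_lawE B : joint_law B = P [set w | B (joint w)].
Proof. by []. Qed.

Lemma joint_law_box x :
  joint_law (closed_box x) = P [set w | forall i, U (t i) w <= x i].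
Proof.
rewrite joint_lawE; congr (P _); apply/seteqP; split=> w /= h i; have := h i;
  by rewrite tnth_mktuple.
Qed.

Lemma Ex_joint (g : k.-tuple R -> R) : measurable_fun setT g ->
  (forall y, 0 <= g y <= 1) ->
  (Ex P (fun w => g (joint w)))%:E = (\int[joint_law]_y (g y)%:E)%E.
Proof.
move=> mg g01; rewrite Ex_EFin; last first.
  apply: bm01 => [|w]; last exact: g01.
  by apply: measurableT_comp => //; exact: measurable_joint.
rewrite (_ : joint_law = pushforward P joint :> (_ -> _))//.
rewrite (ge0_integral_pushforward measurable_joint)//.
  exact/measurable_EFinP.
by move=> y _; rewrite lee_fin; case/andP: (g01 y).
Qed.

End joint_law.

(** With thresholds [1 + n x_i] the ramp is [1] on the closed box, and it is [0] at a point outside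
    as soon as [n (U - x) >= 1] for one violated side. Hence the convergence is pointwise, and
    dominated by [1]. *)
Lemma Ex_ramp_box (R : realType) (I : choiceType) (d : measure_display) (T : measurableType d)
    (P : probability T R) (U : I -> T -> R) k (t : 'I_k -> I) (x : 'I_k -> R) :
  (forall i, measurable_fun setT (U (t i))) ->
  Ex P (fun w => ramp [seq (t i, 1 + n%:R * x i) | i <- enum 'I_k] n%:R (U^~ w))
    @[n --> \oo] --> fine (P [set w | forall i, U (t i) w <= x i]).
Proof.
move=> mU; set A := [set w | _].
have mA : measurable A.
  by apply: measurable_forall_fin => i; exact: measurable_le_set.
rewrite -(Ex_indic P mA) /=.
apply: (@Ex_cvg _ _ _ _ _ _ 1).
- by move=> n; apply: measurable_ramp => _ /mapP[i _ ->] /=.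
- exact: measurable_indic.
- move=> n w; have /andP[r0 r1] := ramp01 [seq (t i, 1 + n%:R * x i) | i <- enum 'I_k]
    n%:R (U^~ w).
  by rewrite ger0_norm.
apply: aeW => w; rewrite indicE.
have rE n : ramp [seq (t i, 1 + n%:R * x i) | i <- enum 'I_k] n%:R (U^~ w) =
    \big[Num.min/1]_(i < k) clamp (1 + n%:R * (x i - U (t i) w)).
  rewrite /ramp big_map big_enum /=; apply: eq_bigr => i _.
  by congr clamp => /=; ring.
have [Aw|Aw] := boolP (w \in A).
  apply: cvg_near_cst; apply: nearW => n; rewrite rE.
  elim/big_ind: _ => [//|a b -> ->|i _]; first by rewrite minxx.
  apply: clamp_ge1; rewrite lerDl mulr_ge0// subr_ge0.
  by move: Aw; rewrite inE; exact.
have [i xi] : exists i, x i < U (t i) w.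
  move: Aw; rewrite notin_setE => /existsNP[i /negP]; rewrite -ltNge => xi.
  by exists i.
apply: cvg_near_cst; near=> n; apply: le_anti; apply/andP; split; last first.
  by have /andP[] := ramp01 [seq (t i, 1 + n%:R * x i) | i <- enum 'I_k]
    n%:R (U^~ w).
rewrite rE (bigminD1 i)//= ge_min; apply/orP; left.
have n0 : (U (t i) w - x i)^-1 <= n%:R by near: n; exact: nbhs_infty_ger.
have xi0 : 0 < U (t i) w - x i by rewrite subr_gt0.
rewrite clamp_le0//.
by move: n0; rewrite -[_^-1]mul1r ler_pdivrMr// => n0; lra.
Unshelve. all: by end_near.
Qed.

Section fdd_eq_criteria.
Context (R : realType) (I : choiceType) (D : set I).
Context (d1 : measure_display) (T1 : measurableType d1) (P1 : probability T1 R).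
Context (d2 : measure_display) (T2 : measurableType d2) (P2 : probability T2 R).
Context (U1 : I -> T1 -> R) (U2 : I -> T2 -> R).
Hypothesis mU1 : forall i, D i -> measurable_fun setT (U1 i).
Hypothesis mU2 : forall i, D i -> measurable_fun setT (U2 i).

Lemma fdd_eq_box :
  (forall k (t : 'I_k -> I), (forall i, D (t i)) -> forall x : 'I_k -> R,
     P1 [set w | forall i, U1 (t i) w <= x i] =
     P2 [set w | forall i, U2 (t i) w <= x i]) ->
  fdd_eq D P1 U1 P2 U2.
Proof.
move=> h k t Dt B mB.
have m1 i : measurable_fun setT (U1 (t i)) by exact: mU1.
have m2 i : measurable_fun setT (U2 (t i)) by exact: mU2.
apply: (@closed_box_unique _ _ (joint_law P1 m1) (joint_law P2 m2)) => // x.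
transitivity (P1 [set w | forall i, U1 (t i) w <= x i]).
  exact: joint_law_box.
by rewrite h//; apply/esym; exact: joint_law_box.
Qed.

Definition tests_eq := forall s : seq (I * R), (forall p, p \in s -> D p.1) ->
  forall m, 0 <= m ->
  Ex P1 (fun w => ramp s m (U1^~ w)) = Ex P2 (fun w => ramp s m (U2^~ w)).

Lemma fdd_eq_Ex k (t : 'I_k -> I) (g : k.-tuple R -> R) :
  fdd_eq D P1 U1 P2 U2 -> (forall i, D (t i)) ->
  measurable_fun setT g -> (forall y, 0 <= g y <= 1) ->
  Ex P1 (fun w => g (joint U1 t w)) = Ex P2 (fun w => g (joint U2 t w)).
Proof.
move=> h Dt mg g01.
have m1 i : measurable_fun setT (U1 (t i)) by exact: mU1.
have m2 i : measurable_fun setT (U2 (t i)) by exact: mU2.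
apply: EFin_inj; rewrite (Ex_joint P1 m1)// (Ex_joint P2 m2)//.
by apply: eq_measure_integral => A mA _; exact: h.
Qed.

Lemma fdd_eq_tests : fdd_eq D P1 U1 P2 U2 -> tests_eq.
Proof.
move=> h s Ds m m0.
(* Coordinates are indexed by the positions in [s], so an index may occur several times with
   different thresholds. *)
pose t (i : 'I_(size s)) := (tnth (in_tuple s) i).1.
pose g (y : (size s).-tuple R) :=
  ramp [seq (i, (tnth (in_tuple s) i).2) | i <- enum 'I_(size s)] m (tnth y).
have gE (u : I -> R) : ramp s m u = g [tuple u (t i) | i < size s].
  rewrite /g /ramp big_map big_enum /= big_tnth; apply: eq_bigr => i _.
  by rewrite tnth_mktuple.
under eq_fun do rewrite gE; under [in RHS]eq_fun do rewrite gE.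
apply: (fdd_eq_Ex (t := t) h) => [i| |y]; last exact: ramp01.
  by apply: Ds; exact: mem_tnth.
by apply: measurable_ramp => p _; exact: measurable_tnth.
Qed.

Lemma tests_fdd_eq : tests_eq -> fdd_eq D P1 U1 P2 U2.
Proof.
move=> h; apply: fdd_eq_box => k t Dt x.
have m1 i : measurable_fun setT (U1 (t i)) by exact: mU1.
have m2 i : measurable_fun setT (U2 (t i)) by exact: mU2.
have c1 := @Ex_ramp_box _ _ _ _ P1 _ _ _ x m1.
have c2 := @Ex_ramp_box _ _ _ _ P2 _ _ _ x m2.
have e : fine (P1 [set w | forall i, U1 (t i) w <= x i]) =
         fine (P2 [set w | forall i, U2 (t i) w <= x i]).
  have c12 : Ex P1 (fun w => ramp [seq (t i, 1 + n%:R * x i) | i <- enum 'I_k]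
      n%:R (U1^~ w)) @[n --> \oo] --> fine (P2 [set w | forall i, U2 (t i) w <= x i]).
    under eq_fun => n.
      rewrite h//; last by move=> _ /mapP[i _ ->]; exact: Dt.
      over.
    exact: c2.
  exact: cvg_unique c1 c12.
by rewrite -[LHS]fineK ?e ?fineK//; apply: fin_num_measure;
  apply: measurable_forall_fin => i; exact: measurable_le_set.
Qed.

End fdd_eq_criteria.

Section fdd_eq_transport.
Context (R : realType) (I : choiceType) (D : set I).
Context (d1 : measure_display) (T1 : measurableType d1) (P1 : probability T1 R).

Lemma fdd_eq_trans (U1 : I -> T1 -> R)
    d2 (T2 : measurableType d2) (P2 : probability T2 R) (U2 : I -> T2 -> R)
    d3 (T3 : measurableType d3) (P3 : probability T3 R) (U3 : I -> T3 -> R) :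
  fdd_eq D P1 U1 P2 U2 -> fdd_eq D P2 U2 P3 U3 -> fdd_eq D P1 U1 P3 U3.
Proof. by move=> h1 h2 k t Dt B mB; rewrite h1// h2. Qed.

Lemma fdd_eq_sym (U1 : I -> T1 -> R)
    d2 (T2 : measurableType d2) (P2 : probability T2 R) (U2 : I -> T2 -> R) :
  fdd_eq D P1 U1 P2 U2 -> fdd_eq D P2 U2 P1 U1.
Proof. by move=> h k t Dt B mB; rewrite h. Qed.

Lemma fdd_eq_map (U1 : I -> T1 -> R)
    d2 (T2 : measurableType d2) (P2 : probability T2 R) (U2 : I -> T2 -> R)
    (g : R -> R) : measurable_fun setT g ->
  fdd_eq D P1 U1 P2 U2 ->
  fdd_eq D P1 (fun i w => g (U1 i w)) P2 (fun i w => g (U2 i w)).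
Proof.
move=> mg h k t Dt B mB.
pose G (y : k.-tuple R) : k.-tuple R := [tuple g (tnth y i) | i < k].
have mG : measurable_fun setT G.
  apply/measurable_fun_tnthP => i.
  rewrite (_ : _ \o _ = fun y => g (tnth y i)).
    exact: (measurableT_comp mg (measurable_tnth i)).
  by apply/funext => y /=; rewrite tnth_mktuple.
have E (u : I -> R) : [tuple g (u (t i)) | i < k] = G [tuple u (t i) | i < k].
  by apply: eq_from_tnth => i; rewrite !tnth_mktuple.
under eq_set do rewrite (E (U1^~ _)).
under [in RHS]eq_set do rewrite (E (U2^~ _)).
by apply: (h k t Dt (G @^-1` B)); rewrite -[X in measurable X]setTI; exact: mG.
Qed.

Lemma ae_fdd_eq (U U' : I -> T1 -> R) :
  (forall i, D i -> measurable_fun setT (U i)) ->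
  (forall i, D i -> measurable_fun setT (U' i)) ->
  (forall i, D i -> {ae P1, forall w, U i w = U' i w}) ->
  fdd_eq D P1 U P1 U'.
Proof.
move=> mU mU' UU'; apply: tests_fdd_eq => // s Ds m m0.
have mUs p : p \in s -> measurable_fun setT (U p.1) by move=> /Ds; exact: mU.
have mU's p : p \in s -> measurable_fun setT (U' p.1) by move=> /Ds; exact: mU'.
apply: Ex_ae; [exact: bm_ramp|exact: bm_ramp|].
elim: s {mUs mU's} Ds => [|p s IHs] Ds; first by apply: aeW => w; rewrite !ramp_nil.
have := UU' _ (Ds p (mem_head _ _)).
have : {ae P1, forall w, ramp s m (U^~ w) = ramp s m (U'^~ w)}.
  by apply: IHs => q qs; apply: Ds; rewrite inE qs orbT.
by apply: filterS2 => w h1 h2; rewrite !ramp_cons h1 h2.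
Qed.

End fdd_eq_transport.

(** * Random bits with prescribed conditional probabilities *)

Section uniform01.
Context (R : realType).

Lemma measurable_id_measurableTypeR :
  @measurable_fun _ _ (measurableTypeR R) R setT id.
Proof. by move=> _ B mB; rewrite setTI. Qed.

(** [uniform_prob] lives on the copy [measurableTypeR R] of the line; its image under the identity
    is a law on [R] itself. *)
Definition unif01 : probability R R := distribution
  (uniform_prob (@ltr01 R) : probability (measurableTypeR R) R)
  (@mfun_Sub _ _ (measurableTypeR R) R id (mem_set measurable_id_measurableTypeR)).

Lemma unif01_itv (x y : R) : 0 <= x -> x <= y -> y <= 1 ->
  unif01 `[x, y[%classic = (y - x)%:E.
Proof.
move=> x0 xy y1; rewrite -[LHS]/(uniform_prob (@ltr01 R) `[x, y[%classic) /uniform_prob.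
rewrite (eq_integral (fun=> 1%:E)); last first.
  move=> u; rewrite inE /= in_itv /= => /andP[xu uy].
  by rewrite /uniform_pdf (le_trans x0 xu) (ltW (lt_le_trans uy y1)) subr0 invr1.
rewrite integral_cst//= mul1e lebesgue_measure_itv /= lte_fin.
case: ltP => // yx; have -> : x = y by apply/le_anti; rewrite xy.
by rewrite subrr.
Qed.

(** The complement of [[0, 1[] is null, so the shape of [B] has to be known on [[0, 1[] only. *)
Lemma unif01_trace (B : set R) (x p : R) : measurable B ->
  0 <= x -> 0 <= p -> x + p <= 1 ->
  (forall u, 0 <= u -> u < 1 -> B u <-> x <= u < x + p) -> unif01 B = p%:E.
Proof.
move=> mB x0 p0 xp1 Bx.
have m01 : measurable (`[0, 1[ : set R) by exact: measurable_itv.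
have U01 : unif01 (~` `[0, 1[%classic) = 0%E.
  rewrite (probability_setC unif01 m01).
  rewrite (_ : _ `[0, 1[%classic = 1%E) ?subee//.
  by rewrite unif01_itv ?subr0.
transitivity (unif01 (B `&` `[0, 1[%classic)).
  rewrite -[B in LHS](setIT B) -(setUv `[0, 1[%classic) setIUr measureU.
  - rewrite [X in (_ + X)%E](_ : _ = 0%E) ?adde0//.
    apply/eqP; rewrite eq_le measure_ge0 andbT -U01.
    apply: le_measure; rewrite ?inE; [|exact: measurableC|exact: subIsetr].
    by apply: measurableI => //; exact: measurableC.
  - exact: measurableI.
  - by apply: measurableI => //; exact: measurableC.
  - by rewrite setIACA setICr setI0.
rewrite (_ : _ `&` _ = `[x, x + p[%classic).
  by rewrite unif01_itv ?lerDl//; congr _%:E; ring.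
apply/seteqP; split=> u /=; rewrite !in_itv /=.
  by move=> [Bu /andP[u0 u1]]; apply/Bx.
move=> xu; have u0 : 0 <= u by lra.
have u1 : u < 1 by lra.
by split; [exact/Bx|rewrite u0].
Qed.

End uniform01.

(* From measurable conditional probabilities [q s] that the next bit is [0]
   given that the previous bits are [s] (most recent bit first), a uniform
   variable produces a random bit sequence having these probabilities. *)
Section digits.
Context (R : realType) (d : measure_display) (T : measurableType d)
  (P : probability T R).
Variable q : seq bool -> T -> R.
Hypothesis mq : forall s, measurable_fun setT (q s).
Hypothesis q01 : forall s w, 0 <= q s w <= 1.

Fixpoint cyl_prob (s : seq bool) (w : T) : R :=
  if s is b :: s' then cyl_prob s' w * (if b then 1 - q s' w else q s' w)
  else 1.

(** Left end of the interval of length [cyl_prob s w] on which the uniform variable produces the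
    word [s]; the bit [false] takes the left part of the parent interval. *)
Fixpoint cyl_low (s : seq bool) (w : T) : R :=
  if s is b :: s' then
    cyl_low s' w + (if b then cyl_prob s' w * q s' w else 0)
  else 0.

Fixpoint digits (n : nat) (x : T * R) : seq bool :=
  if n is n'.+1 then let s := digits n' x in
    (cyl_low s x.1 + cyl_prob s x.1 * q s x.1 <= x.2) :: s
  else [::].

Lemma cyl_prob_ge0 s w : 0 <= cyl_prob s w.
Proof.
by elim: s => [|b s IHs] //=; have := q01 s w; case: b => ?; rewrite mulr_ge0//; lra.
Qed.

Lemma cyl_low_prob s w : 0 <= cyl_low s w /\ cyl_low s w + cyl_prob s w <= 1.
Proof.
elim: s => [|b s [IH0 IH1]] /=; first by split; lra.
have := q01 s w; have := cyl_prob_ge0 s w; case: b => ? ?; split; nra.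
Qed.

(** At each level the intervals partition [[0, 1[]. Outside of it the equivalence already fails for
    the empty word. *)
Lemma digitsP s x : 0 <= x.2 -> x.2 < 1 -> digits (size s) x = s <->
  cyl_low s x.1 <= x.2 < cyl_low s x.1 + cyl_prob s x.1.
Proof.
move=> x0 x1; elim: s => [|b s IHs] /=; first by split=> // _; lra.
have p0 := cyl_prob_ge0 s x.1; have qs := q01 s x.1.
have [ds|ds] := pselect (digits (size s) x = s); last first.
  split=> [[_ //]|h]; case: ds; apply/IHs.
  by move: h; case: b => /andP[? ?]; apply/andP; split; nra.
have /IHs/andP[l u] := ds; rewrite ds.
case: b; case: (leP (cyl_low s x.1 + cyl_prob s x.1 * q s x.1) x.2) => h;
  split; first [by [] | by move=> _; apply/andP; split; nra
    | by move=> /andP[? ?]; exfalso; nra].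
Qed.

Lemma measurable_cyl_prob s : measurable_fun setT (cyl_prob s).
Proof.
elim: s => [|b s IHs] /=; first exact: measurable_cst.
apply: measurable_funM => //; case: b => //.
by apply: measurable_funB => //; exact: measurable_cst.
Qed.

Lemma measurable_cyl_low s : measurable_fun setT (cyl_low s).
Proof.
elim: s => [|b s IHs] /=; first exact: measurable_cst.
apply: measurable_funD => //; case: b; last exact: measurable_cst.
by apply: measurable_funM => //; exact: measurable_cyl_prob.
Qed.

Lemma measurable_digits s : measurable [set x | digits (size s) x = s].
Proof.
elim: s => [|b s IHs] /=.
  by rewrite (_ : [set x | _] = setT)//; apply/seteqP.
have mthr : measurable_fun setT (fun x : T * R =>
    cyl_low s x.1 + cyl_prob s x.1 * q s x.1 <= x.2).
  apply: measurable_fun_ler; last exact: measurable_snd.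
  apply: (measurableT_comp (f := fun w => cyl_low s w + cyl_prob s w * q s w)).
    apply: measurable_funD; first exact: measurable_cyl_low.
    by apply: measurable_funM => //; exact: measurable_cyl_prob.
  exact: measurable_fst.
rewrite (_ : [set x | _] = [set x | digits (size s) x = s] `&`
    (fun x : T * R => cyl_low s x.1 + cyl_prob s x.1 * q s x.1 <= x.2) @^-1` [set b]).
  apply: measurableI => //; rewrite -[X in measurable X]setTI.
  exact: mthr.
apply/seteqP; split=> x /=; first by move=> [<- ds]; rewrite ds.
by move=> [ds <-]; rewrite ds.
Qed.

Definition enlarge : probability (T * R)%type R := (P \x unif01 R)%E.

Lemma enlargeE (A : set T) : measurable A -> enlarge (fst @^-1` A) = P A.
Proof.
move=> mA; rewrite (_ : _ @^-1` A = A `*` setT).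
  rewrite /enlarge /= product_measure1E// -[RHS]mule1; congr (_ * _)%E.
  exact: probability_setT.
by apply/seteqP; split=> [x|x []].
Qed.

(** Fubini: for [w] in [A] the section agrees on [[0, 1[] with the interval of [digitsP], of length
    [cyl_prob s w]. *)
Lemma enlarge_digits (A : set T) s : measurable A ->
  enlarge ((fst @^-1` A) `&` [set x | digits (size s) x = s]) =
  (\int[P]_(w in A) (cyl_prob s w)%:E)%E.
Proof.
move=> mA; set X := _ `&` _.
transitivity (\int[P]_w unif01 R (xsection X w))%E; first by [].
rewrite [RHS]integral_mkcond /X; apply: eq_integral => w _; rewrite patchE.
have [wA|wA] := boolP (w \in A); last first.
  rewrite (_ : xsection _ _ = set0) ?measure0//.
  apply/seteqP; split=> // u; rewrite /xsection /= inE /= => -[Aw _].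
  by move: wA; rewrite notin_setE.
have mS : measurable (xsection (fst @^-1` A `&`
    [set x | digits (size s) x = s]) w).
  apply: measurable_xsection; apply: measurableI; last exact: measurable_digits.
  by rewrite -[X in measurable X]setTI; exact: measurable_fst.
have [l0 lp1] := cyl_low_prob s w.
apply: (unif01_trace mS l0 (cyl_prob_ge0 s w) lp1) => u u0 u1.
rewrite /xsection /= inE /= -(digitsP s (x := (w, u)))//.
by split=> [[]|] //; split => //; exact: set_mem.
Qed.

End digits.

(* Bisection: at step [m] the bit tells whether coordinate [schedule m] lies in
   the upper half of its current dyadic interval [[low, low + width[]. *)
Section bisection.
Context (R : realType) (I : countType).

(** Every natural number is the 2-adic valuation of infinitely many [m] (the odd multiples of a
    power of 2), so every coordinate is bisected infinitely often. *)
Definition schedule (m : nat) : option I := unpickle (logn 2 m).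

Lemma schedule_often (i : I) n : exists2 m, (n <= m)%N & schedule m = Some i.
Proof.
exists (2 ^ pickle i * (n.*2).+1)%N.
  by rewrite (leq_trans _ (leq_pmull _ _)) ?expn_gt0// -addnn; lia.
rewrite /schedule lognM ?expn_gt0// pfactorK// [logn _ _.+1](_ : _ = 0%N).
  by rewrite addn0 pickleK.
by apply/eqP; rewrite -leqn0 leqNgt logn_gt0 mem_primes /= dvdn2 /= odd_double.
Qed.

Fixpoint width (i : I) (n : nat) : R :=
  if n is n'.+1 then
    if schedule n' == Some i then width i n' / 2 else width i n'
  else 1.

Fixpoint low (i : I) (s : seq bool) : R :=
  if s is b :: s' then low i s' +
    (if b && (schedule (size s') == Some i) then width i (size s') / 2 else 0)
  else 0.

(** Steps scheduled for no coordinate emit the bit [false], so that the word at time [n] always has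
    length [n]. *)
Fixpoint encode (u : I -> R) (n : nat) : seq bool :=
  if n is n'.+1 then let s := encode u n' in
    (if schedule n' is Some i then low i s + width i n' / 2 <= u i else false)
      :: s
  else [::].

Lemma size_encode u n : size (encode u n) = n.
Proof. by elim: n => //= n ->. Qed.

Lemma width_gt0 i n : 0 < width i n.
Proof. by elim: n => [|n IHn] //=; case: eqP => // _; rewrite divr_gt0. Qed.

Lemma width_noninc i : {homo width i : m n / (m <= n)%N >-> n <= m}.
Proof.
apply/nonincreasing_seqP => n /=; have := width_gt0 i n.
by case: eqP => // _; lra.
Qed.

Lemma width_cvg i : width i n @[n --> \oo] --> (0 : R).
Proof.
(* Halving sends [1/(k+1)] below [1/(k+2)], so a harmonic bound follows by induction without
   counting the bisections. *)
have H k : exists n, width i n <= (k.+1%:R)^-1.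
  elim: k => [|k [n IHk]]; first by exists 0%N; rewrite invr1.
  have [m nm mi] := schedule_often i n; exists m.+1 => /=; rewrite mi eqxx.
  have := width_noninc i nm; rewrite ler_pdivrMr// => wm.
  rewrite (le_trans wm)// (le_trans IHk)//.
  rewrite -[leLHS]mul1r ler_pdivrMr ?ltr0n// [_^-1 * 2]mulrC mulrAC.
  rewrite ler_pdivlMr ?ltr0n//.
  by rewrite mul1r -natrM ler_nat; lia.
apply/cvgrPdist_le => e e0.
have [n wn] := H (Num.truncn e^-1).
near=> m; rewrite sub0r normrN gtr0_norm ?width_gt0//.
have nm : (n <= m)%N by near: m; exact: nbhs_infty_ge.
rewrite (le_trans (width_noninc i nm))// (le_trans wn)//.
rewrite invf_ple ?posrE ?ltr0n//.
exact/ltW/truncnS_gt.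
Unshelve. all: by end_near.
Qed.

Lemma low_cons i b s : low i s <= low i (b :: s).
Proof.
rewrite /= lerDl; case: ifP => // _.
by rewrite divr_ge0// ltW// width_gt0.
Qed.

Lemma low_width_cons i b s :
  low i (b :: s) + width i (size s).+1 <= low i s + width i (size s).
Proof.
have /= := width_gt0 i (size s); case: b => /=; case: eqP => _ /=; lra.
Qed.

Lemma encode_bound u i n : 0 <= u i < 1 ->
  low i (encode u n) <= u i < low i (encode u n) + width i n.
Proof.
move=> u01; elim: n => [|n IHn] /=; first by rewrite add0r.
rewrite size_encode; case E : (schedule n) => [j|] /=; last first.
  by rewrite addr0.
have [->|ji] := eqVneq j i.
  rewrite eqxx andbT.
  by case: (leP (low i (encode u n) + width i n / 2) (u i)) => h;
    apply/andP; split; lra.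
have -> : (Some j == Some i) = false by apply/eqP => -[/eqP]; rewrite (negbTE ji).
by rewrite andbF addr0.
Qed.

End bisection.

Section bit_process.
Context (R : realType) (d : measure_display) (T : measurableType d)
  (P : probability T R).

(** A random infinite bit sequence, given by its initial words with the latest bit at the head. *)
Definition bit_process (h : nat -> T -> seq bool) :=
  [/\ forall w, h 0%N w = [::],
      forall n w, exists b, h n.+1 w = b :: h n w &
      forall s, measurable [set w | h (size s) w = s]].

Variable h : nat -> T -> seq bool.
Hypothesis hP : bit_process h.

Lemma size_bit_process n w : size (h n w) = n.
Proof.
by have [h0 hS _] := hP; elim: n => [|n IHn]; rewrite ?h0//;
  have [b ->] := hS n w; rewrite /= IHn.
Qed.

(** At a fixed level there are finitely many words; splitting along them reduces measurability and
    integration to cylinder events. *)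
Lemma bit_process_sum n (g : seq bool -> T -> R) w :
  g (h n w) w =
  \sum_(t : n.-tuple bool) g t w * \1_[set w | h (size t) w = t] w.
Proof.
have sz : size (h n w) == n by rewrite size_bit_process.
rewrite (bigD1 (Tuple sz))//= big1 ?addr0.
  by rewrite indicE mem_set ?mulr1//= size_bit_process.
move=> t tn; rewrite indicE memNset ?mulr0//= size_tuple => ht.
by move/eqP: tn; apply; apply/val_inj; rewrite /= ht.
Qed.

Lemma bm_indic (A : set T) : measurable A -> bounded_measurable (\1_A : T -> R).
Proof.
move=> mA; apply: bm01 => [|w]; first exact: measurable_indic.
by rewrite indicE; case: (_ \in _); rewrite /= ?lexx ler01.
Qed.

Lemma bm_bit_process n (g : seq bool -> R) :
  bounded_measurable (fun w => g (h n w)).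
Proof.
have [_ _ mh] := hP.
under eq_fun do rewrite (bit_process_sum _ (fun s _ => g s)).
apply: bm_sum => t; apply: bmM; [exact: bm_cst|exact: bm_indic].
Qed.

Lemma Ex_bit_process n (g : seq bool -> R) :
  Ex P (fun w => g (h n w)) =
  \sum_(t : n.-tuple bool) g t * fine (P [set w | h (size t) w = t]).
Proof.
have [_ _ mh] := hP.
under eq_fun do rewrite (bit_process_sum _ (fun s _ => g s)).
rewrite Ex_sum; last by move=> t; apply: bmM; [exact: bm_cst|exact: bm_indic].
apply: eq_bigr => t _; rewrite ExZ; last exact: bm_indic.
by rewrite -(Ex_indic P (mh t)).
Qed.

Lemma bit_process_measure n (xi : T -> R) (B : seq bool -> set R) :
  measurable_fun setT xi -> (forall s, measurable (B s)) ->
  fine (P [set w | B (h n w) (xi w)]) =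
  \sum_(t : n.-tuple bool)
     fine (P ((xi @^-1` B t) `&` [set w | h (size t) w = t])).
Proof.
move=> mxi mB; have [_ _ mh] := hP.
have mx s : measurable (xi @^-1` B s).
  by rewrite -[X in measurable X]setTI; exact: mxi.
pose g s : T -> R := \1_(xi @^-1` B s).
have E w : \1_[set w | B (h n w) (xi w)] w = g (h n w) w.
  by rewrite /g !indicE; congr (_%:R); apply/idP/idP; rewrite !inE.
have mS : measurable [set w | B (h n w) (xi w)].
  apply/(measurable_indicP R).
  rewrite (_ : \1_ _ = fun w => \sum_(t : n.-tuple bool)
      g t w * \1_[set w | h (size t) w = t] w); last first.
    by apply/funext => w; rewrite E bit_process_sum.
  apply: (proj1 (bm_sum _ _)) => t.
  by apply: bmM; apply: bm_indic.
transitivity (Ex P (\1_[set w | B (h n w) (xi w)])).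
  by rewrite -(Ex_indic P mS).
rewrite (_ : \1_ _ = fun w => \sum_(t : n.-tuple bool)
    \1_((xi @^-1` B t) `&` [set w | h (size t) w = t]) w); last first.
  apply/funext => w; rewrite E bit_process_sum; apply: eq_bigr => t _.
  by rewrite indicI.
rewrite Ex_sum; last by move=> t; apply: bm_indic; exact: measurableI.
by apply: eq_bigr => t _; rewrite -(Ex_indic P)//; exact: measurableI.
Qed.

Context (I : countType).

Definition decode (i : I) (w : T) : R := limn (fun n => low R i (h n w)).

Let low_mono (i : I) w : nondecreasing_seq (fun n => low R i (h n w)).
Proof.
have [_ hS _] := hP; apply/nondecreasing_seqP => n.
by have [b ->] := hS n w; exact: low_cons.
Qed.

Let low_bound (i : I) w : nonincreasing_seq (fun n => low R i (h n w) + width R i n).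
Proof.
have [_ hS _] := hP; apply/nonincreasing_seqP => n.
have [b ->] := hS n w; have := low_width_cons R i b (h n w).
by rewrite size_bit_process.
Qed.

Lemma low_le_upper (i : I) w m n : low R i (h m w) <= low R i (h n w) + width R i n.
Proof.
apply: (le_trans (low_mono i w (leq_maxl m n))).
apply: le_trans (low_bound i w (leq_maxr m n)).
by rewrite lerDl ltW// width_gt0.
Qed.

Lemma decode_cvg i w : low R i (h n w) @[n --> \oo] --> decode i w.
Proof.
apply: nondecreasing_is_cvgn; first exact: low_mono.
by exists (low R i (h 0%N w) + width R i 0) => _ [n _ <-]; exact: low_le_upper.
Qed.

Lemma low_le_decode i w n : low R i (h n w) <= decode i w.
Proof.
apply: nondecreasing_cvgn_le; first exact: low_mono.
exact: decode_cvg.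
Qed.

Lemma decode_le_upper i w n : decode i w <= low R i (h n w) + width R i n.
Proof.
apply: limr_le; first exact: decode_cvg.
by apply: nearW => m; exact: low_le_upper.
Qed.

Lemma decode01 i w : 0 <= decode i w <= 1.
Proof.
have [h0 _ _] := hP.
by have := low_le_decode i w 0; have := decode_le_upper i w 0; rewrite h0 /= add0r => -> ->.
Qed.

Lemma measurable_decode i : measurable_fun setT (decode i).
Proof.
apply: (@measurable_fun_cvg _ _ _ _ (fun n w => low R i (h n w))).
  by move=> n; have [] := bm_bit_process n (low R i).
by move=> w _; exact: decode_cvg.
Qed.

End bit_process.

Arguments decode {R d T} h {I} i w.

(** Compactness of the segment gives a cluster point, and an ultrafilter converges to any of its
    cluster points. *)
Lemma ultra_bounded_cvg (R : realType) (I : Type) (F : set_system I)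
    (f : I -> R) (a b : R) : UltraFilter F -> (forall i, a <= f i <= b) ->
  cvg (f i @[i --> F]).
Proof.
move=> FU fab.
have [|x [_ xcl]] := @segment_compact R a b (f @ F).
  by apply: (@filterE _ F) => i; rewrite /= in_itv /=; exact: fab.
apply/cvg_ex; exists x => B xB.
have [//|FnB] := in_ultra_setVsetC (f @^-1` B) FU.
have [y [/= yB]] := xcl (~` B) B FnB xB.
by [].
Qed.

(** Replacing points by the left ends of their dyadic intervals can only raise the antitone [ramp],
    and by no more than [m] times the widths. *)
Lemma ramp_low_approx (R : realType) (I : countType) (s : seq (I * R)) (m e : R)
    (u l : I -> R) : 0 <= m ->
  (forall i, l i <= u i) -> \sum_(p <- s) m * (u p.1 - l p.1) <= e ->
  ramp s m u <= ramp s m l <= ramp s m u + e.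
Proof.
move=> m0 lu se; rewrite ramp_le//=.
apply: (le_trans (ramp_diff s m l u)); rewrite lerD2l (le_trans _ se)//.
apply: ler_sum => p _; apply: (le_trans (clamp_le_norm _)).
by rewrite ger0_norm// mulr_ge0// subr_ge0.
Qed.

(** * Limit laws along an ultrafilter *)

Section limit_law.
Context (R : realType) (I : countType).
Context (d : measure_display) (T : measurableType d) (P : probability T R).

Lemma encode_bit_process (u : I -> T -> R) :
  (forall i, measurable_fun setT (u i)) ->
  bit_process (fun n w => encode (u^~ w) n).
Proof.
move=> mu; split=> // [n w|]; first by eexists; reflexivity.
elim=> [|b s IHs].
  by rewrite (_ : [set w | _] = setT)//; apply/seteqP.
rewrite (_ : [set w | _] = [set w | encode (u^~ w) (size s) = s] `&`
  (fun w => if schedule I (size s) is Some i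
            then low R i s + width R i (size s) / 2 <= u i w else false)
   @^-1` [set b]).
  apply: measurableI => //; rewrite -[X in measurable X]setTI.
  case: (schedule I (size s)) => [i|].
    by apply: measurable_fun_ler => //; exact: measurable_cst.
  exact: (@measurable_cst _ _ _ _ setT false).
apply/seteqP; split=> w /=; first by move=> [<- ->].
by move=> [-> <-].
Qed.

Variable U : nat -> I -> T -> R.
Hypothesis mU : forall n i, measurable_fun setT (U n i).
Hypothesis U01 : forall n i w, 0 <= U n i w < 1.
Variable F : set_system nat.
Hypothesis FU : UltraFilter F.

Let pn (n : nat) (s : seq bool) : R :=
  fine (P [set w | encode (U n ^~ w) (size s) = s]).

Let mE n s : measurable [set w | encode (U n ^~ w) (size s) = s].
Proof. by have [_ _] := encode_bit_process (mU n); exact. Qed.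

Let pn01 n s : 0 <= pn n s <= 1.
Proof.
rewrite /pn fine_ge0//= -lee_fin fineK ?probability_le1//.
exact: fin_num_measure.
Qed.

Let pnS n s : pn n s = pn n (false :: s) + pn n (true :: s).
Proof.
rewrite /pn -fineD ?fin_num_measure//; try exact: (mE n (_ :: s)).
rewrite -measureU; try exact: (mE n (_ :: s)).
  congr (fine (P _)); apply/seteqP; split=> w /=.
    move=> ->; case: (schedule _ _) => [i|]; last by left.
    by case: (_ <= _); [right|left].
  by case=> -[].
apply/seteqP; split=> // w /= [[e1 _] [e2 _]].
by rewrite e1 in e2.
Qed.

Let p s : R := lim (pn n s @[n --> F]).

Let pn_cvg s : pn n s @[n --> F] --> p s.
Proof. exact: (ultra_bounded_cvg FU (pn01^~ s)). Qed.

Let p_ge0 s : 0 <= p s.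
Proof.
by apply: limr_ge; [exact: pn_cvg|apply: nearW => n; case/andP: (pn01 n s)].
Qed.

Let pS s : p s = p (false :: s) + p (true :: s).
Proof.
have h : pn n s @[n --> F] --> p (false :: s) + p (true :: s).
  by under eq_fun do rewrite pnS; exact: cvgD.
exact: cvg_unique (@pn_cvg s) h.
Qed.

Let p_nil : p [::] = 1.
Proof.
rewrite /p (_ : (fun n => pn n [::]) = fun=> 1).
  exact: lim_cst.
apply/funext => n; rewrite /pn (_ : [set w | _] = setT) ?probability_setT//.
exact/seteqP.
Qed.

(** If [p s = 0] the quotient is [0] by convention; this is harmless, since all extensions of [s]
    then have limit probability [0]. *)
Let q s (w : T) : R := p (false :: s) / p s.

Let q01 s w : 0 <= q s w <= 1.
Proof.
rewrite /q divr_ge0//=; have [->|p0] := eqVneq (p s) 0.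
  by rewrite invr0 mulr0 ler01.
by rewrite ler_pdivrMr ?mul1r ?lt0r ?p0//= (pS s) lerDl.
Qed.

Let cyl_probE s w : cyl_prob q s w = p s.
Proof.
elim: s => [|b s IHs]; first by rewrite p_nil.
rewrite /= IHs /q; have [p0|p0] := eqVneq (p s) 0; last first.
  by case: b; rewrite ?mulrBr ?mulr1 mulrC divfK// (pS s); ring.
rewrite p0 mul0r; apply/esym/le_anti; rewrite p_ge0 andbT -p0 (pS s).
by case: b; rewrite ?lerDl ?lerDr p_ge0.
Qed.

(* Prokhorov's theorem for [[0, 1[]-valued sequences, along an ultrafilter *)
Lemma limit_law : exists h : nat -> T * R -> seq bool, bit_process h /\
  forall (s : seq (I * R)) (m : R), 0 <= m ->
    Ex P (fun w => ramp s m (U n ^~ w)) @[n --> F] -->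
    Ex (enlarge P) (fun x => ramp s m (fun i => decode h i x)).
Proof.
have mq s : measurable_fun setT (q s) by exact: measurable_cst.
have hP : bit_process (digits q).
  split=> [//|n w|s]; first by eexists; reflexivity.
  exact: measurable_digits.
exists (digits q); split=> // s m m0.
have PE t : fine (enlarge P [set x | digits q (size t) x = t]) = p t.
  have := enlarge_digits P mq q01 t (@measurableT _ T).
  rewrite preimage_setT setTI => ->.
  under eq_integral do rewrite cyl_probE.
  by rewrite integral_cst//= [X in (_ * X)%E](_ : _ = 1%E) ?mule1//;
    exact: probability_setT.
pose g t := ramp s m (fun i => low R i t).
(* Cost of stopping the bisection after [N] steps, uniform in the point and in [n]. *)
pose err N := \sum_(r <- s) m * width R r.1 N.
have errE N : err N = m * \sum_(r <- s) width R r.1 N by rewrite mulr_sumr.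
have err_cvg : err N @[N --> \oo] --> 0.
  have ws : \sum_(r <- s) width R r.1 N @[N --> \oo] --> 0.
    elim: (s) => [|r s' IHs].
      by under eq_fun do rewrite big_nil; exact: cvg_cst.
    under eq_fun do rewrite big_cons.
    have h := cvgD (@width_cvg R I r.1) IHs; rewrite addr0 in h; exact: h.
  under eq_fun do rewrite errE.
  have h := cvgM (cvg_cst m) ws; rewrite mulr0 in h; exact: h.
have Vbd N : Ex (enlarge P) (fun x => ramp s m (fun i => decode (digits q) i x)) <=
    Ex (enlarge P) (fun x => g (digits q N x)) <=
    Ex (enlarge P) (fun x => ramp s m (fun i => decode (digits q) i x)) + err N.
  have b1 : bounded_measurable (fun x => ramp s m (fun i => decode (digits q) i x)).
    by apply: bm_ramp => r _; exact: measurable_decode.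
  have b2 := bm_bit_process hP N g.
  have lu x : ramp s m (fun i => decode (digits q) i x) <= g (digits q N x) <=
      ramp s m (fun i => decode (digits q) i x) + err N.
    apply: ramp_low_approx => // [i|]; first exact: low_le_decode.
    apply: ler_sum => r _; apply: ler_wpM2l => //.
    by rewrite lerBlDl; exact: decode_le_upper.
  rewrite Ex_le//=; last by move=> x; case/andP: (lu x).
  rewrite -[X in _ + X](Ex_cst (enlarge P)) -ExD//; last exact: bm_cst.
  apply: Ex_le => //; first by apply: bmD => //; exact: bm_cst.
  by move=> x; case/andP: (lu x).
have Ubd n N : Ex P (fun w => ramp s m (U n ^~ w)) <=
    Ex P (fun w => g (encode (U n ^~ w) N)) <=
    Ex P (fun w => ramp s m (U n ^~ w)) + err N.
  have b1 : bounded_measurable (fun w => ramp s m (U n ^~ w)).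
    by apply: bm_ramp.
  have b2 := bm_bit_process (encode_bit_process (mU n)) N g.
  have lu x : ramp s m (U n ^~ x) <= g (encode (U n ^~ x) N) <=
      ramp s m (U n ^~ x) + err N.
    apply: ramp_low_approx => // [i|].
      by have /andP[] := @encode_bound _ _ (U n ^~ x) i N (U01 n i x).
    apply: ler_sum => r _; apply: ler_wpM2l => //.
    by rewrite lerBlDl; have /andP[_ /ltW] := @encode_bound _ _ (U n ^~ x) r.1 N (U01 n r.1 x).
  rewrite Ex_le//=; last by move=> x; case/andP: (lu x).
  rewrite -[X in _ + X](Ex_cst P) -ExD//; last exact: bm_cst.
  apply: Ex_le => //; first by apply: bmD => //; exact: bm_cst.
  by move=> x; case/andP: (lu x).
(* At a fixed depth the mean is a finite combination of cylinder probabilities, whose limits define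
   the bits. *)
have gcvg N : Ex P (fun w => g (encode (U n ^~ w) N)) @[n --> F] -->
    Ex (enlarge P) (fun x => g (digits q N x)).
  rewrite (Ex_bit_process _ hP).
  under eq_fun => n do rewrite (Ex_bit_process _ (encode_bit_process (mU n))).
  rewrite (eq_bigr (fun t : N.-tuple bool => g t * p t)); last first.
    by move=> t _; rewrite PE.
  suff: forall ts : seq (N.-tuple bool),
      \sum_(t <- ts) g t * pn n t @[n --> F] --> \sum_(t <- ts) g t * p t by exact.
  elim=> [|t ts IHt].
    by under eq_fun do rewrite big_nil; rewrite big_nil; exact: cvg_cst.
  under eq_fun do rewrite big_cons.
  rewrite big_cons; apply: cvgD => //.
  by apply: cvgM; [exact: cvg_cst|exact: pn_cvg].
apply/cvgrPdist_le => e e0.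
have [N errN] : exists N, err N <= e / 2.
  have /cvgrPdist_le/(_ (e / 2))[|N _ HN] := err_cvg; first by rewrite divr_gt0.
  exists N; have := HN N (leqnn N).
  by rewrite sub0r normrN; apply: le_trans; exact: ler_norm.
have e2 : 0 < e / 2 by rewrite divr_gt0.
have /cvgrPdist_le/(_ _ e2) := gcvg N.
apply: filterS => n; have := Vbd N; have := Ubd n N.
move=> /andP[u1 u2] /andP[v1 v2]; rewrite !ler_norml => /andP[g1 g2].
by apply/andP; split; lra.
Qed.

End limit_law.

(** * Transfer of a conditional law to another probability space *)

Section slice_measure.
Context (R : realType) (d : measure_display) (T : measurableType d)
  (P : probability T R).
Variables (xi : T -> R) (E : set T).

(** Its density with respect to the law of [xi] is the conditional probability of [E] given [xi]. *)
Definition slice_measure of measurable_fun setT xi & measurable E :=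
  fun A : set R => P ((xi @^-1` A) `&` E).

Variables (mxi : measurable_fun setT xi) (mE : measurable E).

Let mpre (A : set R) : measurable A -> measurable (xi @^-1` A).
Proof. by move=> mA; rewrite -[X in measurable X]setTI; exact: mxi. Qed.

Let slice0 : slice_measure mxi mE set0 = 0%E.
Proof. by rewrite /slice_measure preimage_set0 set0I measure0. Qed.

Let slice_ge0 A : (0 <= slice_measure mxi mE A)%E.
Proof. exact: measure_ge0. Qed.

Let slice_sigma_additive : semi_sigma_additive (slice_measure mxi mE).
Proof.
move=> F mF tF mUF; rewrite /slice_measure preimage_bigcup setI_bigcupl.
apply: measure_semi_sigma_additive.
- by move=> n; apply: measurableI => //; exact: mpre.
- apply/trivIsetP => /= i j _ _ ij; rewrite setIACA -preimage_setI.
  by move/trivIsetP : tF => /(_ _ _ _ _ ij) ->//; rewrite preimage_set0 set0I.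
- rewrite -setI_bigcupl -preimage_bigcup; apply: measurableI => //; exact: mpre.
Qed.

HB.instance Definition _ := isMeasure.Build _ _ _ (slice_measure mxi mE)
  slice0 slice_ge0 slice_sigma_additive.

Let slice_fin : fin_num_fun (slice_measure mxi mE).
Proof.
by move=> A mA; apply: fin_num_measure; apply: measurableI => //; exact: mpre.
Qed.

HB.instance Definition _ := Measure_isFinite.Build _ _ _ (slice_measure mxi mE)
  slice_fin.

End slice_measure.

Section transfer.
Context (R : realType).
Context (d : measure_display) (T : measurableType d) (P : probability T R).
Context (d' : measure_display) (S : measurableType d') (Q : probability S R).
Variables (xi : T -> R) (xi' : S -> R).
Hypothesis mxi : measurable_fun setT xi.
Hypothesis mxi' : measurable_fun setT xi'.
Hypothesis law_xi : forall A : set R, measurable A ->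
  P (xi @^-1` A) = Q (xi' @^-1` A).
Variable h' : nat -> S -> seq bool.
Hypothesis hP' : bit_process h'.

Let mu : probability R R := distribution Q (mfun_Sub (mem_set mxi')).

Let mh' s : measurable [set w | h' (size s) w = s].
Proof. by have [_ _] := hP'; exact. Qed.

Let nu s : {finite_measure set R -> \bar R} := slice_measure Q mxi' (mh' s).

Let nuE s A : nu s A = Q ((xi' @^-1` A) `&` [set w | h' (size s) w = s]).
Proof. by []. Qed.

Let mpre (A : set R) : measurable A -> measurable (xi' @^-1` A).
Proof. by move=> mA; rewrite -[X in measurable X]setTI; exact: mxi'. Qed.

Let nu_mu s : nu s `<< mu.
Proof.
apply/null_content_dominatesP => A mA muA; apply/eqP.
rewrite eq_le measure_ge0 andbT -muA.
have : (Q ((xi' @^-1` A) `&` [set w | h' (size s) w = s]) <= Q (xi' @^-1` A))%E.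
  by apply: le_measure; rewrite ?inE; [apply: measurableI => //|..|exact: subIsetl];
    exact: mpre.
exact.
Qed.

(** A version of the conditional probability of the word [s] given [xi' = y]. The relations between
    these versions hold almost everywhere only. *)
Let p s (y : R) : R := fine (Radon_Nikodym_SigmaFinite.f (nu s) mu y).

Let p_ge0 s y : 0 <= p s y.
Proof. by rewrite fine_ge0//; exact: Radon_Nikodym_SigmaFinite.f_ge0. Qed.

Let pE s : (fun y => (p s y)%:E) = Radon_Nikodym_SigmaFinite.f (nu s) mu.
Proof.
by apply/funext => y; rewrite fineK//; exact: Radon_Nikodym_SigmaFinite.f_fin_num.
Qed.

Let mp s : measurable_fun setT (p s).
Proof.
apply/measurable_EFinP; rewrite (_ : _ \o _ = fun y => (p s y)%:E)// pE.
apply: (measurable_int mu); exact: Radon_Nikodym_SigmaFinite.f_integrable.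
Qed.

Let ip s : mu.-integrable setT (fun y => (p s y)%:E).
Proof. by rewrite pE; exact: Radon_Nikodym_SigmaFinite.f_integrable. Qed.

Let p_int s A : measurable A -> nu s A = (\int[mu]_(y in A) (p s y)%:E)%E.
Proof.
move=> mA; rewrite (Radon_Nikodym_SigmaFinite.f_integral (nu_mu s))//.
by rewrite -pE.
Qed.

Let nuS s A : measurable A ->
  nu s A = (nu (false :: s) A + nu (true :: s) A)%E.
Proof.
move=> mA; rewrite !nuE; have [_ hS _] := hP'.
rewrite -measureU; [|apply: measurableI; [exact: mpre|exact: (mh' (_ :: s))]..|].
  rewrite -setIUr; congr (Q (_ `&` _)); apply/seteqP; split=> w /=.
    by have [b ->] := hS (size s) w => ->; case: b; [right|left].
  by have [b ->] := hS (size s) w; case=> -[].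
by apply/seteqP; split=> // w /= [[_ ->] [_]].
Qed.

Let p_nil : {ae mu, forall y, p [::] y = 1}.
Proof.
have [h0 _ _] := hP'.
have : ae_eq mu setT (fun y => (p [::] y)%:E) (cst 1%E).
  apply: integral_ae_eq => // A _ mA; rewrite -p_int// integral_cst// mul1e.
  rewrite nuE -[RHS]/(Q (xi' @^-1` A)); congr (Q _); apply/seteqP; split=> w /=; first by case.
  by split => //; exact: h0.
by apply: filterS => y /(_ I) [].
Qed.

Let pS s : {ae mu, forall y, p s y = p (false :: s) y + p (true :: s) y}.
Proof.
have : ae_eq mu setT (fun y => (p s y)%:E)
    (fun y => (p (false :: s) y)%:E + (p (true :: s) y)%:E)%E.
  apply: integral_ae_eq => // [|A _ mA].
    by apply: emeasurable_funD; apply/measurable_EFinP.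
  rewrite integralD//; try exact: integrableS (ip _).
  by rewrite -!p_int// nuS.
by apply: filterS => y /(_ I) [].
Qed.

(** The quotient is at most [1] only for almost every [y], while [digits] needs a probability at
    every point; hence the truncation. *)
Let q s (y : R) : R := clamp (p (false :: s) y / p s y).

Let mq s : measurable_fun setT (q s).
Proof.
apply: (measurableT_comp (@measurable_clamp R)); apply: measurable_funM => //.
exact: (measurableT_comp (@measurable_invr R)).
Qed.

Let q01 s y : 0 <= q s y <= 1.
Proof. exact: clamp01. Qed.

Let cyl_probE s : {ae mu, forall y, cyl_prob q s y = p s y}.
Proof.
elim: s => [|b s IHs]; first by apply: filterS p_nil => y /= ->.
apply: filterS2 IHs (pS s) => y /= -> e; rewrite /q.
have f0 := p_ge0 (false :: s) y; have t0 := p_ge0 (true :: s) y.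
have [ps0|ps0] := eqVneq (p s y) 0.
  by rewrite ps0 mul0r; case: b; lra.
have psgt0 : 0 < p s y by rewrite lt0r ps0 p_ge0.
rewrite clamp_id; last first.
  by rewrite divr_ge0//= ?p_ge0// ler_pdivrMr// mul1r e lerDl.
case: b; last by rewrite mulrC divfK.
by rewrite mulrBr mulr1 [p s y * _]mulrC divfK//; lra.
Qed.

(* The conditional probabilities of the bits of [h'] given [xi'] drive fresh
   random bits on the enlarged space of [xi]. *)
Lemma transfer_bits : exists h : nat -> T * R -> seq bool, bit_process h /\
  forall A, measurable A -> forall s,
    enlarge P (((xi \o fst) @^-1` A) `&` [set x | h (size s) x = s]) =
    Q ((xi' @^-1` A) `&` [set w | h' (size s) w = s]).
Proof.
pose q' s (w : T) := q s (xi w).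
have mq' s : measurable_fun setT (q' s) by exact: (measurableT_comp (mq s)).
have q'01 s w : 0 <= q' s w <= 1 by exact: q01.
exists (digits q'); split.
  split=> [//|n w|s]; first by eexists; reflexivity.
  exact: measurable_digits.
move=> A mA s.
have mxA : measurable (xi @^-1` A).
  by rewrite -[X in measurable X]setTI; exact: mxi.
rewrite comp_preimage (enlarge_digits P mq' q'01 s mxA).
have -> : cyl_prob q' s = cyl_prob q s \o xi.
  by apply/funext => w; elim: s => //= b s ->.
have mc : measurable_fun setT (fun y => (cyl_prob q s y)%:E).
  by apply/measurable_EFinP; exact: measurable_cyl_prob.
(* The integrand depends on [w] through [xi w] alone. By [law_xi] the image measure agrees with
   [mu], for which [cyl_prob q s] is a density of [nu s]. *)
transitivity (\int[pushforward P xi]_(y in A) (cyl_prob q s y)%:E)%E.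
  rewrite (ge0_integral_pushforward mxi)//; first exact: measurable_funTS.
  by move=> y _; rewrite lee_fin; exact: cyl_prob_ge0.
rewrite -nuE p_int//.
rewrite (eq_measure_integral mu); last by move=> B mB _; exact: law_xi.
apply: ae_eq_integral => //.
- exact: measurable_funTS.
- by apply: measurable_funTS; exact/measurable_EFinP.
- by apply: filterS (cyl_probE s) => y -> _.
Qed.

End transfer.

Section decode_boxes.
Context (R : realType) (I : countType).
Context (d : measure_display) (T : measurableType d) (P : probability T R).
Variables (xi : T -> R) (h : nat -> T -> seq bool).
Hypothesis mxi : measurable_fun setT xi.
Hypothesis hP : bit_process h.

Definition adjoin (o : option I) (w : T) : R :=
  if o is Some i then decode h i w else xi w.

Lemma measurable_adjoin o : measurable_fun setT (adjoin o).
Proof. by case: o => [i|] //=; exact: measurable_decode. Qed.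

Variables (k : nat) (t : 'I_k -> option I) (x : 'I_k -> R).

(** The box condition with decoded coordinates replaced by their left ends after the word [s], so
    that finitely many bits decide it. *)
Definition low_box (s : seq bool) : set R :=
  [set y | forall j, (if t j is Some i then low R i s else y) <= x j].

Lemma measurable_low_box s : measurable (low_box s).
Proof.
apply: measurable_forall_fin => j; apply: measurable_le_set.
by case: (t j) => [i|]; [exact: measurable_cst|exact: measurable_id].
Qed.

Let mA n : measurable [set w | low_box (h n w) (xi w)].
Proof.
apply: measurable_forall_fin => j; apply: measurable_le_set.
by case: (t j) => [i|] //; have [] := bm_bit_process hP n (low R i).
Qed.

(** Left ends increase to the decoded values, hence these events decrease; because the box is
    closed, their intersection is exactly the box event. *)
Lemma low_box_cvg : P [set w | low_box (h n w) (xi w)] @[n --> \oo] -->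
  P [set w | forall j, adjoin (t j) w <= x j].
Proof.
have -> : [set w | forall j, adjoin (t j) w <= x j] =
    \bigcap_n [set w | low_box (h n w) (xi w)].
  apply/seteqP; split=> w /=.
    move=> Aw n _ j /=; have := Aw j; rewrite /adjoin.
    by case: (t j) => [i|] //; apply: le_trans; exact: low_le_decode.
  move=> Aw j; have {}Aw n := Aw n Logic.I j; move: Aw; rewrite /adjoin /=.
  case: (t j) => [i|]; last by move=> /(_ 0%N).
  move=> Aw; apply: limr_le; first exact: (decode_cvg hP).
  exact: nearW.
apply: nonincreasing_cvg_mu => //.
- by rewrite -ge0_fin_numE// fin_num_measure.
- exact: bigcapT_measurable.
- apply/nonincreasing_seqP => n; apply/subsetPset => w /= Aw j; have := Aw j.
  case: (t j) => [i|] //; apply: le_trans.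
  by have [_ hS _] := hP; have [b ->] := hS n w; exact: low_cons.
Qed.

End decode_boxes.

Section transfer_fdd.
Context (R : realType) (I : countType).
Context (d : measure_display) (T : measurableType d) (P : probability T R).
Context (d' : measure_display) (S : measurableType d') (Q : probability S R).
Variables (xi : T -> R) (xi' : S -> R).
Hypothesis mxi : measurable_fun setT xi.
Hypothesis mxi' : measurable_fun setT xi'.
Variables (h : nat -> T -> seq bool) (h' : nat -> S -> seq bool).
Hypothesis hP : bit_process h.
Hypothesis hP' : bit_process h'.
Hypothesis law : forall A, measurable A -> forall s,
  P ((xi @^-1` A) `&` [set x | h (size s) x = s]) =
  Q ((xi' @^-1` A) `&` [set w | h' (size s) w = s]).

(** [law] fixes the joint law of [xi] and any finite number of bits, hence the probability of every
    [low_box]; the limit fixes that of every closed box. *)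
Lemma adjoin_fdd_eq :
  fdd_eq [set: option I] P (adjoin xi h) Q (adjoin xi' h').
Proof.
apply: fdd_eq_box => [i _|i _|k t _ x]; [exact: measurable_adjoin..|].
have c := @low_box_cvg _ _ _ _ P _ _ mxi hP _ t x.
have c' := @low_box_cvg _ _ _ _ Q _ _ mxi' hP' _ t x.
have e n : P [set w | low_box t x (h n w) (xi w)] =
           Q [set w | low_box t x (h' n w) (xi' w)].
  rewrite -[LHS]fineK; last first.
    apply: fin_num_measure.
    apply: measurable_forall_fin => j; apply: measurable_le_set.
    by case: (t j) => [i|] //; have [] := bm_bit_process hP n (low R i).
  rewrite -[RHS]fineK; last first.
    apply: fin_num_measure.
    apply: measurable_forall_fin => j; apply: measurable_le_set.
    by case: (t j) => [i|] //; have [] := bm_bit_process hP' n (low R i).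
  rewrite (bit_process_measure P hP n mxi (measurable_low_box t x)).
  rewrite (bit_process_measure Q hP' n mxi' (measurable_low_box t x)).
  congr (_%:E); apply: eq_bigr => s _; rewrite law//.
  exact: measurable_low_box.
have c2 : P [set w | low_box t x (h n w) (xi w)] @[n --> \oo] -->
    Q [set w | forall j, adjoin xi' h' (t j) w <= x j].
  by under eq_fun do rewrite e; exact: c'.
exact: cvg_unique c c2.
Qed.

End transfer_fdd.

(** * Sensitivity of the test functions to a change of scale *)

Section phi_scale.
Context (R : realType).
Implicit Types x y l : R.

Lemma phiM_max0 l x : 0 <= l -> phi (l * Num.max 0 x) = phi (l * x).
Proof.
by move=> l0; rewrite -[in RHS]phi_max0 -{2}(mulr0 l) maxr_pMr.
Qed.

(** The difference is [(l' - l) y / ((1 + l y) (1 + l' y))] with [y = x^+], and [l y <= 1 + l y]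
    gives a bound free of [x]. *)
Lemma phi_scale l l' x : 0 < l -> 0 < l' ->
  `|phi (l' * x) - phi (l * x)| <= `|l' - l| / l.
Proof.
move=> l0 l'0; rewrite -(phiM_max0 x (ltW l'0)) -(phiM_max0 x (ltW l0)).
have := max0_ge0 x; set y := Num.max 0 x => y0.
have ly : 0 <= l * y by rewrite mulr_ge0// ltW.
have l'y : 0 <= l' * y by rewrite mulr_ge0// ltW.
rewrite phiB// -mulrBl -mulrA normrM; apply: ler_wpM2l => //.
have h1 : 0 < 1 + l * y by lra.
have h2 : 0 < 1 + l' * y by lra.
rewrite ger0_norm; last by rewrite divr_ge0// mulr_ge0// ltW.
rewrite ler_pdivrMr ?mulr_gt0// -ler_pdivrMl ?invr_gt0// invrK.
nra.
Qed.

Lemma ramp_dist (I : choiceType) (s : seq (I * R)) (m : R) (u v : I -> R) :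
  0 <= m ->
  `|ramp s m u - ramp s m v| <= \sum_(p <- s) m * `|u p.1 - v p.1|.
Proof.
move=> m0; have H u' v' : ramp s m u' - ramp s m v' <=
    \sum_(p <- s) m * `|u' p.1 - v' p.1|.
  rewrite lerBlDl; apply: (le_trans (ramp_diff s m u' v')); rewrite lerD2l.
  apply: ler_sum => p _; apply: (le_trans (clamp_le_norm _)).
  by rewrite normrM (ger0_norm m0) distrC.
rewrite ler_norml H andbT lerNl opprB (le_trans (H v u))//.
by apply: ler_sum => p _; rewrite distrC.
Qed.

End phi_scale.

(** * Multiplicative monotone functions *)

Section power_law.
Context (R : realType).

Lemma additive_monotone_linear (g : R -> R) :
  {morph g : x y / x + y} -> {homo g : x y / x <= y} ->
  forall x, g x = x * g 1.
Proof.
move=> gD gm x.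
have g0 : g 0 = 0 by have := gD 0 0; rewrite addr0; lra.
have gN y : g (- y) = - g y by have := gD y (- y); rewrite subrr g0; lra.
have gMn n y : g (n%:R * y) = n%:R * g y.
  elim: n => [|n IHn]; first by rewrite !mul0r.
  by rewrite -natr1 !mulrDl !mul1r gD IHn.
have gz (z : int) : g z%:~R = z%:~R * g 1.
  case: z => n; first by rewrite -pmulrn -[n%:R in LHS]mulr1 gMn.
  by rewrite NegzE mulrNz gN -pmulrn -[n.+1%:R in LHS]mulr1 gMn mulNr.
have g1 : 0 <= g 1 by rewrite -g0 gm.
have bd n : `|g x - x * g 1| <= g 1 / n.+1%:R.
  (* [(n+1) x] lies between consecutive integers, where [g] is already linear; monotonicity leaves
     an error of [g 1] before division by [n+1]. *)
  pose k := Num.floor (n.+1%:R * x).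
  have /andP[k1 k2] := floor_itv (n.+1%:R * x).
  have := gm _ _ k1; have := gm _ _ (ltW k2); rewrite !gz gMn => h2 h1.
  have n0 : 0 < n.+1%:R :> R by rewrite ltr0n.
  rewrite ler_pdivlMr// -{1}(gtr0_norm n0) -normrM.
  move: k1 k2 h1 h2; rewrite -/k intrD => k1 k2 h1 h2.
  by rewrite ler_norml; apply/andP; split; nra.
apply/eqP; rewrite -subr_eq0 -normr_eq0 eq_le normr_ge0 andbT.
have c : g 1 / n.+1%:R @[n --> \oo] --> (0 : R).
  by have h := cvgM (cvg_cst (g 1)) (@cvg_harmonic R); rewrite mulr0 in h; exact: h.
by apply: (ler_cvg_to (cvg_cst _) c); exact: nearW.
Qed.

(** In logarithmic coordinates this is Cauchy's equation. The condition [1 < r 2] excludes an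
    exponent [<= 0]. *)
Lemma multiplicative_monotone_power (r : R -> R) :
  (forall c, 0 < c -> 0 < r c) ->
  (forall c c', 0 < c -> 0 < c' -> r (c * c') = r c * r c') ->
  (forall c c', 0 < c -> c <= c' -> r c <= r c') ->
  1 < r 2 -> exists2 H, 0 < H & forall c, 0 < c -> r c = c `^ H.
Proof.
move=> r0 rM rm r2.
pose g x := ln (r (expR x)).
have gD : {morph g : x y / x + y}.
  by move=> x y; rewrite /g expRD rM ?expR_gt0// lnM ?posrE ?r0 ?expR_gt0.
have gm : {homo g : x y / x <= y}.
  by move=> x y xy; rewrite /g ler_ln ?posrE ?r0 ?expR_gt0// rm ?expR_gt0// ler_expR.
have gE := additive_monotone_linear gD gm.
have rE c : 0 < c -> r c = c `^ (g 1).
  move=> c0; have := gE (ln c); rewrite /g lnK ?posrE// => e.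
  by rewrite /powR gt_eqF// mulrC -e lnK// posrE r0.
exists (g 1) => //; rewrite ltNge; apply/negP => g1.
have : r 2 <= 1; last by rewrite leNgt r2.
rewrite rE// -[leRHS](@powRr0 _ 2); apply: ler_powR => //.
by rewrite ler1n.
Qed.

End power_law.

(** * Maxima over blocks *)

Section running_max.
Context (R : realType).
Implicit Types (y : nat -> R) (j k l : nat).

(** Starting at [0] builds in the positive part and the value of the empty maximum, and makes
    concatenation valid for blocks of length zero. *)
Fixpoint running_max y k : R :=
  if k is k'.+1 then Num.max (running_max y k') (y k') else 0.

Lemma running_max_ge0 y k : 0 <= running_max y k.
Proof. by elim: k => //= k IHk; rewrite le_max IHk. Qed.

Lemma running_max_cat y k l : running_max y (k + l) =
  Num.max (running_max y k) (running_max (fun i => y (k + i)%N) l).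
Proof.
elim: l => [|l IHl] /=; last by rewrite addnS /= IHl maxA.
by rewrite addn0; apply/esym/max_idPl; exact: running_max_ge0.
Qed.

Lemma running_max_le y : {homo running_max y : k l / (k <= l)%N >-> k <= l}.
Proof.
by move=> k l kl; rewrite -(subnKC kl) running_max_cat le_max lexx.
Qed.

Lemma eq_running_max y y' k : (forall i, (i < k)%N -> y i = y' i) ->
  running_max y k = running_max y' k.
Proof.
elim: k => //= k IHk yy'; rewrite IHk ?yy'// => i ik.
by apply: yy'; rewrite ltnS ltnW.
Qed.

Lemma running_max_ler y k (x : R) : 0 <= x ->
  (forall i, (i < k)%N -> y i <= x) -> running_max y k <= x.
Proof.
move=> x0; elim: k => //= k IHk yx; rewrite ge_max yx//= andbT IHk// => i ik.
by rewrite yx// ltnS ltnW.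
Qed.

Lemma le_running_max y k i : (i < k)%N -> y i <= running_max y k.
Proof.
elim: k => //= k IHk; rewrite ltnS leq_eqVlt => /predU1P[->|/IHk].
  by rewrite le_max lexx orbT.
by rewrite le_max => ->.
Qed.

Context (d : measure_display) (T : measurableType d).

Lemma measurable_running_max (Z : nat -> T -> R) k :
  (forall i, (i < k)%N -> measurable_fun setT (Z i)) ->
  measurable_fun setT (fun w => running_max (Z^~ w) k).
Proof.
elim: k => [|k IHk] mZ /=; first exact: measurable_cst.
by apply: measurable_maxr; [apply: IHk => i ik; apply: mZ; rewrite ltnS ltnW|exact: mZ].
Qed.

End running_max.

Section blocks.
Context (R : realType) (d : measure_display) (T : measurableType d)
  (P : probability T R) (X : nat -> {RV P >-> R}).

(* [block j k] is the positive part of the maximum of [X (j+1), ..., X (j+k)] *)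
Definition block j k w := running_max (fun i => X (j + i).+1 w) k.

Lemma max0_partial_max n w : Num.max 0 (partial_max X n w) = block 0 n w.
Proof.
case: n => [|n]; first by rewrite /= maxxx.
apply/le_anti/andP; split.
  rewrite ge_max running_max_ge0/= /partial_max big_nat; apply: bigmax_le.
    exact: (@le_running_max _ (fun i => X (0 + i).+1 w) n.+1 0).
  move=> [|k] //= kn; exact: (@le_running_max _ (fun i => X (0 + i).+1 w) n.+1 k).
apply: running_max_ler; first exact: max0_ge0.
move=> i i_n; rewrite le_max; apply/orP; right; rewrite /partial_max add0n.
have ii : i.+1 \in index_iota 1 n.+2 by rewrite mem_index_iota.
exact: (@le_bigmax_seq _ _ _ _ _ i.+1 xpredT (fun k => X k w) ii isT).
Qed.

Lemma block_ge0 j k w : 0 <= block j k w.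
Proof. exact: running_max_ge0. Qed.

Lemma block_cat j k l w :
  block j (k + l) w = Num.max (block j k w) (block (j + k) l w).
Proof.
rewrite /block running_max_cat; congr Num.max.
by apply: eq_running_max => i _; rewrite addnA.
Qed.

Lemma measurable_block j k : measurable_fun setT (block j k).
Proof. by apply: measurable_running_max => i _. Qed.

Lemma block_scale_measurable (l : R) j k :
  measurable_fun setT (fun w => phi (l * block j k w)).
Proof.
apply: (measurableT_comp (@measurable_phi R)).
by apply: measurable_funM; [exact: measurable_cst|exact: measurable_block].
Qed.

Hypothesis X_stationary : stationary X.

(** If [K] is the greatest length involved, both sides are the mean of one function of a [K]-tuple
    of consecutive [X]'s, with starting points differing by [j]. *)
Lemma block_stationary (I : choiceType) (s : seq (I * R)) (m l : R)
    (kappa : I -> nat) (j : nat) : 0 <= m ->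
  Ex P (fun w => ramp s m (fun i => phi (l * block j (kappa i) w))) =
  Ex P (fun w => ramp s m (fun i => phi (l * block 0 (kappa i) w))).
Proof.
move=> m0; pose K := (\max_(p <- s) kappa p.1)%N.
have kK p : p \in s -> (kappa p.1 <= K)%N.
  by move=> ps; exact: (@leq_bigmax_seq _ s xpredT (fun p => kappa p.1)).
pose t (i : 'I_K) : nat := i.+1.
(* The default [0] is never read: for indices occurring in [s] the positions stay below
   [kappa i <= K]. *)
pose g (y : K.-tuple R) := ramp s m (fun i => phi (l * running_max (nth 0 y) (kappa i))).
have gE (Z : nat -> T -> R) w :
    ramp s m (fun i => phi (l * running_max (fun a => Z a.+1 w) (kappa i))) =
    g (joint Z t w).
  apply: eq_ramp => p ps; congr (phi (_ * _)); apply: eq_running_max => a ak.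
  have aK : (a < K)%N by rewrite (leq_trans ak)// kK.
  by rewrite (_ : a = Ordinal aK)// -tnth_nth tnth_mktuple.
transitivity (Ex P (fun w => g (joint (fun k w => X (k + j)%N w) t w))).
  congr Ex; apply/funext => w; rewrite -gE; apply: eq_ramp => p _.
  by congr (phi (_ * _)); apply: eq_running_max => a _; rewrite addSn addnC.
transitivity (Ex P (fun w => g (joint (fun k w => X k w) t w))); last first.
  by congr Ex; apply/funext => w; rewrite -gE.
apply: (fdd_eq_Ex _ _ (X_stationary j)) => // [|y]; last exact: ramp01.
apply: measurable_ramp => p _; apply: (measurableT_comp (@measurable_phi R)).
apply: measurable_funM; first exact: measurable_cst.
apply: measurable_running_max => a _.
have [aK|Ka] := ltnP a K.
  rewrite (_ : (fun y : K.-tuple R => _) = fun y : K.-tuple R => tnth y (Ordinal aK)).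
    exact: measurable_tnth.
  by apply/funext => y; rewrite (tnth_nth 0).
have -> : (fun y : K.-tuple R => nth 0 y a) = fun=> 0.
  by apply/funext => y; rewrite nth_default// size_tuple.
exact: measurable_cst.
Qed.

Lemma ramp_one_sub (I : choiceType) (i : I) (u : I -> R) : 0 <= u i <= 1 ->
  ramp [:: (i, 1)] 1 u = 1 - u i.
Proof.
move=> u01; rewrite ramp_cons ramp_nil mul1r /= clamp_id; last by lra.
by apply/min_idPl; lra.
Qed.

(** Reads a result about ramps as one about the mean of [phi]: the one-term ramp with threshold and
    slope [1] is [1 - phi]. *)
Lemma Ex_phi_ramp (d0 : measure_display) (T0 : measurableType d0)
    (P0 : probability T0 R) (I : choiceType) (i : I) (u : I -> T0 -> R) :
  measurable_fun setT (u i) ->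
  Ex P0 (fun w => phi (u i w)) =
  1 - Ex P0 (fun w => ramp [:: (i, 1)] 1 (fun i => phi (u i w))).
Proof.
move=> mu; have p01 w : 0 <= phi (u i w) <= 1 by rewrite phi_ge0 ltW ?phi_lt1.
under [in RHS]eq_fun do rewrite ramp_one_sub//.
rewrite ExB; [|exact: bm_cst|apply: bm01 => //; exact: (measurableT_comp (@measurable_phi R))].
by rewrite Ex_cst opprB addrC subrK.
Qed.

Lemma Ex_phi_block (l : R) j k :
  Ex P (fun w => phi (l * block j k w)) = Ex P (fun w => phi (l * block 0 k w)).
Proof.
have h j' := Ex_phi_ramp P (i := tt) (u := fun=> fun w => l * block j' k w).
rewrite !h//; try by apply: measurable_funM; [exact: measurable_cst|exact: measurable_block].
by congr (1 - _); exact: (@block_stationary unit [:: (tt, 1)] 1 l (fun=> k) j).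
Qed.

End blocks.

Lemma continuous_bigmin (R : realType) (S : topologicalType) (J : Type)
    (l : seq J) (F : J -> S -> R) :
  (forall j, continuous (F j)) ->
  continuous (fun z => \big[Num.min/1]_(j <- l) F j z).
Proof.
move=> cF; elim: l => [|j l IHl].
  by under eq_fun do rewrite big_nil; exact: cst_continuous.
under eq_fun do rewrite big_cons.
by move=> z; apply: continuous_min; [exact: cF|exact: IHl].
Qed.

Lemma cvg_clamp (R : realType) (J : Type) (F : set_system J) (FF : Filter F)
    (f : J -> R) (b : R) :
  f j @[j --> F] --> b -> clamp (f j) @[j --> F] --> clamp b.
Proof. by move=> fb; apply: continuous_cvg fb; exact: continuous_clamp. Qed.

Lemma cvg_phi (R : realType) (J : Type) (F : set_system J) (FF : Filter F)
    (f : J -> R) (b : R) :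
  f j @[j --> F] --> b -> phi (f j) @[j --> F] --> phi b.
Proof. by move=> fb; apply: continuous_cvg fb; exact: continuous_phi. Qed.

(** * The limit process *)

Section limit_process.
Context (R : realType) (d : measure_display) (T : measurableType d)
  (P : probability T R) (X : nat -> {RV P >-> R}) (a : nat -> R).
Context (d' : measure_display) (T' : measurableType d') (Q : probability T' R)
  (Y : R -> {RV Q >-> R}).
Hypothesis X_stationary : stationary X.
Hypothesis a_pinfty : a n @[n --> \oo] --> +oo.
Hypothesis M_cvg : fdd_cvg [set t : R | 0 <= t]
  P (fun n t w => (a n)^-1 * partial_max X (Num.truncn (n%:R * t)) w)
  Q (fun t w => Y t w).

Let Z n (t : R) w := (a n)^-1 * partial_max X (Num.truncn (n%:R * t)) w.

Lemma M_cvg_Ex k (t : 'I_k -> R) (f : 'rV[R]_k -> R) :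
  (forall i, 0 <= t i) -> continuous f -> (forall z, 0 <= f z <= 1) ->
  measurable_fun setT (fun w => f (\row_i Y (t i) w)) ->
  Ex P (fun w => f (\row_i Z n (t i) w)) @[n --> \oo] -->
  Ex Q (fun w => f (\row_i Y (t i) w)).
Proof.
move=> t0 cf f01 mf.
have fb : exists C : R, forall z, `|f z| <= C.
  by exists 1 => z; have /andP[z0 z1] := f01 z; rewrite ger0_norm.
have := M_cvg t0 cf fb; rewrite Ex_expectation; last first.
  by apply: bm01 => // w; exact: f01.
by move=> /fine_cvg; rewrite unlock.
Qed.

(** Continuity is required coordinatewise along filters, so that test functions of a few times need
    no mention of row vectors. *)
Lemma M_cvg_fun k (t : 'I_k -> R) (g : ('I_k -> R) -> R) :
  (forall i, 0 <= t i) ->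
  (forall (J : Type) (F : set_system J), Filter F ->
    forall (v : J -> 'I_k -> R) (u : 'I_k -> R),
    (forall i, v j i @[j --> F] --> u i) -> g (v j) @[j --> F] --> g u) ->
  (forall u, 0 <= g u <= 1) ->
  measurable_fun setT (fun w => g (fun i => Y (t i) w)) ->
  Ex P (fun w => g (fun i => Z n (t i) w)) @[n --> \oo] -->
  Ex Q (fun w => g (fun i => Y (t i) w)).
Proof.
move=> t0 cg g01 mg; have gE (u : R -> R) :
    g (fun i => u (t i)) = g ((\row_i u (t i)) 0).
  by congr g; apply/funext => i; rewrite mxE.
under eq_fun do (under eq_fun do rewrite (gE (fun t => Z _ t _))).
rewrite (_ : (fun w => g (fun i => Y (t i) w)) =
  fun w => g ((\row_i Y (t i) w) 0)); last first.
  by apply/funext => w; rewrite (gE (fun t => Y t w)).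
have cg0 : continuous (fun z : 'rV[R]_k => g (z 0)).
  move=> z; apply: (cg _ (nbhs z) _ (fun z' : 'rV[R]_k => z' 0) (z 0)) => i.
  exact: coord_continuous.
apply: (M_cvg_Ex t0 cg0) => [z|]; first exact: g01.
by under eq_fun do rewrite -(gE (fun t => Y t _)).
Qed.

Lemma a_gt0 : \forall n \near \oo, 0 < a n.
Proof. by move/cvgryPgt : a_pinfty; exact. Qed.

Definition rescaled_max n (t : R) w :=
  (a n)^-1 * block X 0 (Num.truncn (n%:R * t)) w.

Local Notation A := rescaled_max.

Lemma phi_Z n t w l : 0 < a n -> 0 <= l -> phi (l * Z n t w) = phi (l * A n t w).
Proof.
move=> an l0; rewrite /A -max0_partial_max /Z !mulrA phiM_max0//.
by rewrite mulr_ge0// invr_ge0 ltW.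
Qed.

Lemma A_cvg_ramp (s : seq (R * R)) m l : (forall p, p \in s -> 0 <= p.1) ->
  0 <= m -> 0 <= l ->
  Ex P (fun w => ramp s m (fun t => phi (l * A n t w))) @[n --> \oo] -->
  Ex Q (fun w => ramp s m (fun t => phi (l * Y t w))).
Proof.
move=> s0 m0 l0.
pose t (i : 'I_(size s)) := (tnth (in_tuple s) i).1.
have t0 i : 0 <= t i by apply: s0; exact: mem_tnth.
pose f (z : 'rV[R]_(size s)) := \big[Num.min/1]_(i <- enum 'I_(size s))
  clamp ((tnth (in_tuple s) i).2 - m * phi (l * z 0 i)).
have fE (u : R -> R) : f (\row_i u (t i)) = ramp s m (fun t => phi (l * u t)).
  rewrite /f /ramp [RHS]big_tnth big_enum /=; apply: eq_bigr => i _.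
  by rewrite mxE.
have h := M_cvg_Ex (t := t) (f := f) t0.
have : Ex P (fun w => f (\row_i Z n (t i) w)) @[n --> \oo] -->
       Ex Q (fun w => f (\row_i Y (t i) w)).
  apply: h.
  - apply: continuous_bigmin => i z.
    have c0 : l * z' 0 i @[z' --> z] --> l * z 0 i.
      by apply: cvgM; [exact: cvg_cst|exact: coord_continuous].
    have c1 : (tnth (in_tuple s) i).2 - m * phi (l * z' 0 i) @[z' --> z] -->
        (tnth (in_tuple s) i).2 - m * phi (l * z 0 i).
      apply: cvgB; first exact: cvg_cst.
      by apply: cvgM; [exact: cvg_cst|exact: cvg_phi].
    exact: cvg_clamp c1.
  - move=> z; rewrite /f; elim: (enum _) => [|i r /andP[r0 r1]].
      by rewrite big_nil ler01 lexx.
    by rewrite big_cons le_min clamp_ge0 r0 ge_min r1 orbT.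
  - under eq_fun do rewrite (fE (fun t => Y t _)).
    apply: measurable_ramp => p _; apply: (measurableT_comp (@measurable_phi R)).
    by apply: measurable_funM; [exact: measurable_cst|].
under [X in _ --> Ex Q X -> _]eq_fun do rewrite (fE (fun t => Y t _)).
(* The hypothesis concerns [partial_max]; once [a n > 0], [phi] does not distinguish it from the
   block maximum. *)
apply: cvg_trans; apply: near_eq_cvg.
near=> n; congr Ex; apply/funext => w; rewrite (fE (fun t => Z n t w)).
apply: eq_ramp => p _; rewrite phi_Z//; near: n; exact: a_gt0.
Unshelve. all: by end_near.
Qed.

Lemma a_inv_cvg0 : (a n)^-1 @[n --> \oo] --> (0 : R).
Proof. by apply/gtr0_cvgV0 => //; exact: a_gt0. Qed.

Lemma Ex_clamp_cvg0 (f : T -> R) : measurable_fun setT f ->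
  Ex P (fun w => clamp ((a n)^-1 * f w)) @[n --> \oo] --> (0 : R).
Proof.
move=> mf; rewrite -(Ex_cst P 0); apply: (@Ex_cvg _ _ _ _ _ _ 1).
- move=> n; apply: (measurableT_comp (@measurable_clamp R)).
  by apply: measurable_funM; [exact: measurable_cst|].
- exact: measurable_cst.
- by move=> n w; rewrite ger0_norm ?clamp_ge0// clamp_le1.
apply: aeW => w; rewrite -(clamp_le0 (lexx 0)) -[in clamp 0](mul0r (f w)).
have h : (a n)^-1 * f w @[n --> \oo] --> 0 * f w.
  by apply: cvgM; [exact: a_inv_cvg0|exact: cvg_cst].
exact: cvg_clamp h.
Qed.

Lemma Ex_phi_block_cvg0 (l : R) L : 0 <= l ->
  Ex P (fun w => phi (l * ((a n)^-1 * block X 0 L w))) @[n --> \oo] --> (0 : R).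
Proof.
move=> l0; rewrite -(Ex_cst P 0); apply: (@Ex_cvg _ _ _ _ _ _ 1).
- move=> n; under eq_fun do rewrite mulrA; exact: block_scale_measurable.
- exact: measurable_cst.
- by move=> n w; rewrite ger0_norm ?phi_ge0// ltW// phi_lt1.
apply: aeW => w.
rewrite -(phi0 R) -[in phi 0](mulr0 l) -[in l * 0](mul0r (block X 0 L w)).
have h : l * ((a n)^-1 * block X 0 L w) @[n --> \oo] --> l * (0 * block X 0 L w).
  apply: cvgM; first exact: cvg_cst.
  by apply: cvgM; [exact: a_inv_cvg0|exact: cvg_cst].
exact: cvg_phi h.
Qed.

Lemma partial_max_lb n w : - `|X 1%N w| <= partial_max X n w.
Proof.
case: n => [|n]; first by rewrite /= oppr_le0.
rewrite /partial_max (@le_trans _ _ (X 1%N w))//.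
  by rewrite lerNl -normrN ler_norm.
exact: bigmax_ge_id.
Qed.

Lemma measurable_partial_max n : measurable_fun setT (partial_max X n).
Proof.
case: n => [|n]; first exact: measurable_cst.
rewrite /partial_max /=; elim: (index_iota _ _) => [|k s IHs].
  rewrite (_ : (fun w => _) = X 1%N)//.
  by apply/funext => w; rewrite big_nil.
rewrite (_ : (fun w => _) = fun w =>
    Num.max (X k w) (\big[Num.max/X 1%N w]_(i <- s) X i w)).
  exact: measurable_maxr.
by apply/funext => w; rewrite big_cons.
Qed.

Lemma Z_lb n t w : 0 < a n -> - Z n t w <= (a n)^-1 * `|X 1%N w|.
Proof.
move=> an; rewrite /Z -mulrN; apply: ler_wpM2l; first by rewrite invr_ge0 ltW.
by rewrite lerNl partial_max_lb.
Qed.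

Lemma clamp_eq0 (x : R) : clamp x = 0 -> x <= 0.
Proof. by rewrite /clamp; case_minmax; lra. Qed.

(** [partial_max X n] is at least [- |X 1|] for every [n], and this bound vanishes after division by
    [a n]. *)
Lemma Y_ge0 t : 0 <= t -> {ae Q, forall w, 0 <= Y t w}.
Proof.
move=> t0.
have mY : measurable_fun setT (fun w => clamp (- Y t w)).
  by apply: (measurableT_comp (@measurable_clamp R)); exact: measurableT_comp.
have c : Ex P (fun w => clamp (- Z n t w)) @[n --> \oo] -->
    Ex Q (fun w => clamp (- Y t w)).
  apply: (@M_cvg_fun 1 (fun=> t) (fun u => clamp (- u 0))) => // [J F FF v u vu|u].
    have h : - v j 0 @[j --> F] --> - u 0 by apply: cvgN; exact: vu.
    exact: cvg_clamp h.
  exact: clamp01.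
have mX1 : measurable_fun setT (fun w => `|X 1%N w|) by exact: measurableT_comp.
have E0 : Ex Q (fun w => clamp (- Y t w)) = 0.
  apply/le_anti/andP; split; last by apply: Ex_ge0 => w; exact: clamp_ge0.
  apply: (ler_cvg_to c (Ex_clamp_cvg0 mX1)).
  near=> n; have an : 0 < a n by near: n; exact: a_gt0.
  apply: Ex_le => [| |w].
  - apply: bm01 => [|w]; last exact: clamp01.
    apply: (measurableT_comp (@measurable_clamp R)); apply: measurableT_comp => //.
    by apply: measurable_funM; [exact: measurable_cst|exact: measurable_partial_max].
  - apply: bm01 => [|w]; last exact: clamp01.
    apply: (measurableT_comp (@measurable_clamp R)).
    by apply: measurable_funM; [exact: measurable_cst|].
  - by apply: le_clamp; exact: Z_lb.
apply: filterS (Ex_eq0 (bm01 mY (fun w => clamp01 _)) (fun w => clamp_ge0 _) E0).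
by move=> w /clamp_eq0; rewrite oppr_le0.
Unshelve. all: by end_near.
Qed.

(** This rests on the convention [M_0 = 0]: at time [0] the normalized maxima vanish identically. *)
Lemma Y0_eq0 : {ae Q, forall w, Y 0 w = 0}.
Proof.
have mY : measurable_fun setT (fun w => clamp (Y 0 w)).
  exact: (measurableT_comp (@measurable_clamp R)).
have c : Ex P (fun w => clamp (Z n 0 w)) @[n --> \oo] -->
    Ex Q (fun w => clamp (Y 0 w)).
  apply: (@M_cvg_fun 1 (fun=> 0) (fun u => clamp (u 0))) => // [J F FF v u vu|u].
    exact: cvg_clamp (vu 0).
  exact: clamp01.
have E0 : Ex Q (fun w => clamp (Y 0 w)) = 0.
  have c0 : Ex P (fun w => clamp (Z n 0 w)) @[n --> \oo] --> (0 : R).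
    apply: cvg_near_cst; apply: nearW => n.
    rewrite (_ : (fun w => _) = fun=> 0) ?Ex_cst//.
    by apply/funext => w; rewrite /Z mulr0 truncn0 /= mulr0 clamp_le0.
  exact: cvg_unique c c0.
apply: filterS2 (Y_ge0 (lexx 0)) (Ex_eq0 (bm01 mY (fun w => clamp01 _))
  (fun w => clamp_ge0 _) E0) => w Y0 /clamp_eq0 Y1.
by apply/le_anti; rewrite Y0 Y1.
Qed.

Lemma A_homo n w : 0 < a n -> {homo (A n)^~ w : s t / s <= t}.
Proof.
move=> an s t st; apply: ler_wpM2l; first by rewrite invr_ge0 ltW.
by apply: running_max_le; apply: le_truncn; exact: ler_wpM2l.
Qed.

(** The continuous test [clamp (phi u - phi v)] vanishes exactly when [phi u <= phi v], so an order
    between the approximations survives in the limit. *)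
Lemma phi_Y_homo s t : 0 <= s -> s <= t ->
  {ae Q, forall w, phi (Y s w) <= phi (Y t w)}.
Proof.
move=> s0 st; pose f u v : R := clamp (phi u - phi v).
have mY : measurable_fun setT (fun w => f (Y s w) (Y t w)).
  apply: (measurableT_comp (@measurable_clamp R)).
  by apply: measurable_funB; apply: (measurableT_comp (@measurable_phi R)).
pose tt (i : 'I_2) := if i == 0 then s else t.
have c : Ex P (fun w => f (Z n s w) (Z n t w)) @[n --> \oo] -->
    Ex Q (fun w => f (Y s w) (Y t w)).
  apply: (@M_cvg_fun 2 tt (fun u => f (u 0) (u 1))) => // [i|J F FF v u vu|u].
  - by rewrite /tt; case: ifP => // _; exact: le_trans st.
  - have h : phi (v j 0) - phi (v j 1) @[j --> F] --> phi (u 0) - phi (u 1).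
      by apply: cvgB; apply: cvg_phi; exact: vu.
    exact: cvg_clamp h.
  - exact: clamp01.
have E0 : Ex Q (fun w => f (Y s w) (Y t w)) = 0.
  have c0 : Ex P (fun w => f (Z n s w) (Z n t w)) @[n --> \oo] --> (0 : R).
    apply: cvg_near_cst; near=> n; have an : 0 < a n by near: n; exact: a_gt0.
    rewrite (_ : (fun w => _) = fun=> 0) ?Ex_cst//.
    apply/funext => w; rewrite /f clamp_le0//.
    have := @phi_Z n s w 1 an ler01; rewrite !mul1r => ->.
    have := @phi_Z n t w 1 an ler01; rewrite !mul1r => ->.
    by rewrite subr_le0 le_phi// A_homo.
  exact: cvg_unique c c0.
apply: filterS (Ex_eq0 (bm01 mY (fun w => clamp01 _)) (fun w => clamp_ge0 _) E0).
by move=> w /clamp_eq0; rewrite subr_le0.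
Unshelve. all: by end_near.
Qed.

End limit_process.

(** * Perturbation of the test functions and rescaled times *)

Lemma Ex_ramp_dist (R : realType) (d : measure_display) (T : measurableType d)
    (P : probability T R) (I : choiceType) (s : seq (I * R)) (m : R)
    (U V W : I -> T -> R) : 0 <= m ->
  (forall p, p \in s -> measurable_fun setT (U p.1)) ->
  (forall p, p \in s -> measurable_fun setT (V p.1)) ->
  (forall i, bounded_measurable (W i)) ->
  (forall p w, p \in s -> `|U p.1 w - V p.1 w| <= W p.1 w) ->
  `|Ex P (fun w => ramp s m (U ^~ w)) - Ex P (fun w => ramp s m (V ^~ w))| <=
  \sum_(p <- s) m * Ex P (W p.1).
Proof.
move=> m0 mU mV bW UVW.
have bU : bounded_measurable (fun w => ramp s m (U ^~ w)) by exact: bm_ramp.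
have bV : bounded_measurable (fun w => ramp s m (V ^~ w)) by exact: bm_ramp.
have bS : bounded_measurable (fun w => \sum_(p <- s) m * W p.1 w).
  by apply: bm_sum => p; apply: bmM; [exact: bm_cst|].
have bD : bounded_measurable (fun w => ramp s m (U ^~ w) - ramp s m (V ^~ w)).
  by apply: bmD => //; exact: bmN.
rewrite -ExB//; apply: (le_trans (Ex_norm_le P bD)).
under [leRHS]eq_bigr do rewrite -ExZ//.
rewrite -Ex_sum; last by move=> p; apply: bmM; [exact: bm_cst|].
apply: Ex_le => // [|w]; first exact: bm_norm.
apply: (le_trans (ramp_dist s _ _ m0)); rewrite big_seq [leRHS]big_seq.
by apply: ler_sum => p ps; apply: ler_wpM2l => //; exact: UVW.
Qed.

Lemma cvg_dist_trans (R : realType) (J : Type) (F : set_system J)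
    (FF : Filter F) (f g e : J -> R) (b : R) :
  f j @[j --> F] --> b -> e j @[j --> F] --> (0 : R) ->
  (\forall j \near F, `|g j - f j| <= e j) -> g j @[j --> F] --> b.
Proof.
move=> fb e0 gfe.
have h : g j - f j @[j --> F] --> (0 : R).
  apply/cvgrPdist_le => x x0.
  have /cvgrPdist_le/(_ x x0) := e0; apply: filterS2 gfe => j gfej.
  rewrite !sub0r !normrN => ex; apply: (le_trans gfej).
  exact: le_trans (ler_norm _) ex.
have h2 : f j + (g j - f j) @[j --> F] --> b + 0 by exact: cvgD.
rewrite addr0 in h2; apply: cvg_trans h2; apply: near_eq_cvg.
by apply: nearW => j; rewrite addrC subrK.
Qed.

Lemma cvg_sum0 (R : realType) (J : Type) (I : eqType) (F : set_system J)
    (FF : Filter F) (s : seq I) (f : I -> J -> R) :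
  (forall i, i \in s -> f i j @[j --> F] --> (0 : R)) ->
  \sum_(i <- s) f i j @[j --> F] --> (0 : R).
Proof.
elim: s => [|i s IHs] f0.
  by under eq_fun do rewrite big_nil; exact: cvg_cst.
under eq_fun do rewrite big_cons.
have h : f i j + \sum_(i <- s) f i j @[j --> F] --> (0 + 0 : R).
  apply: cvgD; first by apply: f0; rewrite mem_head.
  by apply: IHs => k ks; apply: f0; rewrite inE ks orbT.
by rewrite addr0 in h.
Qed.

Lemma cvgM0 (R : realType) (J : Type) (F : set_system J)
    (FF : Filter F) (c : R) (f : J -> R) :
  f j @[j --> F] --> (0 : R) -> c * f j @[j --> F] --> (0 : R).
Proof.
move=> f0; have h : c * f j @[j --> F] --> c * 0 by apply: cvgM => //; exact: cvg_cst.
by rewrite mulr0 in h.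
Qed.

Lemma truncn_close (R : realType) (x y t : R) : 0 <= x -> 0 <= t ->
  x <= y -> y <= x + t ->
  (Num.truncn x <= Num.truncn y <= Num.truncn x + (Num.truncn t).+1)%N.
Proof.
move=> x0 t0 xy yxt; apply/andP; split; first exact: le_truncn.
have /andP[_ x1] := truncn_itv x0; have /andP[_ t1] := truncn_itv t0.
rewrite truncn_le_nat; apply: (le_lt_trans yxt).
by apply: (lt_le_trans (ltrD x1 t1)); rewrite -natrD ler_nat; lia.
Qed.

Section rescaling.
Context (R : realType) (d : measure_display) (T : measurableType d)
  (P : probability T R) (X : nat -> {RV P >-> R}) (a : nat -> R).
Context (d' : measure_display) (T' : measurableType d') (Q : probability T' R)
  (Y : R -> {RV Q >-> R}).
Hypothesis X_stationary : stationary X.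
Hypothesis a_pinfty : a n @[n --> \oo] --> +oo.
Hypothesis M_cvg : fdd_cvg [set t : R | 0 <= t]
  P (fun n t w => (a n)^-1 * partial_max X (Num.truncn (n%:R * t)) w)
  Q (fun t w => Y t w).

Local Notation A := (rescaled_max X a).

Lemma measurable_phi_scale (l b : R) j k :
  measurable_fun setT (fun w => phi (l * (b * block X j k w))).
Proof. by under eq_fun do rewrite mulrA; exact: block_scale_measurable. Qed.

Lemma bm_phi_scale (l b : R) j k :
  bounded_measurable (fun w => phi (l * (b * block X j k w))).
Proof.
apply: bm01 => [|w]; first exact: measurable_phi_scale.
by rewrite phi_ge0 ltW// phi_lt1.
Qed.

Lemma bm_phi_Y (l t : R) : bounded_measurable (fun w => phi (l * Y t w)).
Proof.
apply: bm01 => [|w]; last by rewrite phi_ge0 ltW// phi_lt1.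
apply: (measurableT_comp (@measurable_phi R)).
by apply: measurable_funM; [exact: measurable_cst|].
Qed.

Lemma phi_dist_max (x y : R) : 0 <= x -> 0 <= y ->
  `|phi (Num.max x y) - phi x| <= phi y.
Proof.
move=> x0 y0; have := phi_subadd x0 y0.
have : phi x <= phi (Num.max x y) by rewrite le_phi// le_max lexx.
by rewrite ler_norml => h1 h2; apply/andP; split; have := phi_ge0 y; lra.
Qed.

(** Lengthening a block acts only through the maximum over its at most [L] extra terms, which
    stationarity moves back to the origin. *)
Lemma block_perturb n (s : seq (R * R)) (m l b : R) (kappa kappa' : R -> nat) L :
  0 <= m -> 0 <= l -> 0 <= b ->
  (forall p, p \in s -> (kappa p.1 <= kappa' p.1 <= kappa p.1 + L)%N) ->
  `|Ex P (fun w => ramp s m (fun t => phi (l * (b * block X n (kappa' t) w)))) -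
    Ex P (fun w => ramp s m (fun t => phi (l * (b * block X n (kappa t) w))))| <=
  \sum_(p <- s) m * Ex P (fun w => phi (l * (b * block X 0 L w))).
Proof.
move=> m0 l0 b0 kk.
pose W (t : R) w := phi (l * (b * block X (n + kappa t) (kappa' t - kappa t) w)).
apply: (@le_trans _ _ (\sum_(p <- s) m * Ex P (W p.1))).
  apply: Ex_ramp_dist => //.
  - by move=> p _; exact: measurable_phi_scale.
  - by move=> p _; exact: measurable_phi_scale.
  - by move=> t; exact: bm_phi_scale.
  - move=> p w /kk/andP[k1 _].
    rewrite -(subnKC k1) block_cat maxr_pMr// maxr_pMr//.
    by apply: phi_dist_max; rewrite !mulr_ge0// block_ge0.
rewrite big_seq [leRHS]big_seq; apply: ler_sum => p /kk/andP[k1 k2].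
apply: ler_wpM2l => //; rewrite /W.
have E j k : (fun w => phi (l * (b * block X j k w))) =
    fun w => phi (l * b * block X j k w).
  by apply/funext => w; rewrite mulrA.
rewrite E Ex_phi_block// -E; apply: Ex_le => [||w]; [exact: bm_phi_scale..|].
apply: le_phi; do 2 apply: ler_wpM2l => //.
by apply: running_max_le; rewrite leq_subLR.
Qed.

Section scale.
Variable c : R.
Hypothesis c0 : 0 < c.

Definition scaled_index n := Num.truncn (c * n%:R).
Local Notation N := scaled_index.

Lemma scaled_index_cvg : N n @[n --> \oo] --> \oo.
Proof.
apply/cvgnyPge => M; near=> n.
rewrite truncn_ge_nat; last by rewrite mulr_ge0// ltW.
rewrite mulrC -ler_pdivrMr//.
by near: n; exact: nbhs_infty_ger.
Unshelve. all: by end_near.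
Qed.

Lemma rescaled_cvg (s : seq (R * R)) m l : (forall p, p \in s -> 0 <= p.1) ->
  0 <= m -> 0 <= l ->
  Ex P (fun w => ramp s m (fun t => phi (l * ((a (N n))^-1 *
    block X 0 (Num.truncn (n%:R * (c * t))) w)))) @[n --> \oo] -->
  Ex Q (fun w => ramp s m (fun t => phi (l * Y t w))).
Proof.
move=> s0 m0 l0.
have h := cvg_comp _ _ scaled_index_cvg (A_cvg_ramp a_pinfty M_cvg s0 m0 l0).
(* [N n <= c n < N n + 1], so [N n * t] and [n c t] differ by at most [t] and their integer parts by
   at most [truncn t + 1]. *)
pose L := (\max_(p <- s) (Num.truncn p.1).+1)%N.
have e0 := cvg_comp _ _ scaled_index_cvg (Ex_phi_block_cvg0 X a_pinfty L l0).
apply: (@cvg_dist_trans _ _ _ _ _ _ (fun n => \sum_(p <- s) m *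
    Ex P (fun w => phi (l * ((a (N n))^-1 * block X 0 L w)))) _ h).
  by apply: cvg_sum0 => p _; apply: cvgM0; exact: e0.
have aN : \forall n \near \oo, 0 < a (N n).
  exact: (scaled_index_cvg (a_gt0 a_pinfty)).
near=> n; apply: block_perturb => //.
  by rewrite invr_ge0 ltW//; near: n.
move=> p ps; have p0 := s0 p ps.
have cn : 0 <= c * n%:R by rewrite mulr_ge0// ltW.
have /andP[N1 N2] := truncn_itv cn.
have /andP[-> k2] : (Num.truncn ((N n)%:R * p.1) <= Num.truncn (n%:R * (c * p.1)) <=
    Num.truncn ((N n)%:R * p.1) + (Num.truncn p.1).+1)%N.
  apply: truncn_close => //.
  - by rewrite mulr_ge0.
  - by rewrite mulrA [_ * c]mulrC ler_wpM2r.
  - rewrite mulrA [_ * c]mulrC -[X in _ + X]mul1r -mulrDl ler_wpM2r// ltW//.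
    by rewrite natr1.
apply: (leq_trans k2); rewrite leq_add2l.
exact: (@leq_bigmax_seq _ s xpredT (fun p => (Num.truncn p.1).+1)).
Unshelve. all: by end_near.
Qed.

End scale.
End rescaling.

(** * Convergence of types *)

Section type_convergence.
Context (R : realType) (d : measure_display) (T : measurableType d)
  (P : probability T R) (X : nat -> {RV P >-> R}) (a : nat -> R).
Context (d' : measure_display) (T' : measurableType d') (Q : probability T' R)
  (Y : R -> {RV Q >-> R}).
Hypothesis X_stationary : stationary X.
Hypothesis a_pinfty : a n @[n --> \oo] --> +oo.
Hypothesis Y_nondegenerate : forall t : R, 0 <= t -> t != 1 ->
  (Q [set w | Y t w = Y 1%R w] < 1)%E.
Hypothesis M_cvg : fdd_cvg [set t : R | 0 <= t]
  P (fun n t w => (a n)^-1 * partial_max X (Num.truncn (n%:R * t)) w)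
  Q (fun t w => Y t w).

Local Notation A := (rescaled_max X a).

(** Stands in for the law of [l Y(1)]: by strict monotonicity this single number determines the
    scale [l >= 0]. *)
Definition scale_mean (l : R) := Ex Q (fun w => phi (l * Y 1 w)).
Local Notation G := scale_mean.

Lemma A_cvg_phi t l : 0 <= t -> 0 <= l ->
  Ex P (fun w => phi (l * A n t w)) @[n --> \oo] --> Ex Q (fun w => phi (l * Y t w)).
Proof.
move=> t0 l0.
rewrite (Ex_phi_ramp Q (i := t) (u := fun t w => l * Y t w)); last first.
  by apply: measurable_funM; [exact: measurable_cst|].
under eq_fun => n.
  rewrite (Ex_phi_ramp P (i := t) (u := fun t w => l * A n t w)).
    over.
  apply: measurable_funM; first exact: measurable_cst.
  by apply: measurable_funM; [exact: measurable_cst|exact: measurable_block].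
apply: cvgB; first exact: cvg_cst.
by apply: A_cvg_ramp => // p; rewrite inE => /eqP ->.
Qed.

Lemma rescaled_cvg_phi c t l : 0 < c -> 0 <= t -> 0 <= l ->
  Ex P (fun w => phi (l * ((a (scaled_index c n))^-1 *
    block X 0 (Num.truncn (n%:R * (c * t))) w))) @[n --> \oo] -->
  Ex Q (fun w => phi (l * Y t w)).
Proof.
move=> c0 t0 l0.
rewrite (Ex_phi_ramp Q (i := t) (u := fun t w => l * Y t w)); last first.
  by apply: measurable_funM; [exact: measurable_cst|].
under eq_fun => n.
  rewrite (Ex_phi_ramp P (i := t) (u := fun t w => l * ((a (scaled_index c n))^-1 *
    block X 0 (Num.truncn (n%:R * (c * t))) w))).
    over.
  apply: measurable_funM; first exact: measurable_cst.
  by apply: measurable_funM; [exact: measurable_cst|exact: measurable_block].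
apply: cvgB; first exact: cvg_cst.
by apply: (rescaled_cvg X_stationary) => // p; rewrite inE => /eqP ->.
Qed.

Lemma Y_not_ae t : 0 <= t -> t != 1 -> ~ {ae Q, forall w, Y t w = Y 1 w}.
Proof.
move=> t0 t1 [N [mN QN subN]]; have := Y_nondegenerate t0 t1.
have mE : measurable [set w | Y t w = Y 1 w].
  rewrite (_ : [set w | _] = (fun w => Y t w == Y 1 w) @^-1` [set true]).
    rewrite -[X in measurable X]setTI.
    by apply: (measurable_fun_eqr (f := Y t) (g := Y 1)).
  by apply/seteqP; split=> w /= /eqP.
rewrite (_ : Q _ = 1%E) ?ltxx//.
apply/eqP; rewrite eq_le probability_le1//=.
rewrite -(probability_setT Q) -(setUv [set w | Y t w = Y 1 w]).
apply: (le_trans (measureU2 _ _ _)) => //; first exact: measurableC.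
rewrite [X in (_ + X)%E](_ : _ = 0%E) ?adde0//.
apply/eqP; rewrite eq_le measure_ge0 andbT -QN.
by apply: le_measure; rewrite ?inE//; exact: measurableC.
Qed.

Lemma phi_scale_le (l l' y : R) : 0 <= l -> l <= l' -> phi (l * y) <= phi (l' * y).
Proof.
move=> l0 ll; rewrite -phiM_max0// -(phiM_max0 y (le_trans l0 ll)).
by apply: le_phi; apply: ler_wpM2r => //; exact: max0_ge0.
Qed.

Lemma scale_mean0 : G 0 = 0.
Proof.
rewrite /G (_ : (fun w => _) = fun=> 0) ?Ex_cst//.
by apply/funext => w; rewrite mul0r phi0.
Qed.

(** Equal means would force [phi (l' Y(1)) = phi (l Y(1))], hence [Y(1) = 0 = Y(0)], almost surely,
    against nondegeneracy at [t = 0]. *)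
Lemma scale_mean_lt l l' : 0 <= l -> l < l' -> G l < G l'.
Proof.
move=> l0 ll; have le01 w := phi_scale_le (Y 1 w) l0 (ltW ll).
rewrite lt_neqAle Ex_le ?andbT//; [|exact: bm_phi_Y..].
apply/negP => /eqP GG; apply: (@Y_not_ae 0) => //; first by rewrite eq_sym oner_neq0.
have bD : bounded_measurable (fun w => phi (l' * Y 1 w) - phi (l * Y 1 w)).
  by apply: bmD; [|apply: bmN]; exact: bm_phi_Y.
have E0 : Ex Q (fun w => phi (l' * Y 1 w) - phi (l * Y 1 w)) = 0.
  rewrite ExB; [|exact: bm_phi_Y..].
  by apply/eqP; rewrite subr_eq0; apply/eqP; exact: esym GG.
have ge0 w : 0 <= phi (l' * Y 1 w) - phi (l * Y 1 w) by rewrite subr_ge0.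
have Y01 := Y0_eq0 a_pinfty M_cvg.
have Y1ge := Y_ge0 a_pinfty M_cvg ler01.
have Z0 := Ex_eq0 bD ge0 E0.
apply: filterS3 Y01 Y1ge Z0 => w -> y0 /eqP; rewrite subr_eq0 => /eqP e.
apply/eqP; rewrite eq_le y0/= leNgt; apply/negP => y1.
have := @lt_phi _ (l * Y 1 w) (l' * Y 1 w); rewrite mulr_ge0// ltr_pM2r// => /(_ isT ll).
by rewrite e ltxx.
Qed.

Lemma scale_mean_inj l l' : 0 <= l -> 0 <= l' -> G l = G l' -> l = l'.
Proof.
move=> l0 l'0 e; have [ll|ll|//] := ltgtP l l'.
- by have := scale_mean_lt l0 ll; rewrite e ltxx.
- by have := scale_mean_lt l'0 ll; rewrite e ltxx.
Qed.

Lemma phi_mul1 (S : Type) (Z : S -> R) :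
  (fun w => phi (1 * Z w)) = (fun w => phi (Z w)).
Proof. by apply/funext => w; rewrite mul1r. Qed.

(** With [k] the integer part of [n t], that of [2 n t] is at most [2 k + 1]: two blocks of length
    [k] with equal means, and one negligible extra index. [phi] is subadditive on maxima. *)
Lemma Ex_phi_Y_doubling t : 0 <= t ->
  Ex Q (fun w => phi (1 * Y (2 * t) w)) <= 2 * Ex Q (fun w => phi (1 * Y t w)).
Proof.
move=> t0; have t20 : 0 <= 2 * t by rewrite mulr_ge0.
have c2 := A_cvg_phi t20 ler01.
have c1 : 2 * Ex P (fun w => phi (1 * A n t w)) +
    Ex P (fun w => phi (1 * ((a n)^-1 * block X 0 1 w))) @[n --> \oo] -->
    2 * Ex Q (fun w => phi (1 * Y t w)) + 0.
  apply: cvgD; last exact: Ex_phi_block_cvg0.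
  by apply: cvgM; [exact: cvg_cst|exact: A_cvg_phi].
rewrite addr0 in c1; apply: (ler_cvg_to c2 c1).
near=> n; have an : 0 < a n by near: n; exact: a_gt0.
have an' : 0 <= (a n)^-1 by rewrite invr_ge0 ltW.
set k := Num.truncn (n%:R * t).
pose B j i w := phi (1 * ((a n)^-1 * block X j i w)).
have bB j i : bounded_measurable (B j i) by exact: bm_phi_scale.
have BE j i : Ex P (B j i) = Ex P (B 0%N i).
  rewrite /B; under eq_fun do rewrite mulrA; rewrite Ex_phi_block//.
  by congr Ex; apply/funext => w; rewrite mulrA.
have kk : (Num.truncn (n%:R * (2 * t)) <= k + k + 1)%N.
  have nt : 0 <= n%:R * t by rewrite mulr_ge0.
  have /andP[_ k2] := truncn_itv nt.
  have -> : (Num.truncn (n%:R * (2 * t)) <= k + k + 1)%N =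
      (n%:R * (2 * t) < k%:R + k%:R + 1 + 1) by rewrite truncn_le_nat -[(k + k + 1).+1%:R]natr1 !natrD.
  by move: k2; rewrite -/k -natr1 => k2; lra.
rewrite (_ : 2 * _ + _ = Ex P (fun w => B 0%N k w + B k k w + B (k + k)%N 1%N w)).
  apply: Ex_le => [||w]; first exact: bm_phi_scale.
    by do 2 apply: bmD => //.
  rewrite /rescaled_max /B !mul1r.
  apply: (@le_trans _ _ (phi ((a n)^-1 * block X 0 (k + k + 1) w))).
    apply: le_phi; apply: ler_wpM2l => //; exact: running_max_le.
  have b0 j i : 0 <= (a n)^-1 * block X j i w by rewrite mulr_ge0// block_ge0.
  rewrite !block_cat !add0n maxr_pMr// maxr_pMr//.
  set x := _ * block X 0 k w; set y := _ * block X k k w; set z := _ * block X (k + k) 1 w.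
  have x0 : 0 <= x := b0 _ _; have y0 : 0 <= y := b0 _ _; have z0 : 0 <= z := b0 _ _.
  have xy0 : 0 <= Num.max x y by rewrite le_max x0.
  by have := phi_subadd xy0 z0; have := phi_subadd x0 y0; lra.
rewrite !ExD//; last exact: bmD.
by rewrite (BE k) (BE (k + k)%N) -/(B 0%N 1%N) mulr_natl mulr2n.
Unshelve. all: by end_near.
Qed.

Lemma Ex_phi_Y_homo s t : 0 <= s -> s <= t ->
  Ex Q (fun w => phi (Y s w)) <= Ex Q (fun w => phi (Y t w)).
Proof.
move=> s0 st; apply: Ex_le_ae.
- by have := bm_phi_Y Y 1 s; rewrite phi_mul1.
- by have := bm_phi_Y Y 1 t; rewrite phi_mul1.
- exact: (phi_Y_homo a_pinfty M_cvg).
Qed.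

(** If [Y(c)] vanished, doubling would make [Y(2^j c)] vanish for all [j], and by monotonicity
    [Y(1)] too. The choice of [j] gives [2^j >= j + 1 > 1/c]. *)
Lemma Ex_phi_Y_gt0 c : 0 < c -> 0 < Ex Q (fun w => phi (Y c w)).
Proof.
move=> c0; rewrite lt0r Ex_ge0 ?andbT; last by move=> w; exact: phi_ge0.
apply/negP => /eqP Ec.
have Ej j : Ex Q (fun w => phi (Y (2 ^+ j * c) w)) = 0.
  elim: j => [|j IHj]; first by rewrite mul1r.
  apply/le_anti/andP; split; last by apply: Ex_ge0 => w; exact: phi_ge0.
  have j0 : 0 <= 2 ^+ j * c by rewrite mulr_ge0 ?exprn_ge0// ltW.
  have := Ex_phi_Y_doubling j0.
  by rewrite !(phi_mul1 (Y _)) exprS -mulrA IHj mulr0.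
have G1 : 0 < G 1 by rewrite -scale_mean0 scale_mean_lt.
pose j := Num.truncn c^-1.
have c1 : 1 <= 2 ^+ j * c.
  rewrite -ler_pdivrMr// mul1r ltW// (lt_le_trans (truncnS_gt _))//.
  by rewrite -natrX ler_nat ltn_expl.
have := Ex_phi_Y_homo ler01 c1; rewrite Ej leNgt.
by move: G1; rewrite /G phi_mul1 => ->.
Qed.

End type_convergence.

(** * Convergence of the ratios [a_[cn] / a_n] and the resulting scaling law *)

Lemma Ex_phi_harmonic (R : realType) (d : measure_display) (T : measurableType d)
    (P : probability T R) (Z : T -> R) : measurable_fun setT Z ->
  Ex P (fun w => phi (k.+1%:R^-1 * Z w)) @[k --> \oo] --> (0 : R).
Proof.
move=> mZ; rewrite -(Ex_cst P 0); apply: (@Ex_cvg _ _ _ _ _ _ 1).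
- move=> k; apply: (measurableT_comp (@measurable_phi R)).
  by apply: measurable_funM; [exact: measurable_cst|].
- exact: measurable_cst.
- by move=> n w; rewrite ger0_norm ?phi_ge0// ltW// phi_lt1.
apply: aeW => w.
have h : k.+1%:R^-1 * Z w @[k --> \oo] --> 0 * Z w.
  by apply: cvgM; [exact: cvg_harmonic|exact: cvg_cst].
have := cvg_phi _ h; rewrite mul0r phi0; exact.
Qed.

Section self_similarity.
Context (R : realType) (d : measure_display) (T : measurableType d)
  (P : probability T R) (X : nat -> {RV P >-> R}) (a : nat -> R).
Context (d' : measure_display) (T' : measurableType d') (Q : probability T' R)
  (Y : R -> {RV Q >-> R}).
Hypothesis X_stationary : stationary X.
Hypothesis a_pinfty : a n @[n --> \oo] --> +oo.
Hypothesis Y_nondegenerate : forall t : R, 0 <= t -> t != 1 ->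
  (Q [set w | Y t w = Y 1%R w] < 1)%E.
Hypothesis M_cvg : fdd_cvg [set t : R | 0 <= t]
  P (fun n t w => (a n)^-1 * partial_max X (Num.truncn (n%:R * t)) w)
  Q (fun t w => Y t w).

Local Notation A := (rescaled_max X a).
Local Notation G := (scale_mean Y).

Section ratio.
Variable c : R.
Hypothesis c0 : 0 < c.

Local Notation N := (scaled_index c).

Definition ratio n := a (N n) / a n.

Let V n w := (a (N n))^-1 * block X 0 (Num.truncn (n%:R * (c * 1))) w.

Lemma aN_gt0 : \forall n \near \oo, 0 < a n /\ 0 < a (N n).
Proof.
near=> n; split; near: n; first exact: a_gt0.
exact: (scaled_index_cvg c0 (a_gt0 a_pinfty)).
Unshelve. all: by end_near.
Qed.

Lemma ratio_gt0 : \forall n \near \oo, 0 < ratio n.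
Proof. by apply: filterS aN_gt0 => n [? ?]; rewrite divr_gt0. Qed.

Let L := Ex Q (fun w => phi (Y c w)).

Let bV (l : R) n : bounded_measurable (fun w => phi (l * V n w)).
Proof. exact: bm_phi_scale. Qed.

Let cV l : 0 <= l -> Ex P (fun w => phi (l * V n w)) @[n --> \oo] --> G l.
Proof. by move=> l0; apply: (rescaled_cvg_phi X_stationary a_pinfty M_cvg). Qed.

Let cA l : 0 <= l -> Ex P (fun w => phi (l * (ratio n * V n w))) @[n --> \oo] -->
  Ex Q (fun w => phi (l * Y c w)).
Proof.
move=> l0; have := A_cvg_phi a_pinfty M_cvg (ltW c0) l0.
apply: cvg_trans; apply: near_eq_cvg.
apply: filterS aN_gt0 => n [an aNn]; congr Ex; apply/funext => w.
congr (phi (_ * _)); rewrite /V /rescaled_max /ratio mulr1.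
by field; rewrite !gt_eqF.
Qed.

Let cL : Ex P (fun w => phi (ratio n * V n w)) @[n --> \oo] --> L.
Proof.
have := cA ler01; rewrite (phi_mul1 (Y c)).
by under eq_fun do rewrite (phi_mul1 (fun w => ratio _ * V _ w)).
Qed.

(** The mean of [phi (l V_n)] tends to [G l] and that of [phi (ratio n V_n)] to [L]; as [ratio n] is
    deterministic, [ratio n <= l] would order the means the wrong way. *)
Lemma ratio_gt l : 0 <= l -> G l < L -> \forall n \near \oo, l < ratio n.
Proof.
move=> l0 GL; pose b := (G l + L) / 2.
have Gb : G l < b by rewrite /b; lra.
have bL : b < L by rewrite /b; lra.
near=> n; rewrite ltNge; apply/negP => rl.
have r0 : 0 < ratio n by near: n; exact: ratio_gt0.
have h1 : Ex P (fun w => phi (l * V n w)) < b by near: n; exact: (cvgr_lt _ (cV l0)).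
have h2 : b < Ex P (fun w => phi (ratio n * V n w)) by near: n; exact: (cvgr_gt _ cL).
have : Ex P (fun w => phi (ratio n * V n w)) <= Ex P (fun w => phi (l * V n w)).
  by apply: Ex_le => // w; apply: phi_scale_le => //; exact: ltW.
by lra.
Unshelve. all: by end_near.
Qed.

Lemma ratio_lt l : 0 <= l -> L < G l -> \forall n \near \oo, ratio n < l.
Proof.
move=> l0 GL; pose b := (G l + L) / 2.
have Gb : b < G l by rewrite /b; lra.
have bL : L < b by rewrite /b; lra.
near=> n; rewrite ltNge; apply/negP => rl.
have h1 : b < Ex P (fun w => phi (l * V n w)) by near: n; exact: (cvgr_gt _ (cV l0)).
have h2 : Ex P (fun w => phi (ratio n * V n w)) < b by near: n; exact: (cvgr_lt _ cL).
have : Ex P (fun w => phi (l * V n w)) <= Ex P (fun w => phi (ratio n * V n w)).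
  by apply: Ex_le => // w; exact: phi_scale_le.
by lra.
Unshelve. all: by end_near.
Qed.

Let G_lt l l' : 0 <= l -> l < l' -> G l < G l'.
Proof. exact: (scale_mean_lt a_pinfty Y_nondegenerate M_cvg). Qed.

(** Otherwise the ratios exceed every [k + 1] eventually, and
    [phi (V_n) <= phi (ratio n V_n / (k + 1))] yields [G 1 <= E phi (Y(c) / (k + 1))] in the limit;
    the right side tends to [0] with [k]. *)
Lemma ratio_bounded : exists2 l, 0 <= l & L < G l.
Proof.
apply: contrapT => H.
have GL l : 0 <= l -> G l <= L.
  by move=> l0; rewrite leNgt; apply/negP => LG; apply: H; exists l.
have rinf k : \forall n \near \oo, k.+1%:R < ratio n.
  have k0 : (0 : R) <= k.+1%:R by [].
  apply: ratio_gt => //; have := GL (k.+1%:R + 1) (addr_ge0 k0 ler01).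
  by apply: lt_le_trans; apply: G_lt => //; rewrite ltrDl.
have G1k k : G 1 <= Ex Q (fun w => phi (k.+1%:R^-1 * Y c w)).
  have k0 : (0 : R) < k.+1%:R by rewrite ltr0n.
  have ki : (0 : R) <= k.+1%:R^-1 by rewrite invr_ge0 ltW.
  apply: (ler_cvg_to (cV ler01) (cA ki)); near=> n.
  apply: Ex_le => [||w]; [exact: bV|by under eq_fun do rewrite mulrA; exact: bV|].
  rewrite [k.+1%:R^-1 * _]mulrA; apply: phi_scale_le => //.
  have : k.+1%:R < ratio n by near: n; exact: rinf.
  by move=> kr; rewrite mulrC ler_pdivlMr// mul1r ltW.
have : G 1 <= 0.
  have h := Ex_phi_harmonic Q (measurable_funPT (Y c)).
  by apply: (ler_cvg_to (cvg_cst (G 1)) h); exact: nearW.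
by rewrite leNgt -(scale_mean0 Y) G_lt.
Unshelve. all: by end_near.
Qed.

Lemma ratio_cvg : exists2 rho : R, 0 < rho & ratio n @[n --> \oo] --> rho.
Proof.
have L0 : 0 < L by exact: (Ex_phi_Y_gt0 X_stationary a_pinfty Y_nondegenerate M_cvg).
have [u u0 Lu] := ratio_bounded.
(* The limit is where [G] crosses the level [L]; taken as a supremum, it needs only the monotonicity
   of [G]. *)
pose S : set R := [set l | 0 <= l /\ G l < L].
have S0 : S 0 by split=> //; rewrite (scale_mean0 Y).
have Su : ubound S u.
  move=> l [l0 Gl]; rewrite leNgt; apply/negP => ul.
  by have := G_lt u0 ul; lra.
have hS : has_sup S by split; [exists 0|exists u].
(* [G] tends to [0] at the origin while [L > 0], so the supremum is positive. *)
have [k kS] : exists k, S (k.+1%:R^-1).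
  have h := Ex_phi_harmonic Q (measurable_funPT (Y 1)).
  have [k _ Hk] := cvgr_lt _ h _ L0; exists k; split; first by rewrite invr_ge0.
  exact: (Hk k (leqnn k)).
have rho0 : 0 < sup S.
  apply: (@lt_le_trans _ _ k.+1%:R^-1); first by rewrite invr_gt0 ltr0n.
  by apply: ub_le_sup => //; exists u.
exists (sup S) => //.
have low l : 0 <= l -> l < sup S -> G l < L.
  move=> l0 lS; have Sl : 0 < sup S - l by rewrite subr_gt0.
  have [l' [l'0 Gl']] := sup_adherent Sl hS; rewrite subKr => ll'.
  by apply: lt_trans Gl'; exact: G_lt.
have high l : sup S < l -> L < G l.
  (* The midpoint lies outside [S], so [G] is at least [L] there and, by strict monotonicity,
     greater than [L] at [l]. *)
  move=> Sl; have mid : sup S < (sup S + l) / 2 by lra.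
  have midl : (sup S + l) / 2 < l by lra.
  have m0 : 0 <= (sup S + l) / 2 by lra.
  apply: le_lt_trans (G_lt m0 midl); rewrite leNgt; apply/negP => Gm.
  have : (sup S + l) / 2 <= sup S by apply: ub_le_sup; [exists u|].
  by lra.
apply/cvgrPdist_le => e e0.
pose l1 := Num.max 0 (sup S - e).
have l10 : 0 <= l1 by exact: max0_ge0.
have l1S : l1 < sup S by rewrite /l1 gt_max rho0 ltrBlDr ltrDl.
have l2S : sup S < sup S + e by rewrite ltrDl.
have l20 : 0 <= sup S + e by lra.
near=> n.
have h1 : l1 < ratio n by near: n; apply: ratio_gt => //; exact: low.
have h2 : ratio n < sup S + e by near: n; apply: ratio_lt => //; exact: high.
have : sup S - e <= l1 by rewrite /l1 le_max lexx orbT.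
by rewrite ler_distl; move=> h3; apply/andP; split; lra.
Unshelve. all: by end_near.
Qed.

(** For large [n] the rescaled maximum at time [c t] equals [ratio n * W n t]. By [phi_scale],
    replacing [ratio n] by [rho] costs an amount uniform in [w] and [t]. *)
Lemma scaling_law (rho : R) (s : seq (R * R)) (m l : R) : 0 < rho ->
  ratio n @[n --> \oo] --> rho ->
  (forall p, p \in s -> 0 <= p.1) -> 0 <= m -> 0 < l ->
  Ex Q (fun w => ramp s m (fun t => phi (l * Y (c * t) w))) =
  Ex Q (fun w => ramp s m (fun t => phi (l * (rho * Y t w)))).
Proof.
move=> rho0 rc s0 m0 l0.
pose W n t w := (a (N n))^-1 * block X 0 (Num.truncn (n%:R * (c * t))) w.
have lr0 : 0 < l * rho by rewrite mulr_gt0.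
have c1 : Ex P (fun w => ramp s m (fun t => phi (l * rho * W n t w))) @[n --> \oo] -->
    Ex Q (fun w => ramp s m (fun t => phi (l * (rho * Y t w)))).
  have := rescaled_cvg X_stationary a_pinfty M_cvg c0 s0 m0 (ltW lr0).
  have -> : (fun w => ramp s m (fun t => phi (l * (rho * Y t w)))) =
      (fun w => ramp s m (fun t => phi (l * rho * Y t w))).
    by apply/funext => w; apply: eq_ramp => p _; rewrite mulrA.
  exact.
have c2 : Ex P (fun w => ramp s m (fun t => phi (l * (ratio n * W n t w)))) @[n --> \oo] -->
    Ex Q (fun w => ramp s m (fun t => phi (l * Y (c * t) w))).
  pose s' := [seq (c * p.1, p.2) | p <- s].
  have rs (u : R -> R) : ramp s' m u = ramp s m (fun t => u (c * t)).
    by rewrite /ramp big_map.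
  have s'0 p : p \in s' -> 0 <= p.1.
    by move=> /mapP[q qs ->] /=; rewrite mulr_ge0 ?s0// ltW.
  have h := A_cvg_ramp a_pinfty M_cvg s'0 m0 (ltW l0).
  rewrite (_ : (fun w => ramp s m (fun t => phi (l * Y (c * t) w))) =
      fun w => ramp s' m (fun t => phi (l * Y t w))); last first.
    by apply/funext => w; rewrite rs.
  apply: cvg_trans h; apply: near_eq_cvg.
  apply: filterS aN_gt0 => n [an aNn]; congr Ex; apply/funext => w.
  rewrite rs; apply: eq_ramp => p _; congr (phi (_ * _)).
  by rewrite /W /rescaled_max /ratio; field; rewrite !gt_eqF.
suff c3 : Ex P (fun w => ramp s m (fun t => phi (l * (ratio n * W n t w)))) @[n --> \oo]
    --> Ex Q (fun w => ramp s m (fun t => phi (l * (rho * Y t w)))).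
  exact: cvg_unique c2 c3.
apply: (@cvg_dist_trans _ _ _ _ _ _ (fun n => \sum_(p <- s) m *
  (`|ratio n - rho| * rho^-1)) _ c1).
  apply: cvg_sum0 => p _; apply: cvgM0.
  under eq_fun do rewrite mulrC; apply: cvgM0; apply/norm_cvg0P.
  by rewrite -(subrr rho); apply: cvgB => //; exact: cvg_cst.
near=> n.
have r0 : 0 < ratio n by near: n; exact: ratio_gt0.
apply: (@le_trans _ _ (\sum_(p <- s) m * Ex P (cst (`|ratio n - rho| * rho^-1)))).
  apply: (@Ex_ramp_dist _ _ _ _ _ _ _ _ _ (fun _ => cst (`|ratio n - rho| * rho^-1))).
  - by [].
  - move=> p _; under eq_fun do rewrite mulrA.
    by under eq_fun do rewrite mulrA; exact: block_scale_measurable.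
  - by move=> p _; exact: measurable_phi_scale.
  - by move=> _; exact: bm_cst.
  - move=> p w _; rewrite mulrA.
    apply: (le_trans (phi_scale _ lr0 (mulr_gt0 l0 r0))).
    rewrite -mulrBr normrM (gtr0_norm l0) -mulf_div divff ?gt_eqF// mul1r.
    by [].
by apply: ler_sum => p _; rewrite Ex_cst.
Unshelve. all: by end_near.
Qed.

End ratio.

End self_similarity.

Lemma powR_cvg (R : realType) (H t : R) : 0 < t ->
  s `^ H @[s --> t] --> t `^ H.
Proof.
move=> t0; have h : expR (H * ln s) @[s --> t] --> expR (H * ln t).
  have hl : H * ln s @[s --> t] --> H * ln t.
    by apply: cvgM; [exact: cvg_cst|exact: continuous_ln].
  exact: (continuous_cvg _ (@continuous_expR R _) hl).
rewrite [X in _ --> X]/powR gt_eqF//; apply: cvg_trans h; apply: near_eq_cvg.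
near=> s; rewrite /powR gt_eqF//; near: s; exact: lt_nbhsr.
Unshelve. all: by end_near.
Qed.

Lemma Ex_norm_ae0 (R : realType) (d : measure_display) (T : measurableType d)
    (P : probability T R) (f g : T -> R) :
  bounded_measurable f -> bounded_measurable g ->
  {ae P, forall w, f w <= g w} -> Ex P (fun w => g w - f w) = 0 ->
  {ae P, forall w, f w = g w}.
Proof.
move=> bf bg fg E0.
have bD : bounded_measurable (fun w => g w - f w) by apply: bmD => //; exact: bmN.
have bN := bm_norm bD.
have EN : Ex P (fun w => `|g w - f w|) = 0.
  rewrite -[RHS]E0; apply: Ex_ae => //.
  by apply: filterS fg => w fg; rewrite ger0_norm// subr_ge0.
apply: filterS (Ex_eq0 bN (fun w => normr_ge0 _) EN) => w /normr0_eq0/eqP.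
by rewrite subr_eq0 => /eqP.
Qed.

(** * Self-similarity and regular variation *)

Section consequences.
Context (R : realType) (d : measure_display) (T : measurableType d)
  (P : probability T R) (X : nat -> {RV P >-> R}) (a : nat -> R).
Context (d' : measure_display) (T' : measurableType d') (Q : probability T' R)
  (Y : R -> {RV Q >-> R}).
Hypothesis X_stationary : stationary X.
Hypothesis a_pinfty : a n @[n --> \oo] --> +oo.
Hypothesis Y_nondegenerate : forall t : R, 0 <= t -> t != 1 ->
  (Q [set w | Y t w = Y 1%R w] < 1)%E.
Hypothesis M_cvg : fdd_cvg [set t : R | 0 <= t]
  P (fun n t w => (a n)^-1 * partial_max X (Num.truncn (n%:R * t)) w)
  Q (fun t w => Y t w).

Local Notation G := (scale_mean Y).

Let G_inj l l' : 0 <= l -> 0 <= l' -> G l = G l' -> l = l'.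
Proof. exact: (scale_mean_inj a_pinfty Y_nondegenerate M_cvg). Qed.

Lemma Ex_scaling (c rho t l : R) : 0 < c -> 0 < rho ->
  ratio a c n @[n --> \oo] --> rho -> 0 <= t -> 0 < l ->
  Ex Q (fun w => phi (l * Y (c * t) w)) = Ex Q (fun w => phi (l * (rho * Y t w))).
Proof.
move=> c0 rho0 rc t0 l0.
rewrite (Ex_phi_ramp Q (i := t) (u := fun t w => l * Y (c * t) w)); last first.
  by apply: measurable_funM; [exact: measurable_cst|].
rewrite (Ex_phi_ramp Q (i := t) (u := fun t w => l * (rho * Y t w))); last first.
  apply: measurable_funM; first exact: measurable_cst.
  by apply: measurable_funM; [exact: measurable_cst|].
congr (1 - _); apply: (scaling_law X_stationary a_pinfty M_cvg c0 rho0 rc) => //.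
by move=> p; rewrite inE => /eqP ->.
Qed.

Lemma Ex_scaling1 (c rho : R) : 0 < c -> 0 < rho ->
  ratio a c n @[n --> \oo] --> rho -> Ex Q (fun w => phi (Y c w)) = G rho.
Proof.
move=> c0 rho0 rc; have := Ex_scaling c0 rho0 rc ler01 ltr01.
by rewrite (phi_mul1 (Y (c * 1))) (phi_mul1 (fun w => rho * Y 1 w)) mulr1.
Qed.

Lemma ratio_power : exists2 H : R, 0 < H &
  forall c, 0 < c -> ratio a c n @[n --> \oo] --> c `^ H.
Proof.
have /choice[r rP] : forall c : R, exists rho : R, 0 < c ->
    0 < rho /\ ratio a c n @[n --> \oo] --> rho.
  move=> c; have [c0|c0] := ltP 0 c; last by exists 0.
  have [rho rho0 rc] := ratio_cvg X_stationary a_pinfty Y_nondegenerate M_cvg c0.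
  by exists rho.
have r0 c : 0 < c -> 0 < r c by move=> /rP[].
have rc c : 0 < c -> ratio a c n @[n --> \oo] --> r c by move=> /rP[].
have EG c : 0 < c -> Ex Q (fun w => phi (Y c w)) = G (r c).
  by move=> c0; apply: Ex_scaling1 => //; [exact: r0|exact: rc].
(* Scaling by [c], then by [c'], gives [G (r (c c')) = G (r c * r c')], and [G] is injective. *)
have rM c c' : 0 < c -> 0 < c' -> r (c * c') = r c * r c'.
  move=> c0 c'0; have cc0 : 0 < c * c' by rewrite mulr_gt0.
  apply: G_inj; [exact/ltW/r0|by rewrite mulr_ge0// ltW// r0|].
  rewrite -EG//.
  have := Ex_scaling c0 (r0 _ c0) (@rc _ c0) (ltW c'0) ltr01.
  rewrite (phi_mul1 (Y (c * c'))) (phi_mul1 (fun w => r c * Y c' w)) => ->.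
  have := Ex_scaling c'0 (r0 _ c'0) (@rc _ c'0) ler01 (r0 _ c0).
  rewrite mulr1 => ->; congr Ex; apply/funext => w.
  by rewrite mulrA.
(* The sequence [a] need not be monotone; the order comes from the paths of [Y], through [G]. *)
have rm c c' : 0 < c -> c <= c' -> r c <= r c'.
  move=> c0 cc; have c'0 : 0 < c' := lt_le_trans c0 cc.
  rewrite leNgt; apply/negP => rr.
  have := scale_mean_lt a_pinfty Y_nondegenerate M_cvg (ltW (r0 _ c'0)) rr.
  by rewrite -!EG// ltNge (Ex_phi_Y_homo a_pinfty M_cvg (ltW c0) cc).
have r1 : r 1 = 1.
  have := rM 1 1 ltr01 ltr01; rewrite mulr1 => e.
  by apply: (@mulfI _ (r 1)); [rewrite gt_eqF// r0|rewrite -e mulr1].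
(* If [r 2 = 1], the almost surely ordered [phi (Y(1))] and [phi (Y(2))] have equal means, so
   [Y(2) = Y(1)] almost surely. *)
have r2 : 1 < r 2.
  have le12 : 1 <= 2 :> R by rewrite ler1n.
  have := rm _ _ ltr01 le12; rewrite r1 le_eqVlt => /predU1P[r2|//]; exfalso.
  have E12 : Ex Q (fun w => phi (Y 2 w) - phi (Y 1 w)) = 0.
    rewrite ExB; last 2 first.
    - by have := bm_phi_Y Y 1 2; rewrite phi_mul1.
    - by have := bm_phi_Y Y 1 1; rewrite phi_mul1.
    by rewrite !EG// -r2 r1 subrr.
  have b1 : bounded_measurable (fun w => phi (Y 1 w)).
    by have := bm_phi_Y Y 1 1; rewrite phi_mul1.
  have b2 : bounded_measurable (fun w => phi (Y 2 w)).
    by have := bm_phi_Y Y 1 2; rewrite phi_mul1.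
  have Z0 := Ex_norm_ae0 b1 b2 (phi_Y_homo a_pinfty M_cvg ler01 le12) E12.
  apply: (Y_not_ae Y_nondegenerate (t := 2)) => //; first by rewrite (eqr_nat _ 2 1).
  have Y2 : {ae Q, forall w, 0 <= Y 2 w} by exact: (Y_ge0 a_pinfty M_cvg).
  apply: filterS3 (Y_ge0 a_pinfty M_cvg ler01) Y2 Z0 => w y1 y2 e.
  by rewrite -(psiK y1) -(psiK y2) e.
have [H H0 rH] := multiplicative_monotone_power r0 rM rm r2.
by exists H => // c c0; rewrite -rH//; exact: rc.
Qed.

Variable H : R.
Hypothesis H0 : 0 < H.
Hypothesis ratioH : forall c, 0 < c -> ratio a c n @[n --> \oo] --> c `^ H.

Lemma Y_max0 t : 0 <= t -> {ae Q, forall w, Y t w = psi (phi (Y t w))}.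
Proof.
by move=> t0; apply: filterS (Y_ge0 a_pinfty M_cvg t0) => w y0; rewrite psiK.
Qed.

(** [scaling_law] gives the equality after [phi]; applying [psi] recovers the processes, up to null
    sets since [Y >= 0] holds only almost surely at each time. *)
Lemma Y_self_similar : self_similar H Y.
Proof.
move=> c c0.
have cH : 0 < c `^ H by exact: powR_gt0.
pose U1 t w := phi (Y (c * t) w); pose U2 t w := phi (c `^ H * Y t w).
have mU1 t : measurable_fun setT (U1 t).
  exact: (measurableT_comp (@measurable_phi R)).
have mcY t : measurable_fun setT (fun w => c `^ H * Y t w).
  by apply: measurable_funM; [exact: measurable_cst|].
have mU2 t : measurable_fun setT (U2 t).
  exact: (measurableT_comp (@measurable_phi R)).
have U12 : fdd_eq [set t | 0 <= t] Q U1 Q U2.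
  apply: tests_fdd_eq => // s s0 m m0.
  have := scaling_law X_stationary a_pinfty M_cvg c0 cH (@ratioH _ c0) s0 m0 ltr01.
  rewrite (_ : (fun w => ramp s m (fun t => phi (1 * Y (c * t) w))) =
    fun w => ramp s m (U1^~ w)); last first.
    by apply/funext => w; apply: eq_ramp => p _; rewrite mul1r.
  rewrite (_ : (fun w => ramp s m (fun t => phi (1 * (c `^ H * Y t w)))) =
    fun w => ramp s m (U2^~ w))//.
  by apply/funext => w; apply: eq_ramp => p _; rewrite mul1r.
have mpsi (S : measurableType d') (V : S -> R) :
    measurable_fun setT V -> measurable_fun setT (fun w => psi (V w)).
  exact: (measurableT_comp (@measurable_psi R)).
apply: (@fdd_eq_trans _ _ _ _ _ _ _ _ _ _ (fun t w => psi (U1 t w))).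
  apply: ae_fdd_eq => [t _|t _|t t0] //; first exact: mpsi.
  by apply: Y_max0; rewrite mulr_ge0// ltW.
apply: (fdd_eq_trans (fdd_eq_map (@measurable_psi R) U12)).
apply: ae_fdd_eq => [t _|t _|t t0] //; first exact: mpsi.
apply: filterS (Y_ge0 a_pinfty M_cvg t0) => w y0.
by rewrite psiK// mulr_ge0// ltW.
Qed.

Lemma Y_regularly_varying : regularly_varying H a.
Proof. by split; [exact: a_gt0|move=> c c0; exact: ratioH]. Qed.

Lemma Ex_phi_Y_G t : 0 < t -> Ex Q (fun w => phi (Y t w)) = G (t `^ H).
Proof. by move=> t0; apply: Ex_scaling1 => //; [exact: powR_gt0|exact: ratioH]. Qed.

Lemma Ex_phi_Y_cvg (t : R) : 0 <= t -> Ex Q (fun w => phi (Y s w))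
  @[s --> within [set s | 0 <= s] (nbhs t)] --> Ex Q (fun w => phi (Y t w)).
Proof.
rewrite le_eqVlt => /predU1P[<-|t0].
  have -> : Ex Q (fun w => phi (Y 0 w)) = 0.
    transitivity (Ex Q (fun=> 0)); last exact: Ex_cst.
    apply: Ex_ae; [|exact: bm_cst|].
      by have := bm_phi_Y Y 1 0; rewrite phi_mul1.
    by apply: filterS (Y0_eq0 a_pinfty M_cvg) => w ->; rewrite phi0.
  apply/cvgrPdist_lt => e e0.
  have [k _ Hk] := cvgr_lt _ (Ex_phi_harmonic Q (measurable_funPT (Y 1))) _ e0.
  have {}Hk : G (k.+1%:R^-1) < e := Hk k (leqnn k).
  pose x : R := k.+1%:R^-1.
  have x0 : 0 < x by rewrite invr_gt0 ltr0n.
  (* For [s < x^(1/H)] monotonicity bounds the mean of [phi (Y(s))] by that at time [x^(1/H)], which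
     is [G x < e]. *)
  have d0 : 0 < x `^ H^-1 by exact: powR_gt0.
  apply: filterS (lt_nbhsl d0) => s sx s0 /=.
  rewrite sub0r normrN ger0_norm; last by apply: Ex_ge0 => w; exact: phi_ge0.
  apply: le_lt_trans Hk.
  apply: (le_trans (Ex_phi_Y_homo a_pinfty M_cvg s0 (ltW sx))).
  by rewrite Ex_phi_Y_G// -powRrM mulVf ?gt_eqF// powRr1// ltW.
rewrite Ex_phi_Y_G//.
apply: cvg_within_filter.
have tH : 0 < t `^ H by exact: powR_gt0.
apply: (@cvg_dist_trans _ _ _ _ (fun=> G (t `^ H)) _
  (fun s => (t `^ H)^-1 * `|s `^ H - t `^ H|)); first exact: cvg_cst.
  apply: cvgM0; apply/norm_cvg0P; rewrite -(subrr (t `^ H)).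
  by apply: cvgB; [exact: powR_cvg|exact: cvg_cst].
near=> s.
have s0 : 0 < s by near: s; exact: lt_nbhsr.
have sH : 0 < s `^ H by exact: powR_gt0.
rewrite Ex_phi_Y_G// /scale_mean -ExB; [|exact: bm_phi_Y..].
have bD : bounded_measurable (fun w => phi (s `^ H * Y 1 w) - phi (t `^ H * Y 1 w)).
  by apply: bmD; [|apply: bmN]; exact: bm_phi_Y.
apply: (le_trans (Ex_norm_le Q bD)); rewrite mulrC -[leRHS](Ex_cst Q).
apply: Ex_le; [exact: bm_norm|exact: bm_cst|move=> w].
exact: phi_scale.
Unshelve. all: by end_near.
Qed.

End consequences.

(** * Continuity in probability *)

(** [phi] flattens at infinity, so one point has to stay below [K]; the constant is
    [phi (K + e) - phi K]. *)
Lemma phi_gap (R : realType) (K e x y : R) : 0 <= x -> x <= K -> 0 <= y -> 0 < e ->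
  e <= `|y - x| -> e / ((1 + K) * (1 + K + e)) <= `|phi y - phi x|.
Proof.
move=> x0 xK y0 e0 exy.
have K0 : 0 <= K := le_trans x0 xK.
have gap z z' : 0 <= z -> z <= K -> z' = z + e ->
    e / ((1 + K) * (1 + K + e)) <= phi z' - phi z.
  move=> z0 zK ->; rewrite phiB//; last by lra.
  rewrite [z + e - z]addrAC subrr add0r; apply: ler_wpM2l; first exact: ltW.
  by rewrite lef_pV2 ?posrE ?mulr_gt0//; [apply: ler_pM; lra|lra..].
have [xy|yx] := leP x y.
  have xe : x + e <= y by move: exy; rewrite ger0_norm ?subr_ge0//; lra.
  have := gap x (x + e) x0 xK erefl; have := le_phi xe => h1 h2.
  by apply: le_trans (ler_norm _); lra.
have ye : y <= x - e by move: exy; rewrite ltr0_norm ?subr_lt0//; lra.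
have := gap (x - e) x; have := le_phi ye => h1 h2.
rewrite distrC; apply: le_trans (ler_norm _).
by have := h2 ltac:(lra) ltac:(lra) ltac:(lra); lra.
Qed.

Section continuity.
Context (R : realType) (d : measure_display) (T : measurableType d)
  (P : probability T R) (X : nat -> {RV P >-> R}) (a : nat -> R).
Context (d' : measure_display) (T' : measurableType d') (Q : probability T' R)
  (Y : R -> {RV Q >-> R}).
Hypothesis X_stationary : stationary X.
Hypothesis a_pinfty : a n @[n --> \oo] --> +oo.
Hypothesis M_cvg : fdd_cvg [set t : R | 0 <= t]
  P (fun n t w => (a n)^-1 * partial_max X (Num.truncn (n%:R * t)) w)
  Q (fun t w => Y t w).
Variable H : R.
Hypothesis H0 : 0 < H.
Hypothesis ratioH : forall c, 0 < c -> ratio a c n @[n --> \oo] --> c `^ H.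

Let bY t : bounded_measurable (fun w => phi (Y t w)).
Proof. by have := bm_phi_Y Y 1 t; rewrite phi_mul1. Qed.

Lemma bm_phi_dist s t : bounded_measurable (fun w => `|phi (Y s w) - phi (Y t w)|).
Proof. by apply: bm_norm; apply: bmD => //; exact: bmN. Qed.

(* By monotonicity the [L^1] distance is a difference of expectations. *)
Lemma Ex_phi_dist s t : 0 <= s -> 0 <= t ->
  Ex Q (fun w => `|phi (Y s w) - phi (Y t w)|) =
  `|Ex Q (fun w => phi (Y s w)) - Ex Q (fun w => phi (Y t w))|.
Proof.
wlog st : s t / s <= t.
  move=> wl s0 t0; have [st|ts] := leP s t; first exact: wl.
  rewrite distrC -wl// ?ltW//; congr Ex; apply/funext => w; exact: distrC.
move=> s0 t0; rewrite distrC -ExB// ger0_norm; last first.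
  rewrite -[leLHS](Ex_cst Q); apply: Ex_le_ae; [exact: bm_cst| |].
    by apply: bmD => //; exact: bmN.
  by apply: filterS (phi_Y_homo a_pinfty M_cvg s0 st) => w; rewrite subr_ge0.
apply: Ex_ae; [exact: bm_phi_dist|by apply: bmD => //; exact: bmN|].
apply: filterS (phi_Y_homo a_pinfty M_cvg s0 st) => w h.
by rewrite distrC ger0_norm// subr_ge0.
Qed.

Lemma Y_continuous_in_probability : continuous_in_probability Y.
Proof.
move=> t t0 e e0.
pose S s := [set w | e <= `|Y s w - Y t w|].
have mS s : measurable (S s).
  rewrite /S -[X in measurable X]setTI; apply: measurable_fun_ler => //.
    by apply: measurableT_comp => //; exact: measurable_funB.
have bS s : bounded_measurable (\1_(S s) : T' -> R) by exact: bm_indic.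
have SE s : Q (S s) = (Ex Q (\1_(S s)))%:E by rewrite Ex_indic.
suff h : Ex Q (\1_(S s)) @[s --> within [set s | 0 <= s] (nbhs t)] --> (0 : R).
  by rewrite -/(0%:E); under eq_fun do rewrite SE; apply: cvg_EFin => //; exact: nearW.
apply/cvgrPdist_le => x x0.
have x2 : 0 < x / 2 by rewrite divr_gt0.
(* For [k] large this event is unlikely; off it [phi_gap] bounds the [phi]-distance below by [g],
   and Markov's inequality concludes. *)
pose B (k : nat) := [set w | k%:R < Y t w].
have mB k : measurable (B k) by exact: measurable_lt_set.
have bB k : bounded_measurable (\1_(B k) : T' -> R) by exact: bm_indic.
have cB : Ex Q (\1_(B k)) @[k --> \oo] --> (0 : R).
  rewrite -(Ex_cst Q 0); apply: (@Ex_cvg _ _ _ _ _ _ 1).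
  - by move=> k; exact: measurable_indic.
  - exact: measurable_cst.
  - by move=> k w; rewrite indicE; case: (_ \in _); rewrite /= ?normr1 ?normr0.
  apply: aeW => w; apply: cvg_near_cst; near=> k.
  rewrite indicE memNset// /B /= => kY.
  have : Y t w <= k%:R by near: k; exact: nbhs_infty_ger.
  by rewrite leNgt kY.
have [k _ /(_ k (leqnn k)) /= Bk] := cvgr_le _ cB _ x2.
pose K : R := k%:R; pose g := e / ((1 + K) * (1 + K + e)).
have K0 : 0 <= K by [].
have g0 : 0 < g by rewrite /g divr_gt0// mulr_gt0//; lra.
have c := Ex_phi_Y_cvg X_stationary a_pinfty M_cvg H0 ratioH t0.
have gx : 0 < g * (x / 2) by rewrite mulr_gt0.
have /cvgrPdist_le/(_ _ gx) hc := c.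
have s0 : \forall s \near within [set s | 0 <= s] (nbhs t), 0 <= s.
  exact: withinT.
apply: filterS2 hc s0 => s hs s0; rewrite sub0r normrN.
rewrite ger0_norm; last by apply: Ex_ge0 => w; rewrite indicE.
have bD := bm_phi_dist s t.
apply: (@le_trans _ _ (Ex Q (fun w => \1_(B k) w +
    g^-1 * `|phi (Y s w) - phi (Y t w)|))).
  apply: Ex_le_ae => //; first by apply: bmD => //; apply: bmM => //; exact: bm_cst.
  apply: filterS2 (Y_ge0 a_pinfty M_cvg s0) (Y_ge0 a_pinfty M_cvg t0) => w ys yt.
  rewrite !indicE; have [wS|_] := boolP (w \in S s); last first.
    by rewrite addr_ge0// mulr_ge0// invr_ge0 ltW.
  have [wB|wB] := boolP (w \in B k).
    by rewrite lerDl mulr_ge0// invr_ge0 ltW.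
  rewrite add0r mulrC ler_pdivlMr// mul1r.
  apply: phi_gap => //; last by move: wS; rewrite inE.
  by move: wB; rewrite notin_setE /B /= => /negP; rewrite -leNgt.
rewrite ExD//; last by apply: bmM => //; exact: bm_cst.
rewrite ExZ// Ex_phi_dist// distrC.
have : g^-1 * `|Ex Q (fun w => phi (Y t w)) - Ex Q (fun w => phi (Y s w))| <= x / 2.
  by rewrite mulrC ler_pdivrMr// [_ * g]mulrC.
by move=> h; lra.
Unshelve. all: by end_near.
Qed.

End continuity.

Lemma ramp_map (R : realType) (I J : choiceType) (f : J -> I) (s : seq (J * R))
    (m : R) (u : I -> R) :
  ramp [seq (f p.1, p.2) | p <- s] m u = ramp s m (fun j => u (f j)).
Proof. by rewrite /ramp big_map. Qed.

Section fdd_eq_marginals.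
Context (R : realType) (I : choiceType) (D : set I).
Context (d1 : measure_display) (T1 : measurableType d1) (P1 : probability T1 R).
Context (d2 : measure_display) (T2 : measurableType d2) (P2 : probability T2 R).
Variables (U1 : I -> T1 -> R) (U2 : I -> T2 -> R).
Hypothesis U12 : fdd_eq D P1 U1 P2 U2.

Lemma fdd_eq_marginal i (B : set R) : D i -> measurable B ->
  P1 (U1 i @^-1` B) = P2 (U2 i @^-1` B).
Proof.
move=> Di mB; have h := @U12 1 (fun=> i) (fun=> Di) ((fun y => tnth y ord0) @^-1` B).
have E S (u : I -> S -> R) :
    [set w | ((fun y : 1.-tuple R => tnth y ord0) @^-1` B) [tuple u i w | _ < 1]] =
    u i @^-1` B.
  by apply/seteqP; split=> w; rewrite /preimage /= tnth_mktuple.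
rewrite -(E _ U1) -(E _ U2); apply: h.
by rewrite -[X in measurable X]setTI; exact: measurable_tnth.
Qed.

Hypothesis mU1 : forall i, D i -> measurable_fun setT (U1 i).
Hypothesis mU2 : forall i, D i -> measurable_fun setT (U2 i).

Lemma fdd_eq_ae_le i j : D i -> D j ->
  {ae P2, forall w, U2 i w <= U2 j w} -> {ae P1, forall w, U1 i w <= U1 j w}.
Proof.
move=> Di Dj ae2.
pose t (k : 'I_2) := if k == ord0 then i else j.
pose g (y : 2.-tuple R) := clamp (tnth y ord0 - tnth y ord_max).
have mg : measurable_fun setT g.
  apply: (measurableT_comp (@measurable_clamp R)).
  by apply: measurable_funB; exact: measurable_tnth.
pose f (S : Type) (u : I -> S -> R) w := clamp (u i w - u j w).
have gE d (S : measurableType d) (u : I -> S -> R) :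
    (fun w => g (joint u t w)) = f S u.
  by apply/funext => w; rewrite /g !tnth_mktuple.
have bf d (T : measurableType d) (u : I -> T -> R) :
    (forall k, D k -> measurable_fun setT (u k)) -> bounded_measurable (f T u).
  move=> mu; apply: bm01 => [|w]; last exact: clamp01.
  apply: (measurableT_comp (@measurable_clamp R)).
  by apply: measurable_funB; exact: mu.
have E0 : Ex P2 (f _ U2) = 0.
  transitivity (Ex P2 (fun=> 0)); last exact: Ex_cst.
  apply: Ex_ae; [exact: bf|exact: bm_cst|].
  by apply: filterS ae2 => w h; rewrite /f clamp_le0// subr_le0.
have E1 : Ex P1 (f _ U1) = 0.
  rewrite -E0 -!gE; apply: (fdd_eq_Ex mU1 mU2 U12) => // [k|y].
    by rewrite /t; case: ifP.
  exact: clamp01.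
apply: filterS (Ex_eq0 (bf _ _ U1 mU1) (fun w => clamp_ge0 _) E1) => w.
by move=> /clamp_eq0; rewrite subr_le0.
Qed.

End fdd_eq_marginals.

(** * Stationary max-increments *)

Section dyadic.
Context (R : realType).

(** The successor puts the point of index [(truncn (2^k t), k)] strictly above [t], so that
    [dyadic_above] approaches [t] from the right. *)
Definition dyadic (q : nat * nat) : R := q.1.+1%:R / 2 ^+ q.2.

Definition dyadic_above (t : R) (k : nat) : nat * nat :=
  (Num.truncn (2 ^+ k * t), k).

Lemma dyadic_ge0 q : 0 <= dyadic q.
Proof. by rewrite /dyadic divr_ge0// exprn_ge0. Qed.

Let pow2_gt0 k : 0 < 2 ^+ k :> R. Proof. by rewrite exprn_gt0. Qed.

Lemma dyadic_above_noninc t k : 0 <= t ->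
  dyadic (dyadic_above t k.+1) <= dyadic (dyadic_above t k).
Proof.
move=> t0; rewrite /dyadic /dyadic_above /=.
set x := 2 ^+ k * t; have x0 : 0 <= x by rewrite mulr_ge0// ltW.
rewrite (_ : 2 ^+ k.+1 * t = 2 * x); last by rewrite exprS mulrA.
rewrite (_ : (Num.truncn x).+1%:R / 2 ^+ k =
    (2 * (Num.truncn x).+1)%:R / 2 ^+ k.+1); last first.
  by rewrite natrM exprS; field; rewrite gt_eqF.
apply: ler_wpM2r; first by rewrite invr_ge0 ltW.
rewrite ler_nat (_ : (2 * _)%N = (2 * Num.truncn x).+1.+1); last by lia.
rewrite ltnS truncn_le_nat.
have /andP[_] := truncn_itv x0.
rewrite (_ : (2 * Num.truncn x).+2 = 2 * (Num.truncn x).+1)%N; last by lia.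
by rewrite natrM ltr_pM2l.
Qed.

Lemma dyadic_above_cvg t : 0 <= t ->
  dyadic (dyadic_above t k) @[k --> \oo] --> t.
Proof.
move=> t0; apply: (@cvg_dist_trans _ _ _ _ (fun=> t) _ (fun k => (2 ^+ k)^-1)).
- exact: cvg_cst.
- have h : (2^-1 : R) ^+ k @[k --> \oo] --> (0 : R).
    by apply: cvg_expr; rewrite ger0_norm ?invr_ge0// invf_lt1 ?ltr1n.
  by under eq_fun do rewrite -exprVn.
apply: nearW => k; rewrite /dyadic /=.
have kt : 0 <= 2 ^+ k * t by rewrite mulr_ge0// ltW.
have /andP[h1 h2] := truncn_itv kt.
rewrite (_ : _ - t = ((Num.truncn (2 ^+ k * t)).+1%:R - 2 ^+ k * t) / 2 ^+ k);
  last by field; rewrite gt_eqF.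
rewrite normrM [`|_^-1|]gtr0_norm ?invr_gt0// ler_pdivrMr// mulVf ?gt_eqF//.
by rewrite -natr1 in h2 *; rewrite ler_norml; apply/andP; split; lra.
Qed.

End dyadic.

Section right_limits.
Context (R : realType) (d : measure_display) (T : measurableType d)
  (P : probability T R) (X : nat -> {RV P >-> R}) (a : nat -> R).
Context (d' : measure_display) (T' : measurableType d') (Q : probability T' R)
  (Y : R -> {RV Q >-> R}).
Hypothesis X_stationary : stationary X.
Hypothesis a_pinfty : a n @[n --> \oo] --> +oo.
Hypothesis M_cvg : fdd_cvg [set t : R | 0 <= t]
  P (fun n t w => (a n)^-1 * partial_max X (Num.truncn (n%:R * t)) w)
  Q (fun t w => Y t w).
Variable H : R.
Hypothesis H0 : 0 < H.
Hypothesis ratioH : forall c, 0 < c -> ratio a c n @[n --> \oo] --> c `^ H.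

Lemma ramp_Y_cvg (s : seq (R * R)) (m : R) (u : nat -> R -> R) (v : R -> R) :
  0 <= m -> (forall p k, p \in s -> 0 <= u k p.1) ->
  (forall p, p \in s -> 0 <= v p.1) ->
  (forall p, p \in s -> u k p.1 @[k --> \oo] --> v p.1) ->
  Ex Q (fun w => ramp s m (fun t => phi (Y (u k t) w))) @[k --> \oo] -->
  Ex Q (fun w => ramp s m (fun t => phi (Y (v t) w))).
Proof.
move=> m0 u0 v0 uv.
apply: (@cvg_dist_trans _ _ _ _ (fun=> _) _ (fun k => \sum_(p <- s) m *
  `|Ex Q (fun w => phi (Y (u k p.1) w)) - Ex Q (fun w => phi (Y (v p.1) w))|)).
- exact: cvg_cst.
- apply: cvg_sum0 => p ps; apply: cvgM0.
  have c := Ex_phi_Y_cvg X_stationary a_pinfty M_cvg H0 ratioH (v0 p ps).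
  have uw : u k p.1 @[k --> \oo] --> within [set s | 0 <= s] (nbhs (v p.1)).
    move=> A hA; have hB := uv p ps _ hA.
    by apply: (@filterS nat \oo _ _ _ _ hB) => k uA; apply: uA; exact: u0.
  have h := cvg_comp _ _ uw c.
  apply/norm_cvg0P; rewrite -(subrr (Ex Q (fun w => phi (Y (v p.1) w)))).
  by apply: cvgB; [exact: h|exact: cvg_cst].
apply: nearW => k.
apply: (@le_trans _ _ (\sum_(p <- s) m *
    Ex Q (fun w => `|phi (Y (u k p.1) w) - phi (Y (v p.1) w)|))).
  apply: (@Ex_ramp_dist _ _ _ _ _ _ _ (fun t w => phi (Y (u k t) w))
    (fun t w => phi (Y (v t) w))
    (fun t w => `|phi (Y (u k t) w) - phi (Y (v t) w)|)) => //.
  - by move=> p _; exact: (measurableT_comp (@measurable_phi R)).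
  - by move=> p _; exact: (measurableT_comp (@measurable_phi R)).
  - by move=> t; exact: bm_phi_dist.
rewrite big_seq [leRHS]big_seq; apply: ler_sum => p ps.
by rewrite (Ex_phi_dist a_pinfty M_cvg)// ?u0// v0.
Qed.

End right_limits.

Section increment_limit.
Context (R : realType) (d : measure_display) (T : measurableType d)
  (P : probability T R) (X : nat -> {RV P >-> R}) (a : nat -> R).
Context (d' : measure_display) (T' : measurableType d') (Q : probability T' R)
  (Y : R -> {RV Q >-> R}).
Hypothesis X_stationary : stationary X.
Hypothesis a_pinfty : a n @[n --> \oo] --> +oo.
Hypothesis M_cvg : fdd_cvg [set t : R | 0 <= t]
  P (fun n t w => (a n)^-1 * partial_max X (Num.truncn (n%:R * t)) w)
  Q (fun t w => Y t w).
Variable r : R.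
Hypothesis r0 : 0 <= r.

(* [None] stands for the maximum up to time [n r], and [Some q] for the maximum
   over the [n q] following times. *)
Definition block_pair n (i : option (nat * nat)) w : R :=
  if i is Some q
  then phi ((a n)^-1 * block X (Num.truncn (n%:R * r))
              (Num.truncn (n%:R * dyadic R q)) w)
  else phi ((a n)^-1 * block X 0 (Num.truncn (n%:R * r)) w).

Lemma measurable_block_pair n i : measurable_fun setT (block_pair n i).
Proof. by case: i => [q|]; exact: block_scale_measurable. Qed.

Lemma block_pair01 n i w : 0 <= block_pair n i w < 1.
Proof. by case: i => [q|]; rewrite /= phi_ge0 phi_lt1. Qed.

Lemma A_cvg_ramp1 (I : choiceType) (t : I -> R) (s : seq (I * R)) (m : R) :
  (forall i, 0 <= t i) -> 0 <= m ->
  Ex P (fun w => ramp s m (fun i => phi (rescaled_max X a n (t i) w)))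
    @[n --> \oo] --> Ex Q (fun w => ramp s m (fun i => phi (Y (t i) w))).
Proof.
move=> t0 m0.
have s0 p : p \in [seq (t p.1, p.2) | p <- s] -> 0 <= p.1.
  by move=> /mapP[q _ ->] /=.
have h := A_cvg_ramp a_pinfty M_cvg s0 m0 ler01.
have E (S : Type) (u : R -> S -> R) :
    (fun w => ramp [seq (t p.1, p.2) | p <- s] m (fun t => phi (1 * u t w))) =
    (fun w => ramp s m (fun i => phi (u (t i) w))).
  apply/funext => w; rewrite (ramp_map t s m (fun t => phi (1 * u t w))).
  by apply: eq_ramp => p _; rewrite mul1r.
rewrite -(E _ (fun t => Y t)); apply: cvg_trans h; apply: near_eq_cvg.
by apply: nearW => n; rewrite -(E _ (rescaled_max X a n)).
Qed.

Lemma block_pair_cvg (s : seq ((nat * nat) * R)) (m : R) : 0 <= m ->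
  Ex P (fun w => ramp s m (fun q => block_pair n (Some q) w)) @[n --> \oo] -->
  Ex Q (fun w => ramp s m (fun q => phi (Y (dyadic R q) w))).
Proof.
move=> m0; have h := @A_cvg_ramp1 _ _ s m (@dyadic_ge0 R) m0.
apply: cvg_trans h; apply: near_eq_cvg; apply: nearW => n.
apply/esym; exact: (block_stationary X_stationary s _
  (fun q => Num.truncn (n%:R * dyadic R q)) _ m0).
Qed.

(** Together the two blocks miss at most one of the first [[n (r + q)]] indices, and one extra index
    is negligible. *)
Lemma block_pair_max_cvg (s : seq ((nat * nat) * R)) (m : R) : 0 <= m ->
  Ex P (fun w => ramp s m (fun q =>
    Num.max (block_pair n None w) (block_pair n (Some q) w))) @[n --> \oo] -->
  Ex Q (fun w => ramp s m (fun q => phi (Y (r + dyadic R q) w))).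
Proof.
move=> m0.
have t0 q : 0 <= r + dyadic R q by rewrite addr_ge0// dyadic_ge0.
have h := @A_cvg_ramp1 _ _ s m t0 m0.
have e0 := Ex_phi_block_cvg0 X a_pinfty 1 ler01.
apply: (@cvg_dist_trans _ _ _ _ _ _ (fun n => \sum_(p <- s) m *
    Ex P (fun w => phi (1 * ((a n)^-1 * block X 0 1 w)))) _ h).
  by apply: cvg_sum0 => p _; apply: cvgM0; exact: e0.
near=> n; have an : 0 < a n by near: n; exact: a_gt0.
have an0 : 0 <= (a n)^-1 by rewrite invr_ge0 ltW.
pose j := Num.truncn (n%:R * r).
pose k q := (j + Num.truncn (n%:R * dyadic R q))%N.
pose k' q := Num.truncn (n%:R * (r + dyadic R q)).
have kk q : (k q <= k' q <= k q + 1)%N.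
  have nr : 0 <= n%:R * r by rewrite mulr_ge0.
  have nq : 0 <= n%:R * dyadic R q by rewrite mulr_ge0 ?dyadic_ge0.
  have /andP[j1 j2] := truncn_itv nr; have /andP[q1 q2] := truncn_itv nq.
  rewrite /k /k' mulrDr; apply/andP; split.
    rewrite truncn_ge_nat; last exact: addr_ge0.
    by rewrite natrD lerD.
  rewrite truncn_le_nat; apply: (lt_le_trans (ltrD j2 q2)).
  by rewrite -natrD ler_nat /j; lia.
pose b q w := phi (1 * ((a n)^-1 * block X 0 (k q) w)).
pose b' q w := phi (1 * ((a n)^-1 * block X 0 (k' q) w)).
have -> : (fun w => ramp s m (fun q =>
    Num.max (block_pair n None w) (block_pair n (Some q) w))) =
    fun w => ramp s m (b^~ w).
  apply/funext => w; apply: eq_ramp => p _.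
  rewrite /b /k /= -phi_max mul1r block_cat add0n maxr_pMr//.
have -> : (fun w => ramp s m (fun q => phi (rescaled_max X a n (r + dyadic R q) w))) =
    fun w => ramp s m (b'^~ w).
  by apply/funext => w; apply: eq_ramp => p _; rewrite /b' mul1r.
pose W q w := phi (1 * ((a n)^-1 * block X (k q) (k' q - k q) w)).
apply: (@le_trans _ _ (\sum_(p <- s) m * Ex P (W p.1))).
  rewrite distrC; apply: (@Ex_ramp_dist _ _ _ _ _ _ _ b' b W) => //.
  - by move=> p _; exact: measurable_phi_scale.
  - by move=> p _; exact: measurable_phi_scale.
  - by move=> q; exact: bm_phi_scale.
  - move=> p w _; have /andP[k1 _] := kk p.1.
    rewrite /b' /b /W -(subnKC k1) block_cat add0n maxr_pMr// maxr_pMr// subnKC//.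
    by apply: phi_dist_max; rewrite !mulr_ge0// block_ge0.
apply: ler_sum => p _; apply: ler_wpM2l => //; have /andP[k1 k2] := kk p.1.
have E i l : (fun w => phi (1 * ((a n)^-1 * block X i l w))) =
  fun w => phi ((a n)^-1 * block X i l w).
  by apply/funext => w; rewrite mul1r.
rewrite /W E Ex_phi_block// -E; apply: Ex_le => [||w]; [exact: bm_phi_scale..|].
apply: le_phi; do 2 apply: ler_wpM2l => //.
by apply: running_max_le; rewrite leq_subLR.
Unshelve. all: by end_near.
Qed.

Lemma increment_limit : exists h : nat -> T * R -> seq bool,
  [/\ bit_process h,
    forall (s : seq (unit * R)) (m : R), 0 <= m ->
      Ex (enlarge P) (fun x => ramp s m (fun=> decode h (None : option (nat * nat)) x)) =
      Ex Q (fun w => ramp s m (fun=> phi (Y r w))),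
    forall (s : seq ((nat * nat) * R)) (m : R), 0 <= m ->
      Ex (enlarge P) (fun x => ramp s m (fun q => decode h (Some q) x)) =
      Ex Q (fun w => ramp s m (fun q => phi (Y (dyadic R q) w))) &
    forall (s : seq ((nat * nat) * R)) (m : R), 0 <= m ->
      Ex (enlarge P) (fun x => ramp s m (fun q =>
        Num.max (decode h (None : option (nat * nat)) x) (decode h (Some q) x))) =
      Ex Q (fun w => ramp s m (fun q => phi (Y (r + dyadic R q) w)))].
Proof.
have [F [FU ooF]] := @ultraFilterLemma nat \oo _.
(* [F] refines [\oo], so the three limits known along the integers identify the corresponding laws
   of the joint limit. *)
have toF (f : nat -> R) (l : R) : f n @[n --> \oo] --> l -> f n @[n --> F] --> l.
  by move=> fl A /fl; exact: ooF.
have [h [hP hE]] := limit_law P measurable_block_pair block_pair01 FU.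
exists h; split => //.
- move=> s m m0.
  have c := hE [seq (None, p.2) | p <- s] m m0.
  have h1 := toF _ _ (@A_cvg_ramp1 _ (fun=> r) s m (fun=> r0) m0).
  have E (S : Type) (u : option (nat * nat) -> S -> R) :
      (fun w => ramp [seq (None, p.2) | p <- s] m (u^~ w)) =
      fun w => ramp s m (fun=> u None w).
    by apply/funext => w; rewrite (ramp_map (fun=> None) s m (u^~ w)).
  have e : (fun n => Ex P (fun w => ramp [seq (None, p.2) | p <- s] m (block_pair n ^~ w))) =
      fun n => Ex P (fun w => ramp s m (fun=> phi (rescaled_max X a n r w))).
    by apply/funext => n; rewrite (E _ (block_pair n)).
  rewrite e in c; rewrite -(E _ (fun i x => decode h i x)); exact: cvg_unique c h1.
- move=> s m m0.
  have c := hE [seq (Some p.1, p.2) | p <- s] m m0.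
  have h1 := toF _ _ (@block_pair_cvg s m m0).
  have E (S : Type) (u : option (nat * nat) -> S -> R) :
      (fun w => ramp [seq (Some p.1, p.2) | p <- s] m (u^~ w)) =
      fun w => ramp s m (fun q => u (Some q) w).
    by apply/funext => w; rewrite (ramp_map Some s m (u^~ w)).
  have e : (fun n => Ex P (fun w => ramp [seq (Some p.1, p.2) | p <- s] m (block_pair n ^~ w))) =
      fun n => Ex P (fun w => ramp s m (fun q => block_pair n (Some q) w)).
    by apply/funext => n; rewrite (E _ (block_pair n)).
  rewrite e in c; rewrite -(E _ (fun i x => decode h i x)); exact: cvg_unique c h1.
- move=> s m m0.
  have c := hE (flatten [seq [:: (None, p.2); (Some p.1, p.2)] | p <- s]) m m0.
  have h1 := toF _ _ (@block_pair_max_cvg s m m0).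
  have E (S : Type) (u : option (nat * nat) -> S -> R) :
      (fun w => ramp (flatten [seq [:: (None, p.2); (Some p.1, p.2)] | p <- s]) m
        (u^~ w)) = fun w => ramp s m (fun q => Num.max (u None w) (u (Some q) w)).
    by apply/funext => w; rewrite (ramp_max s (u^~ w) None Some m0).
  have e : (fun n => Ex P (fun w => ramp (flatten [seq [:: (None, p.2); (Some p.1, p.2)] | p <- s]) m (block_pair n ^~ w))) =
      fun n => Ex P (fun w => ramp s m (fun q =>
      Num.max (block_pair n None w) (block_pair n (Some q) w))).
    by apply/funext => n; rewrite (E _ (block_pair n)).
  rewrite e in c; rewrite -(E _ (fun i x => decode h i x)); exact: cvg_unique c h1.
Qed.

End increment_limit.

Lemma cvg_minr (R : realType) (J : Type) (F : set_system J) (FF : Filter F)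
    (f g : J -> R) (b c : R) : f j @[j --> F] --> b -> g j @[j --> F] --> c ->
  Num.min (f j) (g j) @[j --> F] --> Num.min b c.
Proof.
move=> fb gc; rewrite minr_absE; under eq_fun do rewrite minr_absE.
apply: cvgM; last exact: cvg_cst.
by apply: cvgB; [exact: cvgD|apply: cvg_norm; exact: cvgB].
Qed.

Lemma cvg_maxr (R : realType) (J : Type) (F : set_system J) (FF : Filter F)
    (f g : J -> R) (b c : R) : f j @[j --> F] --> b -> g j @[j --> F] --> c ->
  Num.max (f j) (g j) @[j --> F] --> Num.max b c.
Proof.
move=> fb gc; rewrite maxr_absE; under eq_fun do rewrite maxr_absE.
apply: cvgM; last exact: cvg_cst.
by apply: cvgD; [exact: cvgD|apply: cvg_norm; exact: cvgB].
Qed.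

Lemma ramp_cvg (R : realType) (I : choiceType) (J : Type) (F : set_system J)
    (FF : Filter F) (s : seq (I * R)) (m : R) (u : J -> I -> R) (v : I -> R) :
  (forall p, p \in s -> u j p.1 @[j --> F] --> v p.1) ->
  ramp s m (u j) @[j --> F] --> ramp s m v.
Proof.
elim: s => [|p s IHs] uv.
  rewrite ramp_nil; under eq_fun do rewrite ramp_nil; exact: cvg_cst.
rewrite ramp_cons; under eq_fun do rewrite ramp_cons.
have h : p.2 - m * u j p.1 @[j --> F] --> p.2 - m * v p.1.
  apply: cvgB; first exact: cvg_cst.
  by apply: cvgM; [exact: cvg_cst|apply: uv; rewrite mem_head].
have c1 : clamp (p.2 - m * u j p.1) @[j --> F] --> clamp (p.2 - m * v p.1).
  exact: cvg_clamp.
have c2 := IHs (fun q qs => uv q (mem_behead (s := p :: s) qs)).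
exact: cvg_minr c1 c2.
Qed.

Lemma ae_seq (R : realType) (d : measure_display) (T : measurableType d)
    (P : probability T R) (I : eqType) (s : seq I) (A : I -> T -> Prop) :
  (forall i, i \in s -> {ae P, forall w, A i w}) ->
  {ae P, forall w, forall i, i \in s -> A i w}.
Proof.
elim: s => [|i s IHs] h; first by apply: aeW => w i; rewrite in_nil.
have h1 := h i (mem_head _ _).
have h2 := IHs (fun j js => h j (mem_behead (s := i :: s) js)).
by apply: filterS2 h1 h2 => w Ai As j; rewrite inE => /predU1P[->|/As].
Qed.

Lemma ae_enlarge (R : realType) (d : measure_display) (T : measurableType d)
    (P : probability T R) (A : T -> Prop) :
  {ae P, forall w, A w} -> {ae enlarge P, forall x, A x.1}.
Proof.
move=> [N [mN PN sub]]; exists (fst @^-1` N); split.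
- by rewrite -[X in measurable X]setTI; exact: measurable_fst.
- by rewrite enlargeE.
- by move=> x /= Ax; exact: sub.
Qed.

Lemma prob1_ae (R : realType) (d : measure_display) (T : measurableType d)
    (P : probability T R) (B : set T) : measurable B -> P B = 1%E ->
  {ae P, forall w, B w}.
Proof.
move=> mB PB; exists (~` B); split => //; first exact: measurableC.
by rewrite probability_setC// PB subee.
Qed.

(** [psi] is increasing below its pole at [1], hence the strict upper bounds. *)
Lemma psi_max (R : realType) (x y : R) : 0 <= x < 1 -> 0 <= y < 1 ->
  psi (Num.max x y) = Num.max (psi x) (psi y).
Proof.
have le_psi (u v : R) : 0 <= u -> v < 1 -> u <= v -> psi u <= psi v.
  move=> u0 v1 uv; rewrite /psi ler_pM// ?invr_ge0; try lra.
  by rewrite lef_pV2 ?posrE; lra.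
move=> /andP[x0 x1] /andP[y0 y1]; have [xy|/ltW yx] := leP x y;
  apply/esym; [apply/max_idPr|apply/max_idPl]; exact: le_psi.
Qed.

(** * Construction of the increments on the enlarged space *)

Section increments.
Context (R : realType) (d : measure_display) (T : measurableType d)
  (P : probability T R) (X : nat -> {RV P >-> R}) (a : nat -> R).
Context (d' : measure_display) (T' : measurableType d') (Q : probability T' R)
  (Y : R -> {RV Q >-> R}).
Hypothesis X_stationary : stationary X.
Hypothesis a_pinfty : a n @[n --> \oo] --> +oo.
Hypothesis M_cvg : fdd_cvg [set t : R | 0 <= t]
  P (fun n t w => (a n)^-1 * partial_max X (Num.truncn (n%:R * t)) w)
  Q (fun t w => Y t w).
Variable H : R.
Hypothesis H0 : 0 < H.
Hypothesis ratioH : forall c, 0 < c -> ratio a c n @[n --> \oo] --> c `^ H.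
Variable r : R.
Hypothesis r0 : 0 <= r.

Let mphiY t : measurable_fun setT (fun w => phi (Y t w)).
Proof. exact: (measurableT_comp (@measurable_phi R)). Qed.

Lemma increment_dyadic : exists V : nat * nat -> T' * R -> R,
  [/\ forall q, measurable_fun setT (V q), forall q x, 0 <= V q x <= 1,
    forall (s : seq ((nat * nat) * R)) (m : R), 0 <= m ->
      Ex (enlarge Q) (fun x => ramp s m (V^~ x)) =
      Ex Q (fun w => ramp s m (fun q => phi (Y (dyadic R q) w))) &
    forall (s : seq ((nat * nat) * R)) (m : R), 0 <= m ->
      Ex (enlarge Q) (fun x => ramp s m (fun q => Num.max (phi (Y r x.1)) (V q x))) =
      Ex Q (fun w => ramp s m (fun q => phi (Y (r + dyadic R q) w)))].
Proof.
have [h' [hP' h1 h2 h3]] := increment_limit X_stationary a_pinfty M_cvg r0.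
pose xi' : T * R -> R := decode h' (None : option (nat * nat)).
have mxi' : measurable_fun setT xi' by exact: measurable_decode.
have law A : measurable A ->
    Q ((fun w => phi (Y r w)) @^-1` A) = enlarge P (xi' @^-1` A).
  move=> mA; apply/esym.
  apply: (@fdd_eq_marginal _ _ [set: unit] _ _ _ _ _ _ (fun=> xi')
    (fun _ w => phi (Y r w)) _ tt) => //.
  by apply: tests_fdd_eq => // s _ m m0; exact: h1.
have [h [hP hlaw]] := transfer_bits (mphiY r) mxi' law hP'.
pose xi := (fun w => phi (Y r w)) \o (fst : T' * R -> T').
have mxi : measurable_fun setT xi.
  by apply: measurableT_comp; [exact: mphiY|exact: measurable_fst].
(* In the index type [option (option (nat * nat))] the outer [None] is the conditioning variable,
   now [phi (Y(r))] itself, and [Some (Some q)] is the redrawn block at the dyadic time [q]. *)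
have fdd := adjoin_fdd_eq (I := option (nat * nat)) mxi mxi' hP hP' hlaw.
have tst := fdd_eq_tests (fun i _ => measurable_adjoin mxi hP i)
  (fun i _ => measurable_adjoin mxi' hP' i) fdd.
exists (fun q x => decode h (Some q) x); split.
- by move=> q; exact: measurable_decode.
- by move=> q x; exact: decode01.
- move=> s m m0; rewrite -h2//.
  have := tst [seq (Some (Some p.1), p.2) | p <- s] (fun _ _ => Logic.I) m m0.
  have E S (f : option (option (nat * nat)) -> S -> R) :
      (fun w => ramp [seq (Some (Some p.1), p.2) | p <- s] m (f^~ w)) =
      fun w => ramp s m (fun q => f (Some (Some q)) w).
    by apply/funext => w; rewrite (ramp_map (fun q => Some (Some q)) s m (f^~ w)).
  by rewrite !E.
- move=> s m m0; rewrite -h3//.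
  pose s' : seq (option (option (nat * nat)) * R) :=
    flatten [seq [:: (None, p.2); (Some (Some p.1), p.2)] | p <- s].
  have := tst s' (fun _ _ => Logic.I) m m0.
  have E S (f : option (option (nat * nat)) -> S -> R) :
      (fun w => ramp s' m (f^~ w)) =
      fun w => ramp s m (fun q => Num.max (f None w) (f (Some (Some q)) w)).
    by apply/funext => w; rewrite (ramp_max s (f^~ w) None (fun q => Some (Some q)) m0).
  by rewrite !E.
Qed.

Lemma increment_process : exists v : R -> T' * R -> R,
  [/\ forall t, measurable_fun setT (v t), forall t x, 0 <= v t x,
    fdd_eq [set t | 0 <= t] (enlarge Q) v Q (fun t w => phi (Y t w)) &
    fdd_eq [set t | 0 <= t] (enlarge Q)
      (fun t x => Num.max (phi (Y r x.1)) (v t x)) Q (fun t w => phi (Y (t + r) w))].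
Proof.
have [V [mV V01 V1 V2]] := increment_dyadic.
(* The infimum is defined and measurable everywhere. It is almost surely the limit, since [V]
   inherits from the law of [phi (Y)] its monotonicity along the decreasing dyadic times. *)
pose v (t : R) x := inf (range (fun k => V (dyadic_above t k) x)).
have lbV (t : R) x : has_lbound (range (fun k => V (dyadic_above t k) x)).
  by exists 0 => _ [k _ <-]; case/andP: (V01 (dyadic_above t k) x).
have mv (t : R) : measurable_fun setT (v t).
  rewrite (_ : v t = fun x => infs (fun k => V (dyadic_above t k) x) 0).
    by apply: measurable_fun_infs => // x _; exact: lbV.
  apply/funext => x; rewrite /infs /v; congr (inf _).
  by apply/seteqP; split => y [k _ <-]; exists k.
have fddV : fdd_eq setT (enlarge Q) V Q (fun q w => phi (Y (dyadic R q) w)).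
  by apply: tests_fdd_eq => // s _ m m0; exact: V1.
have Vmono (t : R) k : 0 <= t ->
    {ae enlarge Q, forall x, V (dyadic_above t k.+1) x <= V (dyadic_above t k) x}.
  move=> t0; apply: (fdd_eq_ae_le fddV) => //.
  apply: (phi_Y_homo a_pinfty M_cvg); first exact: dyadic_ge0.
  exact: dyadic_above_noninc.
have vcvg (t : R) : 0 <= t ->
    {ae enlarge Q, forall x, V (dyadic_above t k) x @[k --> \oo] --> v t x}.
  move=> t0; have /ae_foralln h : forall k, {ae enlarge Q, forall x,
      V (dyadic_above t k.+1) x <= V (dyadic_above t k) x}.
    by move=> k; exact: Vmono.
  apply: filterS h => x hx; apply: nonincreasing_cvgn => //.
  by apply/nonincreasing_seqP.
have v0 (t : R) x : 0 <= v t x.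
  apply: lb_le_inf; first by exists (V (dyadic_above t 0) x); exists 0%N.
  by move=> _ [k _ <-]; case/andP: (V01 (dyadic_above t k) x).
have aes (s : seq (R * R)) : (forall p, p \in s -> 0 <= p.1) ->
    {ae enlarge Q, forall x, forall p, p \in s ->
      V (dyadic_above p.1 k) x @[k --> \oo] --> v p.1 x}.
  by move=> s0; apply: ae_seq => p ps; apply: vcvg; exact: s0.
have grid (s : seq (R * R)) (m : R) u :
    ramp [seq (dyadic_above p.1 u, p.2) | p <- s] m = 
    fun w : nat * nat -> R => ramp s m (fun t => w (dyadic_above t u)).
  by apply/funext => w; exact: (ramp_map (fun t => dyadic_above t u)).
exists v; split => //.
- apply: tests_fdd_eq => // s s0 m m0.
  have c1 : Ex (enlarge Q) (fun x => ramp s m (fun t => V (dyadic_above t k) x))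
      @[k --> \oo] --> Ex (enlarge Q) (fun x => ramp s m (v^~ x)).
    apply: (@Ex_cvg _ _ _ _ _ _ 1).
    + by move=> k; apply: measurable_ramp.
    + by apply: measurable_ramp.
    + move=> k x; have /andP[? ?] := ramp01 s m (fun t => V (dyadic_above t k) x).
      by rewrite ger0_norm.
    by apply: filterS (aes s s0) => x hx; exact: ramp_cvg.
  have c2 := ramp_Y_cvg X_stationary a_pinfty M_cvg H0 ratioH
    (s := s) (u := fun k t => dyadic R (dyadic_above t k)) (v := id) m0
    (fun p k _ => dyadic_ge0 R _) s0 (fun p ps => dyadic_above_cvg (s0 p ps)).
  have e : (fun k => Ex (enlarge Q) (fun x => ramp s m (fun t => V (dyadic_above t k) x)))
      = fun k => Ex Q (fun w => ramp s m (fun t => phi (Y (dyadic R (dyadic_above t k)) w))).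
    apply/funext => k.
    have := V1 [seq (dyadic_above p.1 k, p.2) | p <- s] m m0.
    by rewrite !grid.
  by rewrite e in c1; exact: cvg_unique c1 c2.
- apply: tests_fdd_eq => // [t _|s s0 m m0].
    apply: measurable_maxr => //.
    by apply: (measurableT_comp (mphiY r)); exact: measurable_fst.
  have c1 : Ex (enlarge Q) (fun x => ramp s m
      (fun t => Num.max (phi (Y r x.1)) (V (dyadic_above t k) x)))
      @[k --> \oo] --> Ex (enlarge Q) (fun x => ramp s m
      (fun t => Num.max (phi (Y r x.1)) (v t x))).
    have mY1 : measurable_fun setT (fun x : T' * R => phi (Y r x.1)).
      by apply: (measurableT_comp (mphiY r)); exact: measurable_fst.
    apply: (@Ex_cvg _ _ _ _ _ _ 1).
    + by move=> k; apply: measurable_ramp => p _; exact: measurable_maxr.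
    + by apply: measurable_ramp => p _; exact: measurable_maxr.
    + move=> k x; have /andP[? ?] := ramp01 s m
        (fun t => Num.max (phi (Y r x.1)) (V (dyadic_above t k) x)).
      by rewrite ger0_norm.
    apply: filterS (aes s s0) => x hx; apply: ramp_cvg => p ps.
    by apply: cvg_maxr; [exact: cvg_cst|exact: hx].
  have rd p : p \in s ->
      r + dyadic R (dyadic_above p.1 k) @[k --> \oo] --> r + p.1.
    by move=> ps; apply: cvgD; [exact: cvg_cst|apply: dyadic_above_cvg; exact: s0].
  have c2 := ramp_Y_cvg X_stationary a_pinfty M_cvg H0 ratioH
    (s := s) (u := fun k t => r + dyadic R (dyadic_above t k)) (v := fun t => r + t) m0
    (fun p k _ => addr_ge0 r0 (dyadic_ge0 R _)) (fun p ps => addr_ge0 r0 (s0 p ps))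
    rd.
  have e : (fun k => Ex (enlarge Q) (fun x => ramp s m
      (fun t => Num.max (phi (Y r x.1)) (V (dyadic_above t k) x))))
      = fun k => Ex Q (fun w => ramp s m
          (fun t => phi (Y (r + dyadic R (dyadic_above t k)) w))).
    apply/funext => k.
    have := V2 [seq (dyadic_above p.1 k, p.2) | p <- s] m m0.
    by rewrite !grid.
  rewrite e in c1.
  transitivity (Ex Q (fun w => ramp s m (fun t => phi (Y (r + t) w)))).
    exact: cvg_unique c1 c2.
  by congr Ex; apply/funext => w; apply: eq_ramp => p _; rewrite addrC.
Qed.

Lemma Y_max_increments : exists (d1 : measure_display) (T1 : measurableType d1)
    (P1 : probability T1 R) (p : T1 -> T') (Yr : R -> {RV P1 >-> R}),
  [/\ measurable_fun setT p,
      forall A : set T', measurable A -> P1 (p @^-1` A) = Q A,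
      fdd_eq [set t | 0 <= t] P1 (fun t w => Yr t w) Q (fun t w => Y t w) &
      fdd_eq [set t | 0 <= t] Q (fun t w => Y (t + r) w)
        P1 (fun t w => Num.max (Y r (p w)) (Yr t w))].
Proof.
have [v [mv v0 vY vmax]] := increment_process.
have mpsi d0 (S : measurableType d0) (f : S -> R) :
    measurable_fun setT f -> measurable_fun setT (fun w => psi (f w)).
  exact: (measurableT_comp (@measurable_psi R)).
pose Yr t : {RV (enlarge Q) >-> R} := mfun_Sub (mem_set (mpsi _ _ _ (mv t))).
have Y_psi t : 0 <= t -> {ae Q, forall w, psi (phi (Y t w)) = Y t w}.
  by move=> t0; apply: filterS (Y_ge0 a_pinfty M_cvg t0) => w; exact: psiK.
have mfst : measurable_fun setT (fst : T' * R -> T') by exact: measurable_fst.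
exists _, (T' * R)%type, (enlarge Q), fst, Yr; split => //.
- by move=> A; exact: enlargeE.
- apply: (fdd_eq_trans (fdd_eq_map (@measurable_psi R) vY)).
  by apply: ae_fdd_eq => // t _; apply: (mpsi _ _ _).
- apply: (@fdd_eq_trans _ _ _ _ _ _ _ _ _ _ (fun t w => psi (phi (Y (t + r) w)))).
    apply: ae_fdd_eq => // [t _|t t0]; first by apply: (mpsi _ _ _); exact: mphiY.
    have tr0 : 0 <= t + r by exact: addr_ge0.
    by apply: filterS (Y_psi _ tr0) => w ->.
  apply: (fdd_eq_trans (fdd_eq_sym (fdd_eq_map (@measurable_psi R) vmax))).
  have mYf : measurable_fun setT (fun x : T' * R => phi (Y r x.1)).
    exact: (measurableT_comp (mphiY r)).
  apply: ae_fdd_eq => [t _|t _|t t0].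
  + by apply: (mpsi _ _ _); exact: measurable_maxr.
  + apply: measurable_maxr; last by apply: (mpsi _ _ _).
    exact: (measurableT_comp (measurable_funPT (Y r))).
  (* By construction [v] might reach [1], where [psi] is not monotone; this is a null event because
     [v t] has the law of [phi (Y(t))]. *)
  have v1 : {ae enlarge Q, forall x, v t x < 1}.
    have m1 : measurable (`]-oo, 1[%classic : set R) by exact: measurable_itv.
    have e1 : enlarge Q (v t @^-1` `]-oo, 1[%classic) = 1%E.
      rewrite (fdd_eq_marginal vY t0 m1) -(probability_setT Q); congr (Q _).
      by apply/seteqP; split=> // w _; rewrite /= in_itv /= phi_lt1.
    have m2 : measurable (v t @^-1` `]-oo, 1[%classic).
      by rewrite -[X in measurable X]setTI; exact: (mv t).
    by apply: filterS (prob1_ae m2 e1) => x; rewrite /= in_itv.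
  apply: filterS2 v1 (ae_enlarge (Y_psi _ r0)) => x vx Yx.
  by rewrite psi_max ?Yx// ?phi_ge0 ?phi_lt1// v0.
Qed.

End increments.

Theorem theorem3p2 (R : realType)
  (d : measure_display) (T : measurableType d) (P : probability T R)
  (X : nat -> {RV P >-> R}) (a : nat -> R)
  (d' : measure_display) (T' : measurableType d') (Q : probability T' R)
  (Y : R -> {RV Q >-> R})
  (X_stationary : stationary X)
  (a_pinfty : a n @[n --> \oo] --> +oo)
  (Y_nondegenerate : forall t : R, 0 <= t -> t != 1 ->
     (Q [set w | Y t w = Y 1%R w] < 1)%E)
  (M_cvg : fdd_cvg [set t : R | 0 <= t]
     P (fun n t w => (a n)^-1 * partial_max X (Num.truncn (n%:R * t)) w)
     Q (fun t w => Y t w)) :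
  exists H : R,
    [/\ 0 < H, self_similar H Y, stationary_max_increments Y,
        continuous_in_probability Y & regularly_varying H a].
Proof.
have [H H0 ratioH] := ratio_power X_stationary a_pinfty Y_nondegenerate M_cvg.
exists H; split => //.
- exact: (Y_self_similar X_stationary a_pinfty M_cvg ratioH).
- by move=> r r0; exact: (Y_max_increments X_stationary a_pinfty M_cvg H0 ratioH r0).
- exact: (Y_continuous_in_probability X_stationary a_pinfty M_cvg H0 ratioH).
- exact: (Y_regularly_varying a_pinfty ratioH).
Qed.
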